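(* Let $W$ be a Weyl group with set of simple reflections $S$, let $s\in S$ be a leaf of the Dynkin diagram, and let $J=S\setminus\{s\}$. Then $v\in {}^JW$ is palindromic if and only if one of the following holds: (1) $v$ is a locally-longest element; (2) $v$ is in a local chain; (3) $W$ is of type $F_4$, $J=S\setminus\{s_4\}$ and $v=s_4s_3s_2s_1$; (4) $W$ is of type $F_4$, $J=S\setminus\{s_1\}$ and $v=s_1s_2s_3s_4$; (5) $W$ is of type $B_n$, $J=S\setminus\{s_0\}$ and $v=s_0s_1\cdots s_k$ for some $0\le k\le n-1$.
   Context: For $K\subseteq S$, $W_K$ is the parabolic subgroup generated by $K$, and ${}^KW$ is the set of minimal length representatives of the right cosets $W_K\backslash W$ (equivalently, elements with no left descent in $K$), with the induced Bruhat order. For $v\in{}^JW$, $v$ is palindromic if the lower interval $\{z\in{}^JW: z\le v\}$ is rank-symmetric, i.e. $\sum_{z\in {}^JW, z\le v} q^{\ell(z)}$ is a palindromic polynomial of degree $\ell(v)$. Let $I\subseteq S$ be the set of simple reflections appearing in a reduced word of $v$. $v$ is locally-longest if $I$ forms a connected subgraph of the Dynkin diagram and $v$ is the longest element of the embedded quotient ${}^{I\cap J}(W_I)$ (minimal length representatives of $W_{I\cap J}\backslash W_I$); $v$ is in a local chain if ${}^{I\cap J}(W_I)$ is a chain poset in Bruhat order. (These are the analogues for ${}^JW$ of the definitions the paper gives for the left quotient $W^J$.) Labelings: $F_4$ has Dynkin diagram $s_1 - s_2 = s_3 - s_4$ (double bond between $s_2,s_3$). $B_n$ has Dynkin diagram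 $s_0 = s_1 - s_2 - \cdots - s_{n-1}$ (double bond between $s_0,s_1$).
   Formalization: ''W is of type F4'' and ''W is of type B_n'' are read as: the connected component of s in the Dynkin diagram is of that type. For irreducible W nothing changes; for reducible W the printed claim fails, e.g. W=F4×A1, s=s4, v=s4s3s2s1. *)

(* Defs.v *)
From HB Require Import structures.
From mathcomp Require Import all_boot all_order all_algebra all_fingroup.
From mathcomp Require Import all_character.

Set Implicit Arguments.
Unset Strict Implicit.
Unset Printing Implicit Defensive.

Import Order.TTheory GRing.Theory Num.Theory.

Section RootSystems.
Local Open Scope ring_scope.
Variables (R : realFieldType) (n : nat).
Implicit Types (a b : 'cV[R]_n) (Phi Delta : seq 'cV[R]_n).

Definition dot a b : R := (a^T *m b) ord0 ord0.

(* The matrix, acting on column vectors, of b |-> b - (2 (a, b) / (a, a)) a. *)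
Definition reflection_mx a : 'M[R]_n := 1%:M - (2%:R / dot a a) *: (a *m a^T).

(* Reduced crystallographic root systems in the Euclidean space R^n. *)
Definition root_system Phi : Prop :=
  [/\ 0 \notin Phi,
      <<Phi>>%VS = fullv,
      {in Phi &, forall a b, reflection_mx a *m b \in Phi},
      {in Phi &, forall a b, exists z : int, 2%:R * dot a b / dot a a = z%:~R}
    & forall a (c : R), a \in Phi -> c *: a \in Phi -> c = 1 \/ c = -1].

Definition root_base Phi Delta : Prop :=
  [/\ {subset Delta <= Phi},
      basis_of fullv Delta
    & {in Phi, forall b, exists c : 'I_(size Delta) -> nat,
        b = \sum_(i < size Delta) Delta`_i *+ c i \/
        b = - \sum_(i < size Delta) Delta`_i *+ c i}].

End RootSystems.

Local Open Scope group_scope.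

(* The group W, identified through a faithful representation rG with a group
   of matrices, is the group generated by the reflections in the roots of a
   root system, and S consists of the reflections in the roots of a base. *)
Definition weyl_group (R : realFieldType) (W : finGroupType) (S : {set W}) :
    Prop :=
  exists n (Phi Delta : seq 'cV[R]_n) (rG : mx_representation R [set: W]%G n),
    [/\ root_system Phi /\ root_base Phi Delta,
        mx_faithful rG,
        {in Phi, forall a, exists x, rG x = reflection_mx a},
        <<[set x | rG x \in map (@reflection_mx R n) Phi]>> = [set: W]
      & S = [set x | rG x \in map (@reflection_mx R n) Delta]].

Section Coxeter.
Variable W : finGroupType.
Implicit Types (S K I J C : {set W}) (s t v w x y z : W).

(* S ^+ k is the set of products of k elements of S.  The search succeeds for
   every w in <<S>> when S consists of involutions, as a shortest word has
   pairwise distinct prefixes and hence fewer than #|W| letters. *)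
Definition cox_length S w : nat := find (fun k => w \in S ^+ k) (iota 0 #|W|).

Definition reflections S : {set W} := class_support S <<S>>.

Definition bruhat S : rel W :=
  connect [rel x y | (x^-1 * y \in reflections S) &&
                      (cox_length S x < cox_length S y)].

(* ^K W_S, for the group W_S = <<S>>: the minimal length representatives of
   the right cosets <<K>> :* w. *)
Definition min_reps S K : {set W} :=
  [set w in <<S>> | [forall u in <<K>> :* w, cox_length S w <= cox_length S u]].

Definition lower_interval S J v : {set W} :=
  [set z in min_reps S J | bruhat S z v].

Definition poincare S J v : {poly int} :=
  (\sum_(z in lower_interval S J v) 'X^(cox_length S z))%R.

Definition palindromic_poly (p : {poly int}) (d : nat) : Prop :=
  size p = d.+1 /\ forall i, i <= d -> (p`_i = p`_(d - i))%R.

Definition palindromic S J v : Prop :=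
  palindromic_poly (poincare S J v) (cox_length S v).

(* Simple reflections that appear in some reduced word of v; all reduced words
   of v involve the same ones. *)
Definition simple_support S v : {set W} :=
  [set s in S | [exists e : (cox_length S v).-tuple W,
     [&& all (mem S) e, \prod_(x <- e) x == v & s \in e]]].

(* Nodes s and t are joined when s t has order m > 2, the bond being single,
   double or triple for m = 3, 4 or 6.  Arrows on multiple bonds play no role
   below. *)
Definition dynkin_edge S : rel W :=
  [rel s t | [&& s \in S, t \in S, s != t & 2 < #[s * t]]].

Definition dynkin_leaf S s : bool :=
  (s \in S) && (#|[set t | dynkin_edge S s t]| == 1)%N.

Definition dynkin_connected I : Prop :=
  {in I &, forall s t, connect (dynkin_edge I) s t}.

Definition dynkin_component S s : {set W} :=
  [set t in S | connect (dynkin_edge S) s t].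

(* The nodes of C, listed in order by l, form a path whose successive bonds
   correspond to the orders listed in m. *)
Definition path_diagram (m : seq nat) C (l : seq W) : Prop :=
  [/\ uniq l, C = [set:: l], size l = (size m).+1
    & forall i j, i < j < size l ->
        #[nth 1 l i * nth 1 l j] = if j == i.+1 then nth 2 m i else 2].

(* s1 - s2 = s3 - s4 *)
Definition typeF4 C s1 s2 s3 s4 : Prop :=
  path_diagram [:: 3; 4; 3] C [:: s1; s2; s3; s4].

(* s_0 = s_1 - s_2 - ... - s_(n-1), with s_i := nth 1 l i *)
Definition typeB n C (l : seq W) : Prop :=
  1 < n /\ path_diagram (4 :: nseq n.-2 3) C l.

Definition locally_longest S J v : Prop :=
  let I := simple_support S v in
  [/\ dynkin_connected I,
      v \in min_reps I (I :&: J)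
    & {in min_reps I (I :&: J), forall u, cox_length I u <= cox_length I v}].

Definition in_local_chain S J v : Prop :=
  let I := simple_support S v in
  {in min_reps I (I :&: J) &, forall x y, bruhat I x y || bruhat I y x}.

End Coxeter.

(* Main.v *)
Require Import Defs.
From HB Require Import structures.
From mathcomp Require Import all_boot all_order all_algebra all_fingroup.
From mathcomp Require Import all_solvable all_character.
From mathcomp Require Import zify ring lra.

Set Implicit Arguments.
Unset Strict Implicit.
Unset Printing Implicit Defensive.

Import Order.TTheory GRing.Theory Num.Theory.
Local Open Scope group_scope.

(* Let I be the support of v.  An element x of the quotient by S :\ s is
   determined by the coefficients M x s r of alpha_s in the roots x(alpha_r);
   their signs tell which r are ascents of x, and right multiplication by a
   simple reflection acts linearly on them.  If v has no ascent in I it is the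
   longest element of the quotient of W_I.  Otherwise the quotient of W_I has
   one element in each of the ranks below the first branching, so palindromicity
   forces as many ranks of [1, v] below v to be singletons.  As I is connected,
   it is a path or a path with one extra node, by exclusion of the affine
   diagrams, and s is a leaf of it.  In types A, B from the long arm and rank 2
   the quotient is a chain; in the spin quotients of B and D and the vector
   quotient of D the coefficients are differences of a short explicit vector,
   and in types E and F the elements are enumerated: two distinct elements
   appear at the same length near v, except for the words of cases (3)-(5).
   Conversely, a product of distinct letters along a path has only its prefixes
   below it in the quotient. *)

(** * Root systems *)

(** Two features of [v] are played against each other. Its support is all of [I], so no proper
    subset of [I] generates a subgroup containing [v]; in the spin models this forces an entry that
    a single letter can move to have moved. And [v] has an ascent, so it is not at the top of the
    quotient of W_I. Together they leave room for two elements of equal length just below [v]. How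
    far below [v] one may look depends on [s]. Having one neighbour, [s] allows at most one element
    in each of the lengths 0, 1 and 2, which suffices for the spin quotients and for type E seen
    from the side node. When the branch node is [b] steps away from [s], lengths up to [b.+1] are
    unique; the vector quotient and type E seen from an end get this larger bound. A double bond has
    two orientations. In the models only the product 2 of its two entries of [A] is used, which
    treats B and C at once; F4 is enumerated for both. Cases (3)-(5) name the component of [s],
    which may be larger than [I]. A multiple bond in a support with at least two bonds also makes
    that component a path, so its type can be read off. *)

(* A r p is the opposite of the Cartan integer, and M w s p the coordinate of
   w(alpha_p) on the simple root alpha_s.  As the s-coordinate of x(alpha_r) is
   M x s r, only the row s of M x matters in the quotient by S :\ s.  The
   last field is what is left of positive definiteness: no affine diagram. *)
Record cartan_action (W : finGroupType) (S : {set W})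
    (A : W -> W -> nat) (M : W -> W -> W -> int) : Prop := CartanAction {
  ca_inv : {in S, forall r, r * r = 1};
  ca_one : {in S &, forall s p, M 1 s p = (s == p)%:R%R};
  ca_mul : forall u w, {in S &, forall s p,
    M (u * w) s p = (\sum_(q in S) M u s q * M w q p)%R};
  ca_simple : {in S & S & S, forall r s p, M r s p =
    (if p == r then - (s == r)%:R
     else (s == p)%:R + (s == r)%:R * (A r p)%:Z)%R};
  ca_sgn : forall w, {in S, forall p, {in S, forall s, (0 <= M w s p)%R} \/
    {in S, forall s, (M w s p <= 0)%R}};
  ca_refl : forall u, {in S &, forall r q,
    {in S, forall s, M u s r = (s == q)%:R%R} -> u * r * u^-1 = q};
  ca_sym : {in S &, forall r p, (A r p == 0%N) = (A p r == 0%N)};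
  ca_posdef : forall c : W -> nat,
    {in S, forall i, 0 < c i ->
      (c i).*2 <= \sum_(j in S | j != i) c j * A i j} ->
    {in S, forall i, c i = 0%N} }.

Section Geometry.
Local Open Scope ring_scope.
Variables (R : realFieldType) (n : nat).
Implicit Types a b c : 'cV[R]_n.

Lemma dotE a b : dot a b = \sum_i a i ord0 * b i ord0.
Proof. by rewrite /dot mxE; apply: eq_bigr => i _; rewrite mxE. Qed.

Lemma dotC a b : dot a b = dot b a.
Proof. by rewrite !dotE; apply: eq_bigr => i _; rewrite mulrC. Qed.

Lemma dotZr a (k : R) b : dot a (k *: b) = k * dot a b.
Proof. by rewrite /dot -scalemxAr mxE. Qed.

Lemma dot_sumr (I : Type) (r : seq I) (P : pred I) (F : I -> 'cV[R]_n) a :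
  dot a (\sum_(i <- r | P i) F i) = \sum_(i <- r | P i) dot a (F i).
Proof.
by rewrite /dot mulmx_sumr summxE.
Qed.

Lemma dot_eq0 a : (dot a a == 0) = (a == 0).
Proof.
apply/idP/eqP => [|->]; last by rewrite dotE big1 // => i _; rewrite mxE mul0r.
rewrite dotE psumr_eq0 => [/allP H|i _]; last by rewrite -expr2 sqr_ge0.
apply/matrixP => i j; rewrite ord1 mxE.
by have := H i (mem_index_enum _); rewrite -expr2 sqrf_eq0 => /eqP.
Qed.

Lemma dot_ge0 a : 0 <= dot a a.
Proof. by rewrite dotE sumr_ge0 // => i _; rewrite -expr2 sqr_ge0. Qed.

Lemma reflection_mxE a b :
  reflection_mx a *m b = b - (2%:R * dot a b / dot a a) *: a.
Proof.
rewrite /reflection_mx mulmxBl mul1mx -scalemxAl -mulmxA; congr (_ - _).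
have -> : a^T *m b = (dot a b)%:M by apply/matrixP => i j; rewrite !ord1 [RHS]mxE eqxx mulr1n.
by rewrite mul_mx_scalar scalerA; congr (_ *: _); rewrite mulrAC.
Qed.

Lemma reflection_mx_self a : a != 0 -> reflection_mx a *m a = - a.
Proof.
rewrite -dot_eq0 reflection_mxE => nz; rewrite mulfK //.
by rewrite scaler_nat mulr2n opprD addrA subrr sub0r.
Qed.

Lemma reflection_mx_tr a : (reflection_mx a)^T = reflection_mx a.
Proof.
by rewrite /reflection_mx linearB /= trmx1 linearZ /= trmx_mul trmxK.
Qed.

Lemma reflection_mx_invol a :
  a != 0 -> reflection_mx a *m reflection_mx a = 1%:M.
Proof.
move=> nz; rewrite {2}/reflection_mx mulmxBr mulmx1 -scalemxAr mulmxA.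
by rewrite reflection_mx_self // mulNmx scalerN opprK /reflection_mx subrK.
Qed.

Lemma reflection_mx_conj (U : 'M[R]_n) a :
  U^T *m U = 1%:M -> U *m reflection_mx a *m U^T = reflection_mx (U *m a).
Proof.
move=> oU; have oU' : U *m U^T = 1%:M by exact: mulmx1C.
rewrite /reflection_mx mulmxBr mulmx1 mulmxBl oU'; congr (_ - _).
have -> : dot (U *m a) (U *m a) = dot a a.
  by rewrite /dot trmx_mul -mulmxA (mulmxA U^T) oU mul1mx.
by rewrite -scalemxAr -scalemxAl trmx_mul !mulmxA.
Qed.

End Geometry.

(** * From the root system to integer coordinates *)

Section Bridge.
Local Open Scope ring_scope.
Variables (R : realFieldType) (W : finGroupType) (S : {set W}) (n : nat).
Variables (Phi Delta : seq 'cV[R]_n).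
Variable rG : mx_representation R [set: W]%G n.
Hypotheses (rPhi : root_system Phi) (rDelta : root_base Phi Delta).
Hypotheses (fG : mx_faithful rG).
Hypothesis reflG : {in Phi, forall a, exists x, rG x = reflection_mx a}.
Hypothesis genG :
  <<[set x | rG x \in map (@reflection_mx R n) Phi]>>%g = [set: W].
Hypothesis SE : S = [set x | rG x \in map (@reflection_mx R n) Delta].

Let m := size Delta.

Let rGM (x y : W) : rG (x * y)%g = rG x *m rG y.
Proof. by rewrite repr_mxM ?inE. Qed.

Let rG_inj (x y : W) : rG x = rG y -> x = y.
Proof. by apply: (mx_faithful_inj fG); rewrite inE. Qed.

Let Phi_nz a : a \in Phi -> a != 0.
Proof. by case: rPhi => n0 _ _ _ _; apply: contraTneq => ->. Qed.

Let Delta_sub : {subset Delta <= Phi}. Proof. by case: rDelta. Qed.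

Let Delta_free : free Delta.
Proof. by case: rDelta => _ /basis_free. Qed.

(** Both properties pass to products and hold for the reflections in roots, which generate W. *)
Let orth_stable (w : W) :
  (rG w)^T *m rG w = 1%:M /\ {in Phi, forall a, rG w *m a \in Phi}.
Proof.
pose H := [set w : W | ((rG w)^T *m rG w == 1%:M) &&
  all (fun a => rG w *m a \in Phi) Phi].
have gH : group_set H.
  apply/group_setP; split.
    rewrite inE repr_mx1 trmx1 mulmx1 eqxx /=.
    by apply/allP => a aP; rewrite mul1mx.
  move=> x y; rewrite !inE => /andP[/eqP ox /allP sx] /andP[/eqP oy /allP sy].
  rewrite rGM trmx_mul -mulmxA (mulmxA (rG x)^T) ox mul1mx oy eqxx /=.
  by apply/allP => a /sy; rewrite -mulmxA => /sx.
have : w \in H.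
  have /subsetP : [set: W] \subset Group gH.
    rewrite -genG gen_subG; apply/subsetP => x; rewrite !inE.
    case/mapP => a aP ->; rewrite reflection_mx_tr reflection_mx_invol ?Phi_nz //.
    rewrite eqxx /=; apply/allP => b bP.
    by case: rPhi => _ _ + _ _; apply.
  by apply; rewrite inE.
by rewrite inE => /andP[/eqP ? /allP].
Qed.

Let orthT (w : W) : rG w^-1%g = (rG w)^T.
Proof.
have [o _] := orth_stable w.
have : rG w^-1%g *m rG w = 1%:M by rewrite -rGM mulVg repr_mx1.
move=> e; have := mulmx1C o => o'.
by rewrite -[LHS]mulmx1 -o' mulmxA e mul1mx.
Qed.

Let ex_sr : exists f : 'I_m -> W, forall i, rG (f i) = reflection_mx Delta`_i.
Proof.
apply: (@fin_all_exists 'I_m (fun=> W) (fun i x => rG x = reflection_mx Delta`_i)) => i.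
by apply: reflG; apply: Delta_sub; rewrite mem_nth.
Qed.

(** W permutes [Phi], and [root_base] writes each root with integer coordinates of one sign; those
    of w(alpha_p) form column p of [M w]. The field and the vectors are not seen again after this
    lemma. *)
Lemma weyl_cartan_action : exists A M, @cartan_action W S A M.
Proof.
have [sr srE] := ex_sr.
have Dnz i : (i < m)%N -> Delta`_i != 0.
  by move=> lt_i; apply: Phi_nz; apply: Delta_sub; rewrite mem_nth.
have indep (k : 'I_m -> R) : \sum_i k i *: Delta`_i = 0 -> forall i, k i = 0.
  move=> e; have /freeP F : free (in_tuple Delta) by exact: Delta_free.
  exact: F _ e.
have indep2 (k l : 'I_m -> R) :
  \sum_i k i *: Delta`_i = \sum_i l i *: Delta`_i -> k =1 l.
  move=> e i; apply/eqP; rewrite -subr_eq0; apply/eqP.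
  apply: (indep (fun i => k i - l i)).
  under eq_bigr do rewrite scalerBl.
  by rewrite sumrB e subrr.
have deltaE (i : 'I_m) : Delta`_i = \sum_j (j == i)%:R *: Delta`_j.
  rewrite (bigD1 i) //= eqxx scale1r big1 ?addr0 // => j /negPf ->.
  by rewrite scale0r.
have sr_inj : injective sr.
  move=> i j eij; apply/eqP; apply: contraT => nij.
  (* Equal reflections would give -alpha_i = alpha_i - k alpha_j, and the coordinates on alpha_i
     would give -1 = 1. *)
  have E : reflection_mx Delta`_i *m Delta`_i = reflection_mx Delta`_j *m Delta`_i.
    by rewrite -!srE eij.
  move: E; rewrite reflection_mx_self ?Dnz // reflection_mxE.
  set k := (X in X *: _) => E.
  have /indep2 /(_ i) : \sum_l - ((l == i)%:R : R) *: Delta`_l =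
      \sum_l ((l == i)%:R - k * (l == j)%:R) *: Delta`_l.
    under [in LHS]eq_bigr do rewrite scaleNr.
    under [in RHS]eq_bigr do rewrite scalerBl -scalerA.
    by rewrite sumrN sumrB -scaler_sumr -!deltaE.
  rewrite eqxx (negPf nij) mulr0 subr0 => /eqP.
  by rewrite eq_sym -subr_eq0 opprK -(natrD _ 1 1) pnatr_eq0.
have SE' : S = [set sr i | i in 'I_m].
  apply/setP => x; rewrite SE inE; apply/mapP/imsetP => [[a aD e]|[i _ ->]].
    have lt : (index a Delta < m)%N by rewrite index_mem.
    exists (Ordinal lt) => //; apply: rG_inj.
    by rewrite e srE /= nth_index.
  by exists Delta`_i; rewrite ?srE // mem_nth.
(* The simple root of a simple reflection, by inverting [sr]; on [S] the default 0 is never met. *)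
pose rt (s : W) := if [pick i | sr i == s] is Some i then Delta`_(i : 'I_m) else 0.
have rtE i : rt (sr i) = Delta`_i.
  by rewrite /rt; case: pickP => [j /eqP /sr_inj -> //|/(_ i)]; rewrite eqxx.
have sumE (V : nmodType) (F : W -> V) : \sum_(s in S) F s = \sum_i F (sr i).
  by rewrite SE' big_imset //= => ? ? _ _; apply: sr_inj.
have Sex s : s \in S -> exists i, s = sr i.
  by rewrite SE' => /imsetP[i _ ->]; exists i.
have rtP s : s \in S -> rt s \in Phi.
  by move=> /Sex[i ->]; rewrite rtE; apply: Delta_sub; rewrite mem_nth.
have rGrt s : s \in S -> rG s = reflection_mx (rt s).
  by move=> /Sex[i ->]; rewrite rtE srE.
have ind (k l : W -> R) : \sum_(s in S) k s *: rt s = \sum_(s in S) l s *: rt s ->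
    {in S, k =1 l}.
  rewrite !sumE => e s /Sex[i ->].
  apply: (indep2 (k \o sr) (l \o sr)).
  by under eq_bigr do rewrite /= -rtE; under [RHS]eq_bigr do rewrite /= -rtE.
have rtd p : p \in S -> rt p = \sum_(s in S) ((s == p)%:R : R) *: rt s.
  move=> pS; rewrite (bigD1 p) //= eqxx scale1r big1 ?addr0 // => j.
  by case/andP=> _ /negPf->; rewrite scale0r.
(* Finite choice needs a total function of the pair (w, p), hence an arbitrary value for p outside
   [S]. *)
have exM (x : W * W) : exists f : {ffun W -> int}, x.2 \in S ->
   rG x.1 *m rt x.2 = \sum_(s in S) (f s)%:~R *: rt s /\
   ({in S, forall s, 0 <= f s} \/ {in S, forall s, f s <= 0}).
  case: (boolP (x.2 \in S)) => [pS|_]; last by exists [ffun=> 0].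
  have bP : rG x.1 *m rt x.2 \in Phi by case: (orth_stable x.1) => _; apply; apply: rtP.
  case: rDelta => _ _ /(_ _ bP)[c cE].
  pose g s : nat := if [pick i | sr i == s] is Some i then c i else 0%N.
  have gE i : g (sr i) = c i.
    by rewrite /g; case: pickP => [j /eqP /sr_inj -> //|/(_ i)]; rewrite eqxx.
  case: cE => ->.
    exists [ffun s => (g s)%:Z] => _; split; last by left=> s _; rewrite ffunE.
    rewrite sumE; apply: eq_bigr => i _.
    by rewrite ffunE gE rtE -scaler_nat.
  exists [ffun s => - (g s)%:Z] => _; split; last by right=> s _; rewrite ffunE oppr_le0.
  rewrite sumE -sumrN; apply: eq_bigr => i _.
  by rewrite ffunE gE rtE mulrNz scaleNr -scaler_nat.
have [F FE] := fin_all_exists exM.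
pose M w s p := F (w, p) s.
have ME w p : p \in S -> rG w *m rt p = \sum_(s in S) (M w s p)%:~R *: rt s.
  by move=> pS; case: (FE (w, p) pS).
have Mu w p (k : W -> R) : p \in S -> rG w *m rt p = \sum_(s in S) k s *: rt s ->
    {in S, forall s, (M w s p)%:~R = k s}.
  by move=> pS e; apply: ind; rewrite -ME.
have nzrt r : r \in S -> dot (rt r) (rt r) != 0.
  by move=> rS; rewrite dot_eq0 Phi_nz ?rtP.
have rexp r p : r \in S -> p \in S -> rG r *m rt p = \sum_(s in S)
   ((s == p)%:R + (s == r)%:R * - (2%:R * dot (rt r) (rt p) / dot (rt r) (rt r))) *: rt s.
  move=> rS pS; rewrite rGrt // reflection_mxE.
  under eq_bigr do rewrite scalerDl mulrC -scalerA.
  by rewrite big_split /= -scaler_sumr -!rtd // scaleNr.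
pose A r p := `|M r r p|%N.
(* The alpha_p coordinate of r(alpha_p) is 1, so this root is positive and its alpha_r coordinate is
   nonnegative. *)
have Mrr r p : r \in S -> p \in S -> p != r -> 0 <= M r r p.
  move=> rS pS npr; have [_ /= [H|H]] := FE (r, p) pS; first exact: H.
  have := H p pS; rewrite -(ler_int R) -/(M r p p).
  rewrite (Mu _ _ _ pS (rexp _ _ rS pS)) // eqxx (negPf npr) mul0r addr0.
  by rewrite ler10.
have Ae r p : r \in S -> p \in S -> p != r ->
   (A r p)%:R = - (2%:R * dot (rt r) (rt p) / dot (rt r) (rt r)).
  move=> rS pS npr; rewrite /A natr_absz ger0_norm ?Mrr // (Mu _ _ _ pS (rexp _ _ rS pS)) //.
  by rewrite eqxx eq_sym (negPf npr) add0r mul1r.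
exists A, M; split.
- move=> r rS; apply: rG_inj; rewrite rGM rGrt // repr_mx1 reflection_mx_invol //.
  by rewrite Phi_nz ?rtP.
- move=> s p sS pS; apply: (@intr_inj R).
  rewrite (Mu _ _ (fun s => (s == p)%:R) pS) ?repr_mx1 ?mul1mx -?rtd //.
  by case: (s == p).
- move=> u w s p sS pS; apply: (@intr_inj R).
  rewrite rmorph_sum /=; under eq_bigr do rewrite rmorphM /=.
  apply: (Mu _ _ (fun s => \sum_(q in S) (M u s q)%:~R * (M w q p)%:~R)) => //.
  rewrite rGM -mulmxA ME // mulmx_sumr.
  under eq_bigr => q qS do rewrite -scalemxAr ME // scaler_sumr.
  rewrite exchange_big /=; apply: eq_bigr => t tS.
  rewrite scaler_suml; apply: eq_bigr => q qS.
  by rewrite scalerA mulrC.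
- move=> r s p rS sS pS; apply: (@intr_inj R).
  rewrite (Mu _ _ _ pS (rexp _ _ rS pS)) //.
  have [->|npr] := eqVneq p r.
    by rewrite mulfK ?nzrt //; case: (s == r) => //=; ring.
  rewrite -Ae // rmorphD rmorphM /=; congr (_ + _ * _).
  - by case: (s == p).
  - by case: (s == r).
- by move=> w p pS; case: (FE (w, p) pS).
- move=> u r q rS qS H; apply: rG_inj.
  have e : rG u *m rt r = rt q.
    rewrite ME // (rtd q) //; apply: eq_bigr => s sS.
    by rewrite H //; case: (s == q).
  have [o _] := orth_stable u.
  by rewrite !rGM orthT (rGrt r) // reflection_mx_conj // e -rGrt.
- move=> r p rS pS; have [->//|npr] := eqVneq p r.
  rewrite -!(eqr_nat R) (Ae r p) // (Ae p r) //; last by rewrite eq_sym.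
  move: (nzrt r rS) (nzrt p pS).
  rewrite /= mulr0n !oppr_eq0 !mulf_eq0 !invr_eq0 => /negPf-> /negPf->.
  by rewrite !pnatr_eq0 /= !orbF dotC.
- move=> c H.
  (* For the vector x with coordinates [c], the inequality at i says (alpha_i, x) <= 0. Summing with
     the weights [c] gives (x, x) <= 0, so x = 0, and [c] vanishes as the base is free. *)
  pose x := \sum_(j in S) (c j)%:R *: rt j.
  have dx i : i \in S -> (0 < c i)%N -> dot (rt i) x <= 0.
    move=> iS ci; rewrite /x dot_sumr (bigD1 i) //= dotZr.
    have di : 0 < dot (rt i) (rt i) by rewrite lt_def nzrt // dot_ge0.
    have -> : \sum_(j in S | j != i) dot (rt i) ((c j)%:R *: rt j) =
       - (dot (rt i) (rt i) / 2%:R) * (\sum_(j in S | j != i) c j * A i j)%N%:R.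
      rewrite natr_sum mulr_sumr; apply: eq_bigr => j /andP[jS nji].
      rewrite dotZr natrM Ae //; field.
      by rewrite nzrt.
    have : ((c i).*2%:R : R) <= (\sum_(j in S | j != i) c j * A i j)%N%:R.
      by rewrite ler_nat H.
    rewrite -mul2n natrM; nra.
  have xx : dot x x <= 0.
    rewrite {1}/x dotC dot_sumr sumr_le0 // => i iS.
    rewrite dotZr; case: (posnP (c i)) => [->|ci]; first by rewrite mul0r.
    by rewrite dotC mulr_ge0_le0 // dx.
  have /eqP x0 : x == 0 by rewrite -dot_eq0 eq_le xx dot_ge0.
  have E : {in S, (fun s => (c s)%:R : R) =1 (fun=> 0)}.
    by apply: ind; rewrite -/x x0 big1 // => s _; rewrite scale0r.
  by move=> i /E /eqP; rewrite pnatr_eq0 => /eqP.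
Qed.

End Bridge.

(** * Lengths and Bruhat order *)

(* Keeps only the arithmetic hypotheses, and abstracts lengths and sizes up to
   conversion, because lia does not identify convertible atoms. *)
Ltac slia :=
  repeat match goal with
  | H : @eq ?T ?a ?b |- _ => unify T nat; change (@eq nat a b) in H; revert H
  | H : is_true (leq _ _) |- _ => revert H
  | H : is_true (leq _ _ && leq _ _) |- _ => revert H
  | H : is_true (~~ (@eq_op ?T _ _)) |- _ =>
      unify (Equality.sort T) nat; revert H
  end;
  repeat match goal with
  | |- context [cox_length ?S ?w] => move: (cox_length S w) => ?
  | |- context [@size ?T ?s] => move: (@size T s) => ?
  end;
  clear; lia.

Section Words.
Variable W : finGroupType.
Implicit Types (K : {set W}) (w : W) (e : seq W).

Definition wprod e : W := \prod_(x <- e) x.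

Lemma wprod_nil : wprod [::] = 1. Proof. exact: big_nil. Qed.

Lemma wprod_cons x e : wprod (x :: e) = x * wprod e.
Proof. exact: big_cons. Qed.

Lemma wprod_cat e1 e2 : wprod (e1 ++ e2) = wprod e1 * wprod e2.
Proof. exact: big_cat. Qed.

Lemma wprod_rcons e x : wprod (rcons e x) = wprod e * x.
Proof. by rewrite -cats1 wprod_cat wprod_cons wprod_nil mulg1. Qed.

Lemma mem_wprod K e : all (mem K) e -> wprod e \in <<K>>.
Proof.
elim: e => [|x e IHe] /=; first by rewrite wprod_nil group1.
by case/andP=> xK /IHe; rewrite wprod_cons; apply: groupM; apply: mem_gen.
Qed.

Lemma gen_word K w : w \in <<K>> -> exists2 e, all (mem K) e & wprod e = w.
Proof.
case/gen_prodgP => n [c cK ->]; exists [seq c i | i <- index_enum 'I_n].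
  by apply/allP => _ /mapP[i _ ->]; apply: cK.
by rewrite /wprod big_map.
Qed.

Lemma expg_word K k w :
  reflect (exists2 e, all (mem K) e /\ size e = k & wprod e = w) (w \in K ^+ k).
Proof.
elim: k w => [|k IHk] w.
  rewrite expg0 inE; apply: (iffP eqP) => [->|[e [_ /size0nil->] <-]].
    by exists [::]; rewrite ?wprod_nil.
  exact: wprod_nil.
rewrite expgS; apply: (iffP mulsgP) => [[x y xK yK ->]|].
  have /IHk[e [eK se] <-] : y \in K ^+ k := yK.
  by exists (x :: e); rewrite ?wprod_cons //= se; split=> //; apply/andP.
case=> -[|x e] [] //= /andP[xK eK] [se] <-; rewrite wprod_cons.
by exists x (wprod e) => //; apply/IHk; exists e.
Qed.

Lemma cox_length_le K e : all (mem K) e -> cox_length K (wprod e) <= size e.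
Proof.
(* For a word of at least [#|W|] letters the bound holds because [find] never exceeds the length of
   the list searched. *)
move=> eK; rewrite /cox_length; have [lt|ge] := ltnP (size e) #|W|; last first.
  by apply: leq_trans ge; rewrite -[X in _ <= X](size_iota 0) find_size.
rewrite leqNgt; apply/negP => lt_f; have := before_find 0%N lt_f.
by rewrite nth_iota // add0n => /expg_word[]; exists e.
Qed.

Lemma cox_length_word K w : w \in <<K>> ->
  exists2 e, all (mem K) e /\ size e = cox_length K w & wprod e = w.
Proof.
move=> wK.
have ex : exists k, w \in K ^+ k.
  by have [e eK ew] := gen_word wK; exists (size e); apply/expg_word; exists e.
case: (ex_minnP ex) => k /expg_word[e [eK se] ew] mink.
have ltk : k < #|W|.
  (* Two equal prefixes of a shortest word could be spliced into a shorter one. So its k + 1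
     prefixes are distinct and the bounded search finds k. *)
  pose F (i : 'I_k.+1) := wprod (take i e).
  have injF : injective F.
    suff lt (i j : 'I_k.+1) : i < j -> F i <> F j.
      move=> i j eF; apply/val_inj; case: (ltngtP i j) => // [/lt|/lt] //.
      by move=> n; case: n.
    move=> ltij eF.
    have : w \in K ^+ (i + (k - j)).
      apply/expg_word; exists (take i e ++ drop j e).
        rewrite all_cat; split.
          apply/andP; split; apply/allP => x.
            by move/mem_take; apply: (allP eK).
          by move/mem_drop; apply: (allP eK).
        by rewrite size_cat size_drop size_takel se // -ltnS.
      by rewrite wprod_cat -/(F i) eF -wprod_cat cat_take_drop.
    by move/mink; have := ltn_ord j; lia.
  by have := leq_card F injF; rewrite card_ord.
have hs : has (fun k => w \in K ^+ k) (iota 0 #|W|).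
  apply/hasP; exists k; first by rewrite mem_iota.
  by apply/expg_word; exists e.
have := nth_find 0%N hs; rewrite nth_iota; last by rewrite -[X in _ < X](size_iota 0) -has_find.
by move/expg_word.
Qed.

Lemma cox_length1 K : cox_length K 1 = 0%N.
Proof. by apply/eqP; rewrite -leqn0 -wprod_nil; apply: cox_length_le. Qed.

Lemma cox_length_eq0 K w : w \in <<K>> -> cox_length K w = 0%N -> w = 1.
Proof.
by move=> /cox_length_word[e [_ <-] <-] /size0nil->; rewrite wprod_nil.
Qed.

Lemma cox_lengthM K u w : u \in <<K>> -> w \in <<K>> ->
  cox_length K (u * w) <= cox_length K u + cox_length K w.
Proof.
move=> /cox_length_word[e [eK <-] <-] /cox_length_word[d [dK <-] <-].
by rewrite -wprod_cat -size_cat cox_length_le // all_cat eK.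
Qed.

Lemma cox_length_gen K r : r \in K -> cox_length K r <= 1.
Proof.
move=> rK; have := @cox_length_le K [:: r].
by rewrite wprod_cons wprod_nil mulg1; apply; rewrite /= andbT.
Qed.

End Words.

Section CoxeterTheory.
Variables (W : finGroupType) (S : {set W}) (A : W -> W -> nat).
Variable M : W -> W -> W -> int.
Hypothesis ca : cartan_action S A M.
Implicit Types (K I J : {set W}) (u v w x y : W) (e : seq W).

Local Notation len := (cox_length S).

Let inv : {in S, forall r, r * r = 1} := ca_inv ca.

Lemma simple_invg r : r \in S -> r^-1 = r.
Proof. by move=> /inv e; apply/eqP; rewrite eq_invg_mul e. Qed.

Lemma simple_mulK r w : r \in S -> w * r * r = w.
Proof. by move=> /inv e; rewrite -mulgA e mulg1. Qed.

(** Says that w(alpha_r) is a positive root; [pos_root_len] shows that this means that r is a right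
    ascent of w. *)
Definition pos_root w r : bool := [forall s in S, (0 <= M w s r)%R].

Lemma pos_rootP w r : reflect {in S, forall s, (0 <= M w s r)%R} (pos_root w r).
Proof. by apply: (iffP forall_inP). Qed.

Lemma pos_rootN w r : r \in S -> ~~ pos_root w r ->
  {in S, forall s, (M w s r <= 0)%R}.
Proof. by move=> rS; case: (ca_sgn ca w rS) => // /pos_rootP ->. Qed.

(** A diagonal entry of the inverse relation. It shows that roots are nonzero and, the entries being
    integers, that a positive root proportional to a simple root is that simple root. *)
Lemma mul_sumE w r : r \in S -> (\sum_(q in S) M w^-1 r q * M w q r = 1)%R.
Proof. by move=> rS; rewrite -(ca_mul ca) // mulVg (ca_one ca) // eqxx. Qed.

Lemma root_nz w r : r \in S -> ~ {in S, forall s, M w s r = 0%R}.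
Proof.
move=> rS H; have := mul_sumE w rS.
by rewrite big1 // => q qS; rewrite H // mulr0.
Qed.

Lemma M_mulr w r s p : r \in S -> s \in S -> p \in S ->
  M (w * r) s p = (if p == r then - M w s r
                   else M w s p + (A r p)%:Z * M w s r)%R.
Proof.
move=> rS sS pS; rewrite (ca_mul ca) // (bigD1 r) //= (ca_simple ca rS rS pS).
have E (q : W) : q \in S -> q != r -> M r q p = ((p != r) && (q == p))%:R%R.
  move=> qS nqr; rewrite (ca_simple ca rS qS pS) (negPf nqr) mul0r addr0.
  by case: eqP => //= _; rewrite oppr0.
move: E; have [->|npr] := eqVneq p r => E.
  rewrite ?eqxx mulrN1 big1 ?addr0 // => q /andP[qS nqr].
  by rewrite E // mulr0.
rewrite ?[r == p]eq_sym ?(negPf npr) ?eqxx add0r mul1r (bigD1 p) ?pS ?npr //=.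
rewrite E //= eqxx mulr1 big1 => [|q /andP[/andP[qS nqr] nqp]].
  by rewrite addr0 addrC [(M w s r * _)%R]mulrC.
by rewrite E //= (negPf nqp) mulr0.
Qed.

Lemma M_mull w a s p : a \in S -> s \in S -> p \in S -> s != a ->
  M (a * w) s p = M w s p.
Proof.
move=> aS sS pS nsa; rewrite (ca_mul ca) // (bigD1 s) //= (ca_simple ca aS sS sS).
rewrite (negPf nsa) eqxx mul0r addr0 /= mul1r big1 ?addr0 // => q /andP[qS nqs].
rewrite (ca_simple ca aS sS qS) (negPf nsa) oppr0 [s == q]eq_sym (negPf nqs).
by rewrite mul0r addr0; case: ifP; rewrite mul0r.
Qed.

Lemma pos_root_mulr w r : r \in S -> pos_root (w * r) r = ~~ pos_root w r.
Proof.
move=> rS; case: (boolP (pos_root w r)) => [/pos_rootP H|H].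
  apply/negP => /pos_rootP H'; apply: (@root_nz w r) => // s sS.
  by have := H _ sS; have := H' _ sS; rewrite M_mulr // eqxx; lia.
apply/pos_rootP => s sS; rewrite M_mulr // eqxx oppr_ge0.
exact: (pos_rootN rS H).
Qed.

Lemma pos_root1 r : r \in S -> pos_root 1 r.
Proof. by move=> rS; apply/pos_rootP => s sS; rewrite (ca_one ca). Qed.

(** Left multiplication by a changes only the alpha_a coordinate. If it makes a positive root
    negative, the other coordinates vanish, and [mul_sumE] makes the remaining one an invertible
    nonnegative integer. *)
Lemma simple_root_of_sign_change a w p : a \in S -> p \in S ->
  pos_root w p -> ~~ pos_root (a * w) p ->
  {in S, forall s, M w s p = (s == a)%:R%R}.
Proof.
move=> aS pS /pos_rootP Hp /(pos_rootN pS) Hn.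
have Z s : s \in S -> s != a -> M w s p = 0%R.
  by move=> sS nsa; have := Hn s sS; rewrite M_mull //; have := Hp s sS; lia.
have := mul_sumE w pS; rewrite (bigD1 a) //= big1 => [|q /andP[qS nqa]]; last first.
  by rewrite Z // mulr0.
rewrite addr0 => E s sS; case: eqVneq => [->|/Z->//].
rewrite ?eqxx mulr1n.
have := Hp a aS; move: (M w a p) (M w^-1 p a) E; clear=> x y E x0.
have y0 : (0 <= y)%R by nia.
case: x y E x0 y0 => [x|x] [y|y] // E _ _; congr Posz.
by move/eqP: E; rewrite -PoszM eqz_nat muln_eq1 => /andP[_ /eqP].
Qed.

(** When the letters of [e] are applied from the right to u(alpha_r), some letter a makes the root
    negative. Just before, it is alpha_a, so u r u^-1 is a conjugate of a by the letters already
    applied, and multiplying by it cancels this occurrence of a. *)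
Lemma exchange e u r : all (mem S) e -> r \in S -> pos_root u r ->
  ~~ pos_root (wprod e * u) r ->
  exists2 i, i < size e &
    wprod e * (u * r * u^-1) = wprod (take i e ++ drop i.+1 e).
Proof.
elim: e => [|a e IHe] /= eS rS pu; first by rewrite wprod_nil mul1g pu.
case/andP: eS => aS eS; rewrite wprod_cons -mulgA => nau.
case: (boolP (pos_root (wprod e * u) r)) => [peu|neu].
  exists 0%N => //=; rewrite drop0.
  have := ca_refl ca rS aS (simple_root_of_sign_change aS rS peu nau).
  move=> E.
  rewrite -mulgA; have -> : wprod e * (u * r * u^-1) = a * wprod e.
    by rewrite -E invMg !mulgA mulgKV.
  by rewrite mulgA inv // mul1g.
have [i lti Ei] := IHe eS rS pu neu; exists i.+1 => //=.
by rewrite -mulgA Ei wprod_cons.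
Qed.

Lemma size_delete (T : Type) (s : seq T) i : i < size s ->
  (size (take i s ++ drop i.+1 s)).+1 = size s.
Proof. by move=> lti; rewrite size_cat size_drop size_take lti; lia. Qed.

Lemma delete_subseq (T : eqType) (s : seq T) i :
  subseq (take i s ++ drop i.+1 s) s.
Proof.
rewrite -{3}(cat_take_drop i s) cat_subseq //.
by rewrite -add1n -drop_drop; exact: drop_subseq.
Qed.

Lemma all_subseq (T : eqType) (P : pred T) (s1 s2 : seq T) :
  subseq s1 s2 -> all P s2 -> all P s1.
Proof. by move=> /mem_subseq H /allP Q; apply/allP => x /H /Q. Qed.

Section Parabolic.
Variable K : {set W}.
Hypothesis KS : K \subset S.

Lemma all_sub e : all (mem K) e -> all (mem S) e.
Proof. by apply: sub_all => x; apply: (subsetP KS). Qed.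

Lemma gen_sub w : w \in <<K>> -> w \in <<S>>.
Proof. exact: subsetP (genS KS) w. Qed.

Let KSm r : r \in K -> r \in S. Proof. exact: (subsetP KS). Qed.

Lemma cox_length_desc_K w r : w \in <<K>> -> r \in K -> ~~ pos_root w r ->
  cox_length K (w * r) < cox_length K w.
Proof.
move=> /cox_length_word[e [eK <-] <-] rK nw.
have := @exchange e 1 r (all_sub eK) (KSm rK) (pos_root1 (KSm rK)).
rewrite mulg1 mul1g invg1 mulg1 => /(_ nw) [i lti ->].
rewrite -(size_delete lti) ltnS cox_length_le //.
exact: all_subseq (delete_subseq e i) eK.
Qed.

Lemma M_parabolic w s p : w \in <<K>> -> s \in S -> s \notin K -> p \in S ->
  M w s p = (s == p)%:R%R.
Proof.
move=> /gen_word[e eK <-] sS nsK pS.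
elim: e eK => [|a e IHe] /=; first by rewrite wprod_nil (ca_one ca).
case/andP=> aK eK; have nsa : s != a by apply: contraNneq nsK => ->.
by rewrite wprod_cons M_mull ?IHe // KSm.
Qed.

End Parabolic.

Lemma len_desc w r : w \in <<S>> -> r \in S -> ~~ pos_root w r ->
  len w = (len (w * r)).+1.
Proof.
move=> wS rS nw; apply/eqP; rewrite eqn_leq (cox_length_desc_K _ wS) // andbT.
rewrite -{1}(simple_mulK w rS) -addn1.
have rG := mem_gen rS; apply: leq_trans (cox_lengthM (groupM wS rG) rG) _.
by rewrite leq_add2l cox_length_gen.
Qed.

Lemma len_asc w r : w \in <<S>> -> r \in S -> pos_root w r ->
  len (w * r) = (len w).+1.
Proof.
move=> wS rS pw; rewrite (@len_desc (w * r) r) ?simple_mulK //; first by rewrite groupM // mem_gen.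
by rewrite pos_root_mulr // negbK.
Qed.

(** The sign of a root does not depend on the subgroup: the last letter of a shortest word over [K]
    is an ascent of the preceding product, so it also adds one to the length over [S]. *)
Lemma cox_length_K K w : K \subset S -> w \in <<K>> -> cox_length K w = len w.
Proof.
move=> KS; move: {2}(cox_length K w) (erefl (cox_length K w)) => k.
elim: k w => [|k IHk] w ek wK.
  by rewrite (cox_length_eq0 wK ek) !cox_length1.
have [e [eK se] ew] := cox_length_word wK.
case/lastP: e eK se ew => [|e r]; first by rewrite ek.
rewrite all_rcons size_rcons wprod_rcons => /andP[rK eK] se ew.
have e'K := mem_wprod eK.
have le1 := cox_lengthM e'K (mem_gen rK).
have le2 := cox_length_le eK.
have le3 := cox_length_gen rK.
rewrite ew ek in le1; rewrite ek in se.
have e1 : cox_length K (wprod e) = k.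
  by case: se => se; apply: anti_leq; rewrite -{1}se le2 -ltnS (leq_trans le1) // -addn1 leq_add2l.
have pw : pos_root (wprod e) r.
  apply: contraT => /(cox_length_desc_K KS e'K rK); rewrite ew ek e1; slia.
by rewrite ek -ew len_asc ?(gen_sub KS) ?(subsetP KS) // -IHk ?e1.
Qed.

Lemma reduced_word_K K w : K \subset S -> w \in <<K>> ->
  exists2 e, all (mem K) e /\ size e = len w & wprod e = w.
Proof. by move=> KS wK; have := cox_length_word wK; rewrite cox_length_K. Qed.

Lemma pos_root_len w r : w \in <<S>> -> r \in S ->
  pos_root w r = (len w < len (w * r)).
Proof.
move=> wS rS; case: (boolP (pos_root w r)) => H; first by rewrite len_asc ?leqnn.
by rewrite (len_desc wS rS H); apply/esym/negbTE; rewrite -leqNgt.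
Qed.

Lemma wprod_rev e : all (mem S) e -> wprod (rev e) = (wprod e)^-1.
Proof.
elim: e => [|a e IHe] /=; first by rewrite wprod_nil invg1.
by case/andP=> aS /IHe; rewrite rev_cons wprod_rcons wprod_cons invMg (simple_invg aS) => ->.
Qed.

Lemma len_inv w : w \in <<S>> -> len w^-1 = len w.
Proof.
suff le v : v \in <<S>> -> len v^-1 <= len v.
  by move=> wS; apply/eqP; rewrite eqn_leq le //= -{1}(invgK w) le ?groupV.
move=> /cox_length_word[e [eS <-] <-].
by rewrite -wprod_rev // -size_rev cox_length_le // all_rev.
Qed.

Lemma pos_root_lenl w r : w \in <<S>> -> r \in S ->
  pos_root w^-1 r = (len w < len (r * w)).
Proof.
move=> wS rS; rewrite pos_root_len ?groupV // len_inv //.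
by rewrite -{1}(simple_invg rS) -invMg len_inv // groupM // mem_gen.
Qed.

Lemma descent_exists K w : K \subset S -> w \in <<K>> -> w != 1 ->
  exists r, [/\ r \in K, ~~ pos_root w r & w * r \in <<K>>].
Proof.
move=> KS wK nw1; have [e [eK se] ew] := reduced_word_K KS wK.
case/lastP: e eK se ew nw1 => [|e r].
  by rewrite wprod_nil => _ _ <-; rewrite eqxx.
rewrite all_rcons size_rcons wprod_rcons => /andP[rK eK] se ew _.
have rS := subsetP KS _ rK.
exists r; split=> //; last by rewrite groupM // mem_gen.
rewrite pos_root_len ?(gen_sub KS) // -leqNgt -{1}ew simple_mulK //.
by rewrite -se; apply: leqW; apply: cox_length_le; apply: all_sub KS _ eK.
Qed.

Lemma reflectionsP K t : K \subset S -> t \in reflections K ->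
  exists u r, [/\ r \in K, u \in <<K>>, t = u * r * u^-1 & pos_root u r].
Proof.
move=> KS /imset2P[r y rK yK ->]; have rS := subsetP KS _ rK.
have [H|H] := boolP (pos_root y^-1 r).
  by exists y^-1, r; rewrite groupV invgK conjgE mulgA.
exists (y^-1 * r), r; split=> //; first by rewrite groupM ?groupV // mem_gen.
  by rewrite invMg invgK (simple_invg rS) conjgE !mulgA simple_mulK.
by rewrite pos_root_mulr.
Qed.

Lemma strong_exchange e t : all (mem S) e -> t \in reflections S ->
  len (wprod e * t) < len (wprod e) ->
  exists2 i, i < size e & wprod e * t = wprod (take i e ++ drop i.+1 e).
Proof.
move=> eS /(reflectionsP (subxx S))[u [r [rS uS -> pu]]] lt.
(* If y u(alpha_r) were positive, with y the product of [e] and t = u r u^-1, then [exchange] on a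
   shortest word of y t would delete a letter and produce y, making y shorter than y t. *)
apply: exchange => //; apply/negP => pyu.
have yS := mem_wprod eS.
have xS : wprod e * (u * r * u^-1) \in <<S>>.
  by rewrite !groupM ?groupV // mem_gen.
have [d [dS sd] dw] := cox_length_word xS.
have nx : ~~ pos_root (wprod d * u) r.
  by rewrite dw !mulgA mulgKV pos_root_mulr // negbK.
have [i lti] := exchange dS rS pu nx.
rewrite dw !mulgA mulgKV simple_mulK // mulgK => E.
have := @cox_length_le _ S (take i d ++ drop i.+1 d).
rewrite -E (all_subseq (delete_subseq d i) dS) => /(_ isT).
have := size_delete lti; move: lt sd; rewrite !mulgA; slia.
Qed.

(** Each step down deletes one letter by [strong_exchange]. The word is arbitrary, so the argument
    can be repeated on what is left, reduced or not. *)
Lemma bruhat_subword x y e : bruhat S x y -> all (mem S) e -> y = wprod e ->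
  exists2 d, subseq d e & x = wprod d.
Proof.
case/connectP => p + ->; elim/last_ind: p e => [|p z IHp] e /=.
  by move=> _ _ ->; exists e.
rewrite rcons_path last_rcons => /andP[px /andP[tS lt]] eS ze.
set z' := last x p in tS lt px IHp.
have [i lti E] : exists2 i, i < size e &
    wprod e * (z'^-1 * z)^-1 = wprod (take i e ++ drop i.+1 e).
  apply: strong_exchange => //.
    have [u [r [rS uS -> _]]] := reflectionsP (subxx S) tS.
    rewrite !invMg invgK (simple_invg rS) mulgA.
    by apply/imset2P; exists r u^-1; rewrite ?groupV // conjgE invgK mulgA.
  by rewrite -ze invMg invgK mulgA mulgV mul1g.
have Ez : z' = wprod (take i e ++ drop i.+1 e).
  by rewrite -E -ze invMg invgK mulgA mulgV mul1g.
have [d sub ->] := IHp _ px (all_subseq (delete_subseq e i) eS) Ez.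
by exists d => //; apply: subseq_trans sub (delete_subseq e i).
Qed.

Lemma bruhat_parabolic K x y : K \subset S -> bruhat S x y -> y \in <<K>> ->
  x \in <<K>>.
Proof.
move=> KS le /gen_word[e eK ey].
have [d sub ->] := bruhat_subword le (all_sub KS eK) (esym ey).
exact: mem_wprod (all_subseq sub eK).
Qed.

Lemma bruhat_len K x y : bruhat K x y -> x = y \/ cox_length K x < cox_length K y.
Proof.
case/connectP => p + ->; elim/last_ind: p => [|p z IHp] /=; first by left.
rewrite rcons_path last_rcons => /andP[/IHp IH /andP[_ lt]].
by right; case: IH => [->//|H]; apply: ltn_trans H lt.
Qed.

Lemma bruhat_refl K x : bruhat K x x. Proof. exact: connect0. Qed.

Lemma bruhat_trans K x y z : bruhat K x y -> bruhat K y z -> bruhat K x z.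
Proof. exact: connect_trans. Qed.

Lemma bruhat_step K w u r : K \subset S -> w \in <<K>> -> u \in <<K>> ->
  r \in K -> len w < len (w * (u * r * u^-1)) -> bruhat K w (w * (u * r * u^-1)).
Proof.
move=> KS wK uK rK lt; apply: connect1 => /=; rewrite mulKg.
have rG := mem_gen rK; rewrite !(cox_length_K KS) ?groupM ?groupV // lt andbT.
by apply/imset2P; exists r u^-1; rewrite ?groupV // conjgE invgK mulgA.
Qed.

Lemma bruhat_weak K w r : K \subset S -> w \in <<K>> ->
  r \in K -> len w < len (w * r) -> bruhat K w (w * r).
Proof.
move=> KS wK rK; have := @bruhat_step K w 1 r KS wK (group1 _) rK.
by rewrite mul1g invg1 mulg1.
Qed.

End CoxeterTheory.

(** * Parabolic quotients and palindromicity *)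

Section Quotients.
Variables (W : finGroupType) (S : {set W}) (A : W -> W -> nat).
Variable M : W -> W -> W -> int.
Hypothesis ca : cartan_action S A M.
Implicit Types (K I J : {set W}) (u v w x y z : W) (e : seq W).

Local Notation len := (cox_length S).
Local Notation pos := (pos_root S M).

Lemma len_ascl w r : w \in <<S>> -> r \in S -> pos w^-1 r ->
  len (r * w) = (len w).+1.
Proof.
move=> wS rS /(len_asc ca (groupVr wS) rS); rewrite (len_inv ca wS) => <-.
rewrite -(len_inv ca (w := r * w)) ?groupM // ?mem_gen //.
by rewrite invMg (simple_invg ca rS).
Qed.

Lemma len_descl w r : w \in <<S>> -> r \in S -> ~~ pos w^-1 r ->
  len w = (len (r * w)).+1.
Proof.
move=> wS rS /(len_desc ca (groupVr wS) rS); rewrite (len_inv ca wS) => ->.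
rewrite -(len_inv ca (w := r * w)) ?groupM // ?mem_gen //.
by rewrite invMg (simple_invg ca rS).
Qed.

Lemma root_supp I u q a : I \subset S -> u \in <<I>> -> a \in I -> q \in S ->
  M u q a != 0%R -> q \in I.
Proof.
move=> IS uI aI qS; apply: contraR => nqI.
rewrite (M_parabolic ca IS uI qS nqI (subsetP IS _ aI)).
have /negPf-> : q != a by apply: contraNneq nqI => ->.
by rewrite eqxx.
Qed.

(** By linearity: u(alpha_a) is a nonnegative combination of simple roots that w keeps positive. *)
Lemma pos_root_mul u w a : a \in S -> pos u a ->
  {in S, forall q, M u q a != 0%R -> pos w q} -> pos (w * u) a.
Proof.
move=> aS /pos_rootP pu H; apply/pos_rootP => t tS.
rewrite (ca_mul ca) // sumr_ge0 // => q qS.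
case: (eqVneq (M u q a) 0%R) => [->|nz]; first by rewrite mulr0.
by rewrite mulr_ge0 ?pu //; have /pos_rootP := H q qS nz; apply.
Qed.

Lemma neg_root_mul u w a : a \in S -> pos u a ->
  {in S, forall q, M u q a != 0%R -> ~~ pos w q} -> ~~ pos (w * u) a.
Proof.
move=> aS /pos_rootP pu H; apply/negP => /pos_rootP pwu.
apply: (root_nz ca (w := w * u) aS) => t tS; apply/eqP.
rewrite eq_le pwu // andbT (ca_mul ca) // sumr_le0 // => q qS.
case: (eqVneq (M u q a) 0%R) => [->|nz]; first by rewrite mulr0.
rewrite mulrC mulr_ge0_le0 ?pu //.
exact: (pos_rootN ca qS (H q qS nz)).
Qed.

Section General.
Variables I K : {set W}.
Hypotheses (IS : I \subset S) (KI : K \subset I).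

Let KS : K \subset S := subset_trans KI IS.
Let ISm r : r \in I -> r \in S. Proof. exact: (subsetP IS). Qed.
Let KIm r : r \in K -> r \in I. Proof. exact: (subsetP KI). Qed.
Let gI w : w \in <<I>> -> w \in <<S>>. Proof. exact: gen_sub. Qed.
Let gK w : w \in <<K>> -> w \in <<I>>. Proof. exact: gen_sub. Qed.

(** A letter a put in front of e w, with a e reduced in W_K, adds one to the length: e^-1(alpha_a)
    is a positive root supported on [K], and w^-1 keeps such roots positive. *)
Lemma len_add u w : u \in <<K>> -> w \in <<I>> ->
  {in K, forall j, pos w^-1 j} -> len (u * w) = (len u + len w)%N.
Proof.
move=> uK wI H; have [e [eK se] eu] := reduced_word_K ca KS uK.
rewrite -eu in se *; rewrite -se {u uK eu}.
elim: e eK se => [|a e IHe] /=; first by rewrite wprod_nil mul1g.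
case/andP=> aK eK; rewrite wprod_cons => se; rewrite -mulgA addSn.
have ewK := mem_wprod eK; have aS := ISm (KIm aK).
have ewS := gI (gK ewK).
have := cox_length_le (all_sub KS eK).
case: (boolP (pos (wprod e)^-1 a)) => [pa|na]; last first.
  have := len_descl ewS aS na; rewrite -se; slia.
rewrite (len_ascl ewS aS pa) in se; case: se => se _; rewrite -IHe //.
apply: len_ascl => //; first by rewrite groupM // gI.
rewrite invMg; apply: pos_root_mul => // q qS nz.
by apply: H; apply: (root_supp KS (u := (wprod e)^-1) _ aK); rewrite ?groupV.
Qed.

Lemma min_repsP w : reflect (w \in <<I>> /\ {in K, forall j, pos w^-1 j})
  (w \in min_reps I K).
Proof.
rewrite inE; apply: (iffP andP) => [[wI /forall_inP H]|[wI H]].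
  split=> // j jK; rewrite (pos_root_lenl ca) ?gI ?ISm ?KIm //.
  have := H (j * w); rewrite mem_rcoset mulgK mem_gen // => /(_ isT).
  rewrite !(cox_length_K ca IS) ?groupM // ?mem_gen ?KIm // => le.
  case: (boolP (pos w^-1 j)) => p; first by rewrite len_ascl ?gI ?ISm ?KIm.
  by move: le; rewrite {1}(len_descl (gI wI) (ISm (KIm jK)) p) ltnn.
split=> //; apply/forall_inP => _ /rcosetP[u uK ->].
have uI := gK uK; rewrite !(cox_length_K ca IS) ?groupM //.
by rewrite len_add // leq_addl.
Qed.

Lemma min_reps1 : 1 \in min_reps I K.
Proof.
apply/min_repsP; split=> // j jK; rewrite invg1 (pos_root1 ca) //.
by rewrite ISm ?KIm.
Qed.

Lemma min_reps_gen x : x \in min_reps I K -> x \in <<S>>.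
Proof. by case/min_repsP => /gI. Qed.

(** If some j in [K] became a left descent of x p, then x^-1 would send alpha_j to alpha_p. So x p =
    j x would be longer than x, although p is a descent. *)
Lemma min_reps_prefix x p : x \in min_reps I K -> p \in I -> ~~ pos x p ->
  x * p \in min_reps I K.
Proof.
case/min_repsP=> xI H pI nx; apply/min_repsP; split.
  by rewrite groupM // mem_gen.
move=> j jK; rewrite invMg (simple_invg ca (ISm pI)).
have jS := ISm (KIm jK); have pS := ISm pI.
apply: contraT => np.
have E := ca_refl ca jS pS (simple_root_of_sign_change ca pS jS (H j jK) np).
have xp : x * p = j * x by rewrite -E invgK !mulgA mulgV mul1g.
have := len_desc ca (gI xI) pS nx.
by rewrite xp (len_ascl (gI xI) jS) ?H // => /eqP; rewrite -addn2 -{1}[len x]addn0 eqn_add2l.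
Qed.

Lemma min_reps_descent x : x \in min_reps I K -> x != 1 ->
  exists p, [/\ p \in I, ~~ pos x p, x * p \in min_reps I K
             & len x = (len (x * p)).+1].
Proof.
move=> xm nx1; have /min_repsP[xI _] := xm.
have [p [pI npos _]] := descent_exists ca IS xI nx1.
exists p; split=> //; first exact: min_reps_prefix.
exact: (len_desc ca (gI xI) (ISm pI)).
Qed.

Lemma min_reps_prefix_of_len x k : x \in min_reps I K -> k <= len x ->
  exists z, [/\ z \in min_reps I K, bruhat I z x & len z = k].
Proof.
move: {2}(len x) (erefl (len x)) => n; elim: n x => [|n IHn] x en xm lek.
  by exists x; split=> //; [exact: bruhat_refl | lia].
case: (ltngtP k n.+1) => [ltk|gtk|->]; last 2 first.
- by move: lek; rewrite en leqNgt gtk.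
- by exists x; split=> //; exact: bruhat_refl.
have nx : x != 1.
  by apply: contra_eq_neq en => ->; rewrite cox_length1.
have [p [pI npos xpm e]] := min_reps_descent xm nx.
have e' : len (x * p) = n by slia.
have [|z [zm zle ez]] := IHn _ e' xpm; first by rewrite e'.
have /min_repsP[xpI _] := xpm.
exists z; split=> //; apply: bruhat_trans zle _.
rewrite -{2}(simple_mulK ca x (ISm pI)).
by apply: (bruhat_weak ca IS) => //; rewrite (simple_mulK ca) ?ISm // e.
Qed.

End General.

(** * Longest elements and duality of the quotient *)

Section Longest.
Variable I : {set W}.
Hypothesis IS : I \subset S.
Let ISm r : r \in I -> r \in S. Proof. exact: (subsetP IS). Qed.
Let gI w : w \in <<I>> -> w \in <<S>>. Proof. exact: gen_sub. Qed.

Definition is_longest w := (w \in <<I>>) && [forall r in I, ~~ pos w r].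

Lemma is_longestP w :
  reflect (w \in <<I>> /\ {in I, forall r, ~~ pos w r}) (is_longest w).
Proof.
by apply: (iffP andP) => -[wI H]; split=> //; apply/forall_inP.
Qed.

Lemma longest_exists : exists w, is_longest w.
Proof.
have [w wI H] := @arg_maxnP W 1 (fun w => w \in <<I>>) len (group1 _).
exists w; apply/is_longestP; split=> // r rI; apply/negP => pw.
have wrI : w * r \in <<I>> by rewrite groupM // mem_gen.
have := H _ wrI; rewrite /= (len_asc ca (gI wI) (ISm rI) pw).
by rewrite /geq /= ltnn.
Qed.

Section Involution.
Variable w0 : W.
Hypothesis lw0 : is_longest w0.

Let w0I : w0 \in <<I>>. Proof. by case/andP: lw0. Qed.

Lemma longest_inv_neg : {in I, forall r, ~~ pos w0^-1 r}.
Proof.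
have /is_longestP[_ H] := lw0.
move=> r rI; apply/negP => pr.
have : ~~ pos (w0 * w0^-1) r.
  apply: neg_root_mul (ISm rI) pr _ => q qS nz; apply: H.
  by apply: (root_supp IS (u := w0^-1) _ rI qS nz); rewrite groupV.
by rewrite mulgV (pos_root1 ca (ISm rI)).
Qed.

(** Each letter of a reduced word of x put in front lowers the length, as w0^-1 makes every positive
    root supported on [I] negative. *)
Lemma len_mul_longest x : x \in <<I>> -> (len (x * w0) + len x)%N = len w0.
Proof.
move=> xI; have [e [eI se] ex] := reduced_word_K ca IS xI.
rewrite -ex in se *; rewrite -se {x xI ex}.
elim: e eI se => [|a e IHe] /=; first by rewrite wprod_nil mul1g addn0.
case/andP=> aI eI; rewrite wprod_cons => se; rewrite -mulgA.
have eGI := mem_wprod eI; have aS := ISm aI.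
have := cox_length_le (all_sub IS eI).
case: (boolP (pos (wprod e)^-1 a)) => [pa|na]; last first.
  have := len_descl (gI eGI) aS na; rewrite -se; slia.
rewrite (len_ascl (gI eGI) aS pa) in se; case: se => se _; rewrite -(IHe eI se).
rewrite (@len_descl (wprod e * w0) a) ?addSnnS //; first by rewrite groupM // gI.
rewrite invMg; apply: neg_root_mul => // q qS nz; apply: longest_inv_neg.
by apply: (root_supp IS (u := (wprod e)^-1) _ aI); rewrite ?groupV.
Qed.

Lemma longest_invol : w0 * w0 = 1.
Proof.
apply: (cox_length_eq0 (K := S)); first by rewrite groupM // gI.
by apply/eqP; rewrite -(eqn_add2r (len w0)) len_mul_longest.
Qed.

End Involution.
End Longest.

Section Symmetry.
Variables I K : {set W}.
Hypotheses (IS : I \subset S) (KI : K \subset I).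
Variables w0 wK : W.
Hypotheses (lw0 : is_longest I w0) (lwK : is_longest K wK).

Let KS : K \subset S := subset_trans KI IS.
Let ISm r : r \in I -> r \in S. Proof. exact: (subsetP IS). Qed.
Let KIm r : r \in K -> r \in I. Proof. exact: (subsetP KI). Qed.
Let gI w : w \in <<I>> -> w \in <<S>>. Proof. exact: gen_sub. Qed.
Let gK w : w \in <<K>> -> w \in <<I>>. Proof. exact: gen_sub. Qed.
Let w0I : w0 \in <<I>>. Proof. by case/andP: lw0. Qed.
Let wKK : wK \in <<K>>. Proof. by case/andP: lwK. Qed.
Let w0V : w0^-1 = w0.
Proof. by apply/eqP; rewrite eq_invg_mul (longest_invol IS lw0). Qed.
Let wKV : wK^-1 = wK.
Proof. by apply/eqP; rewrite eq_invg_mul (longest_invol KS lwK). Qed.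

(** This involution of the quotient reverses lengths and is the source of rank symmetry for locally
    longest elements. *)
Definition min_reps_dual x := wK * x * w0.

Lemma min_reps_dualK : involutive min_reps_dual.
Proof.
move=> x; rewrite /min_reps_dual !mulgA (longest_invol KS lwK) mul1g.
by rewrite -mulgA (longest_invol IS lw0) mulg1.
Qed.

Lemma min_reps_dualP x : x \in min_reps I K ->
  min_reps_dual x \in min_reps I K /\
  (len (min_reps_dual x) + (len wK + len x))%N = len w0.
Proof.
case/(min_repsP IS KI) => xI H; split; last first.
  rewrite -(len_add IS KI wKK xI H) (len_mul_longest IS lw0) //.
  by rewrite groupM // gK.
apply/(min_repsP IS KI); split; first by rewrite !groupM // gK.
move=> j jK; have jS := ISm (KIm jK).
rewrite /min_reps_dual !invMg w0V wKV mulgA.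
(* The root to be tested is the opposite of w0 x^-1 wK j(alpha_j). Here wK j(alpha_j) is a positive
   root on [K], x^-1 keeps it positive, and w0 makes it negative. *)
have wjK : wK * j \in <<K>> by rewrite groupM // mem_gen.
have p1 : pos (wK * j) j.
  by rewrite (pos_root_mulr ca) //; case/is_longestP: lwK => _; apply.
have p2 : pos (x^-1 * (wK * j)) j.
  apply: pos_root_mul => // q qS nz; apply: H.
  exact: (root_supp KS wjK jK qS nz).
have : ~~ pos (w0 * (x^-1 * (wK * j))) j.
  apply: neg_root_mul => // q qS nz; case/is_longestP: lw0 => _; apply.
  apply: (root_supp IS _ (KIm jK) qS nz).
  by rewrite groupM ?groupV // gK.
by rewrite !mulgA (pos_root_mulr ca) // negbK.
Qed.

(** Induction on the length of the dual of x. Removing a right descent q from the dual multiplies x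
    on the right by the reflection w0 q w0^-1, which leads to a longer element of the quotient. *)
Lemma min_reps_le_dual1 x : x \in min_reps I K ->
  bruhat S x (min_reps_dual 1).
Proof.
move: {2}(len (min_reps_dual x)) (erefl (len (min_reps_dual x))) => n.
elim: n x => [|n IHn] x en xm.
  have [dm _] := min_reps_dualP xm.
  rewrite -[x]min_reps_dualK.
  rewrite (cox_length_eq0 (min_reps_gen IS KI dm) en); exact: bruhat_refl.
have [dm dl] := min_reps_dualP xm.
have nd : min_reps_dual x != 1.
  by apply: contra_eq_neq en => ->; rewrite cox_length1.
have [q [qI _ ym yl]] := min_reps_descent IS KI dm nd.
set y := min_reps_dual x * q in ym yl.
have [dym dyl] := min_reps_dualP ym.
have Ey : min_reps_dual y = x * (w0 * q * w0^-1).
  by rewrite /y /min_reps_dual w0V !mulgA (longest_invol KS lwK) mul1g.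
have [ddm ddl] := min_reps_dualP dym.
have xS := min_reps_gen IS KI xm.
apply: (bruhat_trans (y := min_reps_dual y)).
  rewrite Ey; apply: (bruhat_step ca (subxx S)) => //; first exact: gI.
  - exact: ISm.
  - rewrite -Ey; slia.
apply: IHn => //; rewrite min_reps_dualK; slia.
Qed.

End Symmetry.

(** * Palindromicity as equality of rank counts *)

Section PalindromicCount.
Variable J : {set W}.
Hypothesis JS : J \subset S.

Definition rank_count v i := #|[set z in lower_interval S J v | len z == i]|.

Lemma lower_interval_refl v : v \in min_reps S J -> v \in lower_interval S J v.
Proof. by move=> vm; rewrite inE vm bruhat_refl. Qed.

Lemma coef_poincare v i : ((poincare S J v)`_i = (rank_count v i)%:R)%R.
Proof.
rewrite /poincare coef_sum /rank_count -sum1_card natr_sum big_mkcond /=.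
rewrite [RHS]big_mkcond /=; apply: eq_bigr => z _.
rewrite [in RHS]in_set coefXn eq_sym; case: (z \in lower_interval S J v) => //=.
by case: (len z == i).
Qed.

Lemma palindromicP v : v \in min_reps S J ->
  palindromic S J v <->
  (forall i, i <= len v -> rank_count v i = rank_count v (len v - i)).
Proof.
move=> vm; split=> [[_ H] i lei|H].
  by have := H i lei; rewrite !coef_poincare => /eqP; rewrite eqr_nat => /eqP.
split=> [|i lei]; last by rewrite !coef_poincare H.
apply/eqP; rewrite eqn_leq; apply/andP; split.
  apply/leq_sizeP => j ltj; rewrite coef_poincare; apply/eqP.
  rewrite pnatr_eq0 cards_eq0; apply/eqP/setP => z; rewrite in_set0.
  apply/negbTE/negP; rewrite inE => /andP[+ /eqP ez].
  rewrite inE => /andP[_ /bruhat_len[ezv|]]; last slia.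
  by move: ez; rewrite ezv; slia.
rewrite ltnNge; apply/negP => /leq_sizeP /(_ _ (leqnn _)) /eqP.
rewrite coef_poincare pnatr_eq0 cards_eq0 => /eqP/setP/(_ v).
by rewrite inE lower_interval_refl // eqxx in_set0.
Qed.

Lemma palindromic_of_chain v : v \in min_reps S J ->
  {in lower_interval S J v &, forall x y, len x = len y -> x = y} ->
  palindromic S J v.
Proof.
move=> vm H; apply/palindromicP => //.
suff one i : i <= len v -> rank_count v i = 1%N.
  by move=> i lei; rewrite !one // leq_subr.
move=> lei; have [z [zm zle ez]] := min_reps_prefix_of_len (subxx S) JS vm lei.
apply/eqP/cards1P; exists z; apply/setP => y; rewrite in_set1.
have zin : z \in lower_interval S J v by rewrite inE zm.
apply/idP/eqP => [|->]; last by rewrite inE zin ez eqxx.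
rewrite inE => /andP[yin /eqP ey]; apply: H => //; by rewrite ey.
Qed.

Section Support.
Variable I : {set W}.
Hypothesis IS : I \subset S.

(** A node outside [I] is never a left descent of w: the coordinate of w^-1(alpha_j) on alpha_j
    stays 1. *)
Lemma min_reps_parabolic w : w \in <<I>> ->
  (w \in min_reps S J) = (w \in min_reps I (I :&: J)).
Proof.
move=> wI; have wS := gen_sub IS wI.
apply/(min_repsP (subxx S) JS)/(min_repsP IS (subsetIl I J)) => -[_ H]; split=> // j.
  by case/setIP => _; apply: H.
move=> jJ; have jS := subsetP JS _ jJ.
case: (boolP (j \in I)) => [jI|njI]; first by apply: H; rewrite inE jI.
apply: contraT => /(pos_rootN ca jS)/(_ j jS).
by rewrite (M_parabolic ca IS) ?groupV // eqxx.
Qed.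

Lemma mem_lower_interval v z : v \in <<I>> ->
  (z \in lower_interval S J v) = (z \in min_reps I (I :&: J)) && bruhat S z v.
Proof.
move=> vI; rewrite inE; apply: andb_id2r => zv.
by rewrite min_reps_parabolic //; exact: (bruhat_parabolic ca IS zv vI).
Qed.

Lemma palindromic_longest v : v \in <<I>> ->
  v \in min_reps I (I :&: J) ->
  {in min_reps I (I :&: J), forall u, cox_length I u <= cox_length I v} ->
  palindromic S J v.
Proof.
move=> vI vm vmax.
have KI := subsetIl I J.
have [w0 lw0] := longest_exists IS.
have [wK lwK] := longest_exists (subset_trans KI IS).
pose d := min_reps_dual w0 wK.
have dP x : x \in min_reps I (I :&: J) ->
    d x \in min_reps I (I :&: J) /\ (len (d x) + (len wK + len x))%N = len w0.
  exact: min_reps_dualP.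
have dK : involutive d by exact: (min_reps_dualK IS KI lw0 lwK).
have m1 := min_reps1 IS KI.
have [d1m d1l] := dP _ m1; have [dvm dvl] := dP _ vm.
have lI x : x \in min_reps I (I :&: J) -> cox_length I x = len x.
  by case/(min_repsP IS KI) => xI _; apply: (cox_length_K ca IS).
have := vmax _ d1m; rewrite !lI // => le1.
(* The lengths of an element and of its dual have a constant sum. As v is at least as long as d 1,
   its dual has length 0. *)
have vE : v = d 1.
  rewrite -[v]dK (cox_length_eq0 (K := S) (w := d v)) //.
    exact: (min_reps_gen IS KI dvm).
  move: d1l; rewrite cox_length1; slia.
have int z : (z \in lower_interval S J v) = (z \in min_reps I (I :&: J)).
  rewrite mem_lower_interval //; apply: andb_idr => zm.
  by rewrite vE; apply: (min_reps_le_dual1 IS KI lw0 lwK).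
apply/palindromicP; first by rewrite min_reps_parabolic.
move=> i lei; rewrite /rank_count -(card_imset _ (inv_inj dK)).
apply: eq_card => z; rewrite inE int.
apply/imsetP/idP => [[y]|].
  rewrite inE int => /andP[ym /eqP ey] ->; have [dym dyl] := dP _ ym.
  rewrite dym /=; apply/eqP; move: d1l; rewrite -vE cox_length1; slia.
case/andP=> zm /eqP ez; have [dzm dzl] := dP _ zm.
exists (d z); rewrite ?dK // inE int dzm /=.
apply/eqP; move: d1l; rewrite -vE cox_length1; slia.
Qed.

End Support.
End PalindromicCount.
End Quotients.

(** * The quotient by all nodes but one, seen through one row of coordinates *)

Section MaximalQuotient.
Variables (W : finGroupType) (S : {set W}) (A : W -> W -> nat).
Variable M : W -> W -> W -> int.
Hypothesis ca : cartan_action S A M.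
Implicit Types (K I J : {set W}) (u v w x y z : W) (e : seq W).

Local Notation len := (cox_length S).
Local Notation pos := (pos_root S M).

Lemma simple_support_sub v : simple_support S v \subset S.
Proof. by apply/subsetP => r; rewrite inE => /andP[]. Qed.

Lemma simple_support_word v e : all (mem S) e -> wprod e = v ->
  size e = len v -> {subset e <= simple_support S v}.
Proof.
move=> eS ev se r re; have rS : r \in S := allP eS r re.
rewrite inE rS; apply/existsP.
have se' : size e == len v by apply/eqP.
by exists (Tuple se'); rewrite /= eS re andbT; apply/eqP.
Qed.

Lemma simple_support_gen v : v \in <<S>> -> v \in <<simple_support S v>>.
Proof.
move=> vS; have [e [eS se] ev] := reduced_word_K ca (subxx S) vS.
rewrite -{1}ev; apply: mem_wprod; apply/allP => r re.
exact: simple_support_word eS ev se _ re.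
Qed.

(** If the last letter r were outside [K], the whole product would send alpha_r to a root with
    alpha_r coordinate 1. The product without r would send it to a negative root, so r would shorten
    the word. *)
Lemma reduced_word_mem K e : K \subset S -> all (mem S) e ->
  size e = len (wprod e) -> wprod e \in <<K>> -> all (mem K) e.
Proof.
move=> KS; elim/last_ind: e => [//|e r IHe].
rewrite !all_rcons size_rcons wprod_rcons => /andP[rS eS] se eK.
have eGS := mem_wprod eS; have le := cox_length_le eS.
have rK : r \in K.
  apply: contraT => nrK; have := M_parabolic ca KS eK rS nrK rS.
  rewrite (M_mulr ca) // eqxx => Er.
  have np : ~~ pos (wprod e) r.
    apply/negP => /pos_rootP /(_ r rS); move: Er; clear; lia.
  have := len_desc ca eGS rS np; rewrite -se; slia.
have eKw : wprod e \in <<K>>.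
  by rewrite -(simple_mulK ca (wprod e) rS) groupM // mem_gen.
rewrite /= rK IHe //; case: (boolP (pos (wprod e) r)) => [p|np].
  by move: se; rewrite (len_asc ca eGS rS p) => -[].
have := len_desc ca eGS rS np; rewrite -se; slia.
Qed.

Lemma simple_support_min K v : K \subset S -> v \in <<K>> ->
  simple_support S v \subset K.
Proof.
move=> KS vK; apply/subsetP => r; rewrite inE => /andP[rS /existsP[e]].
case/and3P=> eS /eqP ev re; apply: (allP (reduced_word_mem KS eS _ _)) re.
  by rewrite size_tuple /wprod ev.
by rewrite /wprod ev.
Qed.

Section Fixed.
Variables (I : {set W}) (s : W).
Hypotheses (IS : I \subset S) (sI : s \in I).
Let K := I :\ s.
Let KI : K \subset I. Proof. exact: subsetDl. Qed.
Let ISm r : r \in I -> r \in S. Proof. exact: (subsetP IS). Qed.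
Let sS : s \in S. Proof. exact: ISm. Qed.
Let KS : K \subset S. Proof. exact: subset_trans IS. Qed.

Local Notation X := (min_reps I K).

Let gX x : x \in X -> x \in <<S>>. Proof. exact: (min_reps_gen ca IS KI). Qed.

Lemma pos_of_coef x p : p \in S -> (0 < M x s p)%R -> pos x p.
Proof.
move=> pS gt0; apply: contraT => np.
by have := pos_rootN ca pS np sS; rewrite leNgt gt0.
Qed.

Lemma neg_of_coef x p : p \in S -> (M x s p < 0)%R -> ~~ pos x p.
Proof. by move=> pS lt0; apply/negP => /pos_rootP /(_ s sS); rewrite leNgt lt0. Qed.

(** With a zero s-coordinate, x(alpha_p) would be a nonpositive combination of roots of [K], which
    x^-1 keeps positive, so alpha_p itself would be nonpositive. Hence row [s] shows every
    descent. *)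
Lemma coef_neq0_of_neg x p : x \in X -> p \in I -> ~~ pos x p -> (M x s p < 0)%R.
Proof.
move=> xX pI np; have pS := ISm pI; have Hn := pos_rootN ca pS np.
rewrite lt_neqAle Hn // andbT; apply/eqP => e0.
have /(min_repsP ca IS KI)[xI H] := xX.
have := mul_sumE ca x pS; suff : (\sum_(q in S) M x^-1 p q * M x q p <= 0)%R.
  by move=> le0 E; rewrite E in le0.
apply: sumr_le0 => q qS; case: (eqVneq (M x q p) 0%R) => [->|nz].
  by rewrite mulr0.
have qK : q \in K.
  rewrite !inE (root_supp ca IS xI pI qS nz) andbT.
  by apply: contraNneq nz => ->; rewrite e0.
by rewrite mulr_ge0_le0 ?Hn //; have /pos_rootP := H q qK; apply.
Qed.

(** An ascent p leaves the quotient only if x(alpha_p) = alpha_j for some j in [K], that is, if x p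
    = j x; such a root has s-coordinate 0. *)
Lemma quot_up x p : x \in X -> p \in I -> (0 < M x s p)%R ->
  x * p \in X /\ len (x * p) = (len x).+1.
Proof.
move=> xX pI gt0; have pS := ISm pI; have px := pos_of_coef pS gt0.
split; last by rewrite (len_asc ca (gX xX) pS px).
have /(min_repsP ca IS KI)[xI H] := xX.
apply/(min_repsP ca IS KI); split; first by rewrite groupM // mem_gen.
move=> j jK; have jS := subsetP KS _ jK.
rewrite invMg (simple_invg ca pS); apply: contraT => np.
have E := simple_root_of_sign_change ca pS jS (H j jK) np.
have := ca_mul ca x x^-1 sS jS; rewrite mulgV (ca_one ca) //.
rewrite (bigD1 p) //= E // eqxx big1 => [|q /andP[qS nqp]]; last first.
  by rewrite E // (negPf nqp) mulr0.
have /negPf-> : s != j by apply: contraTneq jK => <-; rewrite !inE eqxx.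
by rewrite mulr1 addr0 => e0; rewrite -e0 ltxx in gt0.
Qed.

Lemma quot_down x p : x \in X -> p \in I -> (M x s p < 0)%R ->
  x * p \in X /\ len x = (len (x * p)).+1.
Proof.
move=> xX pI lt0; have pS := ISm pI; have np := neg_of_coef pS lt0.
split; first exact: (min_reps_prefix ca IS KI).
by rewrite (len_desc ca (gX xX) pS np).
Qed.

Lemma quot_descent x : x \in X -> x != 1 -> exists2 p, p \in I & (M x s p < 0)%R.
Proof.
move=> xX nx1; have [p [pI np _ _]] := min_reps_descent ca IS KI xX nx1.
by exists p => //; apply: coef_neq0_of_neg.
Qed.

Lemma quot_ind (P : W -> Prop) : P 1 ->
  (forall x p, x \in X -> p \in I -> (0 < M x s p)%R -> P x -> P (x * p)) ->
  forall x, x \in X -> P x.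
Proof.
move=> P1 Pm x; move: {2}(len x) (erefl (len x)) => n.
elim: n x => [|n IHn] x en xX; first by rewrite (cox_length_eq0 (gX xX) en).
have nx1 : x != 1 by apply: contra_eq_neq en => ->; rewrite cox_length1.
have [p pI lt0] := quot_descent xX nx1; have pS := ISm pI.
have [xpX xpl] := quot_down xX pI lt0.
rewrite -(simple_mulK ca x pS); apply: Pm => //.
  by rewrite (M_mulr ca) // eqxx oppr_gt0.
by apply: IHn => //; slia.
Qed.

Lemma bruhat_down (L : {set W}) x p : L \subset S -> x \in <<L>> -> p \in L ->
  len x = (len (x * p)).+1 -> bruhat L (x * p) x.
Proof.
move=> LS xL pL e; have pS := subsetP LS _ pL.
rewrite -{2}(simple_mulK ca x pS); apply: (bruhat_weak ca LS) => //.
  by rewrite groupM // mem_gen.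
by rewrite (simple_mulK ca) // e.
Qed.

Section UniqueAscent.
Variable k : nat.
Hypothesis uniq_asc : forall x, x \in X -> len x < k ->
  {in I &, forall p q, (0 < M x s p)%R -> (0 < M x s q)%R -> p = q}.

(** By induction, both elements lie above the single element one step lower, through its single
    ascent. *)
Lemma unique_of_len x y : x \in X -> y \in X -> len x <= k -> len x = len y -> x = y.
Proof.
move: {2}(len x) (erefl (len x)) => n.
elim: n x y => [|n IHn] x y en xX yX le e.
  by rewrite (cox_length_eq0 (gX xX) en) (cox_length_eq0 (gX yX)) // -e.
have nx1 : x != 1 by apply: contra_eq_neq en => ->; rewrite cox_length1.
have ny1 : y != 1.
  by apply: contra_eq_neq en => y1; rewrite e y1 cox_length1.
have [p pI ltp] := quot_descent xX nx1; have [q qI ltq] := quot_descent yX ny1.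
have [xpX xpl] := quot_down xX pI ltp; have [yqX yql] := quot_down yX qI ltq.
have pS := ISm pI; have qS := ISm qI.
have E : x * p = y * q by apply: IHn => //; slia.
have Epq : p = q.
  apply: (uniq_asc xpX) => //; first by slia.
    by rewrite (M_mulr ca) // eqxx oppr_gt0.
  by rewrite E (M_mulr ca) // eqxx oppr_gt0.
by rewrite -(simple_mulK ca x pS) E Epq (simple_mulK ca).
Qed.

(* The ranks up to k are singletons, hence by symmetry so are those within k of the top. *)
Lemma palindromic_top_unique (J : {set W}) v z1 z2 j :
    J \subset S -> K = I :&: J -> v \in <<I>> -> v \in min_reps S J ->
    palindromic S J v -> j <= k -> (len z1 + j = len v)%N ->
    (len z2 + j = len v)%N -> z1 \in lower_interval S J v ->
    z2 \in lower_interval S J v -> z1 = z2.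
Proof.
move=> JS KE vI vm pal lejk e1 e2 z1v z2v.
have lej : j <= len v by slia.
have E := proj1 (palindromicP vm) pal _ lej.
have : rank_count S J v j <= 1.
  rewrite leqNgt; apply/negP => /card_gt1P[a [b [ain bin /eqP]]]; apply.
  case/setIdP: ain => + /eqP al; case/setIdP: bin => + /eqP bl.
  rewrite !(mem_lower_interval ca JS IS) // -KE => /andP[bX _] /andP[aX _].
  by apply: unique_of_len; rewrite ?al ?bl.
rewrite E => /card_le1_eqP; apply; apply/setIdP; split=> //.
- by apply/eqP; slia.
- by apply/eqP; slia.
Qed.

End UniqueAscent.

Lemma chain_of_unique_ascent : (forall x, x \in X ->
    {in I &, forall p q, (0 < M x s p)%R -> (0 < M x s q)%R -> p = q}) ->
  {in X &, forall x y, bruhat I x y || bruhat I y x}.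
Proof.
move=> H; have U m := @unique_of_len m (fun t tX _ => H t tX).
suff le x y : x \in X -> y \in X -> len x <= len y -> bruhat I x y.
  move=> x y xX yX; case: (leqP (len x) (len y)) => [|/ltnW] /le-> //.
  by rewrite orbT.
move=> xX yX; move: {2}(len y) (erefl (len y)) => n.
elim: n y yX => [|n IHn] y yX en lexy.
  by rewrite (U 0%N x y) ?bruhat_refl //; slia.
case: (ltngtP (len x) (len y)) lexy => // [lt|e] _; last first.
  by rewrite (U (len x) x y) ?bruhat_refl.
have ny1 : y != 1 by apply: contra_eq_neq en => ->; rewrite cox_length1.
have [q qI ltq] := quot_descent yX ny1.
have [yqX yql] := quot_down yX qI ltq.
apply: (bruhat_trans (y := y * q)); first by apply: IHn => //; slia.
apply: bruhat_down => //.
by have /(min_repsP ca IS KI)[] := yX.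
Qed.

(** wK v is the longest element of W_I. Where the s-coordinate of v(alpha_p) is negative, wK leaves
    it unchanged; where it is zero, v(alpha_p) is a positive root supported on [K], which wK
    reverses. *)
Lemma no_ascent_longest v : v \in X -> {in I, forall p, (M v s p <= 0)%R} ->
  {in X, forall u, cox_length I u <= cox_length I v}.
Proof.
move=> vX H.
have [wK lwK] := longest_exists ca KS.
have wKK : wK \in <<K>> by case/andP: lwK.
have /(min_repsP ca IS KI)[vI Hv] := vX.
have lw0 : is_longest S M I (wK * v).
  apply/is_longestP; split; first by rewrite groupM // (gen_sub KI).
  move=> p pI; have pS := ISm pI.
  have E : M (wK * v) s p = M v s p.
    rewrite (ca_mul ca) // (bigD1 s) //= big1 => [|q /andP[qS nqs]].
      rewrite (M_parabolic ca KS) // ?eqxx ?mul1r ?addr0 //.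
      by rewrite !inE eqxx.
    by rewrite (M_parabolic ca KS) // ?inE ?eqxx // eq_sym (negPf nqs) mul0r.
  case: (ltgtP (M v s p) 0%R) (H p pI) => // [lt0|e0] _.
    by apply: neg_of_coef => //; rewrite E.
  case: (boolP (pos v p)) => [pp|np]; last first.
    by have := coef_neq0_of_neg vX pI np; rewrite e0.
  apply: (neg_root_mul ca) => // q qS nz.
  case/is_longestP: lwK => _; apply.
  rewrite !inE (root_supp ca IS vI pI qS nz) andbT.
  by apply: contraNneq nz => ->; rewrite e0.
move=> u uX; have /(min_repsP ca IS KI)[uI _] := uX.
rewrite !(cox_length_K ca IS) //.
have [_ e] := min_reps_dualP ca IS KI lw0 lwK uX.
move: e; rewrite (len_add ca IS KI wKK vI Hv); slia.
Qed.

End Fixed.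

Lemma uniq_word_reduced e : all (mem S) e -> uniq e -> len (wprod e) = size e.
Proof.
elim/last_ind: e => [|e r IHe]; first by rewrite wprod_nil cox_length1.
rewrite all_rcons rcons_uniq size_rcons wprod_rcons => /andP[rS eS] /andP[nre ue].
rewrite -IHe // (len_asc ca) ?mem_wprod //.
apply: contraT => /(pos_rootN ca rS)/(_ r rS).
rewrite (M_parabolic ca (K := [set x in e])) ?eqxx ?inE //.
  by apply/subsetP => x; rewrite inE => /(allP eS).
by apply: mem_wprod; apply/allP => x xe /=; rewrite inE.
Qed.

(* Below a product of distinct letters along a path, the quotient only has the
   prefixes: the first letter after a gap would commute to the front. *)
Lemma path_word_palindromic (J : {set W}) s e :
    J = S :\ s -> all (mem S) e -> uniq e -> wprod e \in min_reps S J ->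
    head s e = s ->
    (forall i j, i < j < size e -> i.+1 < j -> commute (nth 1 e i) (nth 1 e j)) ->
  palindromic S J (wprod e).
Proof.
move=> JE eS ue em hs com; have JS : J \subset S by rewrite JE subsetDl.
apply: (palindromic_of_chain ca) => //.
suff pre z : z \in lower_interval S J (wprod e) -> z = wprod (take (len z) e).
  by move=> x y /pre xE /pre yE exy; rewrite xE yE exy.
rewrite inE => /andP[zm zle].
have [d sub zE] := bruhat_subword ca zle eS (erefl _).
have dS := all_subseq sub eS; have ud := subseq_uniq sub ue.
have zl : len z = size d by rewrite zE uniq_word_reduced.
suff pre k : k <= size d -> take k d = take k e.
  by rewrite zl -pre // take_size.
elim: k => [|k IHk] ltk; first by rewrite !take0.
have Ek := IHk (ltnW ltk).
have dke : nth 1 d k \in e by apply: (mem_subseq sub); rewrite mem_nth.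
pose j := index (nth 1 d k) e; have ltj : j < size e by rewrite index_mem.
have ej : nth 1 e j = nth 1 d k by rewrite nth_index.
have lekj : k <= j.
  rewrite leqNgt; apply/negP => ltjk.
  have : nth 1 d k \in take k d.
    by rewrite Ek -ej -(nth_take 1 ltjk) mem_nth // size_takel // ltnW // (leq_trans ltk (size_subseq sub)).
  by rewrite -{1}(nth_take 1 (ltnSn k)) (take_nth 1) // => H;
    have := take_uniq k.+1 ud; rewrite (take_nth 1) // rcons_uniq;
    move: H; rewrite nth_rcons size_takel ?(ltnW ltk) // ltnn eqxx => ->.
have lte : k < size e by apply: leq_trans ltk (size_subseq sub).
case: (ltngtP k j) lekj => // [ltkj|ekj] _; last first.
  by rewrite !(take_nth 1) // Ek -ej -ekj.
exfalso.
set a := nth 1 d k in ej dke.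
have aS : a \in S by apply: (allP eS).
have aJ : a \in J.
  rewrite JE !inE aS andbT -ej -hs; apply/negP => /eqP E.
  have : j = 0%N.
    apply/eqP; rewrite -(nth_uniq 1 ltj _ ue) ?(leq_ltn_trans _ ltj) //.
    by rewrite E -nth0; apply/eqP; apply: set_nth_default; apply: leq_ltn_trans ltj.
  by move: ltkj; case: (j).
have comm i : i <= k -> commute (wprod (take i e)) a.
  elim: i => [|i IHi] lei; first by rewrite take0 wprod_nil; apply: commute_sym; apply: commute1.
  rewrite (take_nth 1); last by apply: leq_ltn_trans lte; apply: ltnW.
  rewrite wprod_rcons; apply/commute_sym/commuteM; apply/commute_sym.
    by apply: IHi; apply: ltnW.
  have lt : i.+1 < j := leq_ltn_trans lei ltkj.
  by rewrite -ej; apply: com => //; rewrite ltj (ltnW lt).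
(* The letter a, which commutes with all that precedes it, becomes a left descent of z lying in
   [J]. *)
have Ez : z = a * wprod (take k e ++ drop k.+1 d).
  rewrite zE -{1}(cat_take_drop k d) Ek (drop_nth 1) // !wprod_cat wprod_cons.
  by rewrite mulgA comm // mulgA.
have zS : z \in <<S>> by rewrite zE mem_wprod.
have /(min_repsP ca (subxx S) JS)[_ /(_ a aJ)] := zm.
rewrite (pos_root_lenl ca) // Ez mulgA (ca_inv ca) // mul1g -Ez zl.
have aw : all (mem S) (take k e ++ drop k.+1 d).
  rewrite all_cat; apply/andP; split; apply/allP => x.
    by move/mem_take; apply: (allP eS).
  by move/mem_drop; apply: (allP dS).
have := cox_length_le aw.
rewrite size_cat size_drop size_takel ?(ltnW lte) //; slia.
Qed.

End MaximalQuotient.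

(** * Bonds and connected diagrams *)

Section Bonds.
Variables (W : finGroupType) (S : {set W}) (A : W -> W -> nat).
Variable M : W -> W -> W -> int.
Hypothesis ca : cartan_action S A M.
Implicit Types (s t : W).

Lemma commute_cartan0 s t : s \in S -> t \in S -> s != t ->
  (A s t == 0%N) = (s * t == t * s).
Proof.
move=> sS tS nst; apply/eqP/eqP => [a0|com].
  have H : {in S, forall q, M s q t = (q == t)%:R%R}.
    move=> q qS; rewrite (ca_simple ca sS qS tS) eq_sym (negPf nst) a0.
    by rewrite mulr0 addr0 eq_sym.
  have E := ca_refl ca tS tS H.
  by rewrite -{2}E mulgKV.
have nts : t != s by rewrite eq_sym.
have e1 : M (t * s) s t = (A s t)%:Z%R.
  rewrite (M_mulr ca) // (negPf nts) (ca_simple ca tS sS tS) (ca_simple ca tS sS sS).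
  by rewrite !eqxx (negPf nst) /=; ring.
have e2 : M (s * t) s t = (- (A s t)%:Z)%R.
  rewrite (M_mulr ca) // eqxx (ca_simple ca sS sS tS) (negPf nts) (negPf nst) eqxx.
  by rewrite /=; ring.
move: e1; rewrite -com e2; lia.
Qed.

Lemma order_le2 s t : s \in S -> t \in S -> s != t ->
  (#[s * t] <= 2) = (s * t == t * s).
Proof.
move=> sS tS nst.
have sqE : ((s * t) ^+ 2 == 1) = (s * t == t * s).
  have -> : t * s = (s * t)^-1 by rewrite invMg !(simple_invg ca).
  by rewrite expgS expg1 -eq_invg_mul eq_sym.
apply/idP/idP => [le2|/eqP com]; last first.
  by rewrite dvdn_leq // order_dvdn sqE com.
rewrite -sqE -order_dvdn; move: le2 (order_gt0 (s * t)).
by case: #[s * t] => [|[|[|]]].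
Qed.

Lemma dynkin_edgeE s t : s \in S -> t \in S ->
  dynkin_edge S s t = (s != t) && (A s t != 0%N).
Proof.
move=> sS tS; rewrite /dynkin_edge /= sS tS /=; apply: andb_id2l => nst.
by rewrite ltnNge order_le2 // -commute_cartan0.
Qed.

(** s t sends alpha_s to alpha_t, which yields the braid relation s t s = t s t. *)
Lemma order3 s t : s \in S -> t \in S -> s != t ->
  A s t = 1%N -> A t s = 1%N -> #[s * t] = 3.
Proof.
move=> sS tS nst a1 a2.
have nts : t != s by rewrite eq_sym.
have H : {in S, forall q, M (s * t) q s = (q == t)%:R%R}.
  move=> q qS; rewrite (M_mulr ca) // (negPf nst) (ca_simple ca sS qS sS).
  by rewrite (ca_simple ca sS qS tS) eqxx (negPf nts) a1 a2 /=; ring.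
have E := ca_refl ca sS tS H.
have E3 : (s * t) ^+ 3 = 1.
  have E' : s * t * s = t * (s * t) by rewrite -{2}E mulgKV.
  rewrite !expgS expg0 mulg1 !mulgA E' -!mulgA (mulgA t t) (ca_inv ca) // mul1g.
  by rewrite (mulgA s s) (ca_inv ca) // mul1g (ca_inv ca).
have : #[s * t] %| 3 by rewrite order_dvdn E3.
rewrite dvdn_divisors //= => /or3P[]; rewrite ?orbF => /eqP e.
- have := order_le2 sS tS nst; rewrite e => /esym.
  by rewrite -commute_cartan0 // a1.
- exact: e.
- by [].
Qed.

(** s t s fixes alpha_t, hence commutes with t. *)
Lemma order4 s t : s \in S -> t \in S -> s != t ->
  (A s t * A t s)%N = 2 -> #[s * t] = 4.
Proof.
move=> sS tS nst ab.
have nts : t != s by rewrite eq_sym.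
have H : {in S, forall q, M (s * t * s) q t = (q == t)%:R%R}.
  move=> q qS; rewrite (M_mulr ca) // (negPf nts) !(M_mulr ca) // eqxx (negPf nst).
  rewrite (ca_simple ca sS qS tS) (ca_simple ca sS qS sS) eqxx (negPf nts).
  have abZ : ((A s t)%:Z * (A t s)%:Z = 2)%R by rewrite -PoszM ab.
  set a := (A s t)%:Z%R in abZ *; set b := (A t s)%:Z%R in abZ *.
  set x := ((q == s)%:R : int)%R; set y := ((q == t)%:R : int)%R.
  have -> : (- (y + x * a) + a * (- x + b * (y + x * a)) =
     (a * b - 2) * (y + x * a) + y)%R by ring.
  by rewrite abZ subrr mul0r add0r.
have E := ca_refl ca tS tS H.
have E4 : (s * t) ^+ 4 = 1.
  have E' : s * t * s * t = t * (s * t * s) by rewrite -{3}E mulgKV.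
  rewrite !expgS expg0 mulg1 !mulgA E' -!mulgA (mulgA s s) (ca_inv ca) // mul1g.
  by rewrite (mulgA t t) (ca_inv ca) // mul1g (mulgA s s) (ca_inv ca) // mul1g (ca_inv ca).
have : #[s * t] %| 4 by rewrite order_dvdn E4.
have := order_le2 sS tS nst; rewrite -commute_cartan0 //.
have -> : (A s t == 0%N) = false by apply/negbTE/eqP => a0; rewrite a0 in ab.
by case: #[s * t] => [|[|[|[|[|k]]]]] // _ /dvdn_leq.
Qed.

End Bonds.

(** * Exclusion of affine diagrams *)

Section PositiveDefinite.
Variables (W : finGroupType) (S : {set W}) (A : W -> W -> nat).
Variable M : W -> W -> W -> int.
Hypothesis ca : cartan_action S A M.

Lemma sum_nodes_le (F : W -> nat) (i : W) (nl nr : seq W) :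
  uniq (nl ++ i :: nr) -> all (mem S) nl -> all (mem S) nr ->
  \sum_(j <- nl) F j + \sum_(j <- nr) F j <= \sum_(j in S | j != i) F j.
Proof.
move=> u nlS nrS; rewrite -big_cat /=.
have : uniq (i :: (nl ++ nr)) by rewrite -[_ :: _]/([:: i] ++ nl ++ nr) uniq_catCA.
rewrite cons_uniq => /andP[ni un].
rewrite big_uniq //= big_mkcond [X in _ <= X]big_mkcond /=.
apply: leq_sum => j _; case: ifP => // jn.
have -> : j \in S.
  by move: jn; rewrite mem_cat => /orP[/(allP nlS)|/(allP nrS)].
by have -> : j != i by apply: contraNneq ni => <-.
Qed.

(** It is enough to list some neighbours that carry twice the weight of each node. They come in two
    lists around the node, so that along a path their distinctness is that of a subsequence. *)
Lemma posdef_false (c : W -> nat) r : r \in S -> 0 < c r ->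
  (forall i, i \in S -> 0 < c i -> exists nl nr,
    [/\ uniq (nl ++ i :: nr), all (mem S) nl, all (mem S) nr &
    (c i).*2 <= \sum_(j <- nl) c j * A i j + \sum_(j <- nr) c j * A i j]) ->
  False.
Proof.
move=> rS cr H; suff c0 : c r = 0%N by rewrite c0 in cr.
apply: (ca_posdef ca (c := c)) rS => i iS ci.
have [nl [nr [u nlS nrS le]]] := H i iS ci.
exact: leq_trans le (sum_nodes_le _ u nlS nrS).
Qed.

(* The affine diagrams of types B, C and D: a path of nodes of weight 2 with
   an incoming weight of at least 2 at both ends. *)
Lemma loaded_path (q L R : seq W) (cz : W -> nat) :
  uniq (L ++ q ++ R) -> all (mem S) (L ++ q ++ R) -> 0 < size q ->
  (forall i, i.+1 < size q -> A (nth 1%g q i) (nth 1%g q i.+1) != 0%N) ->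
  2 <= \sum_(z <- L) cz z * A (nth 1%g q 0) z ->
  2 <= \sum_(z <- R) cz z * A (nth 1%g q (size q).-1) z ->
  (forall z, z \in L -> cz z <= A z (nth 1%g q 0)) ->
  (forall z, z \in R -> cz z <= A z (nth 1%g q (size q).-1)) -> False.
Proof.
move=> u; rewrite !all_cat => /and3P[LS qS RS] q0 adj wL wR cL cR.
pose c x := if x \in q then 2 else if x \in L ++ R then cz x else 0%N.
have cq i : i < size q -> c (nth 1%g q i) = 2 by move=> lti; rewrite /c mem_nth.
have qm i : i < size q -> nth 1%g q i \in S by move=> lti; apply: (allP qS); rewrite mem_nth.
have LqR x : x \in L ++ R -> x \notin q.
  move: u; rewrite uniq_catCA cat_uniq => /and3P[_ /hasPn H _] xLR; exact: H.
have cLR x : x \in L ++ R -> c x = cz x.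
  by move=> xLR; rewrite /c (negPf (LqR _ xLR)) xLR.
have sumL y : \sum_(z <- L) c z * A y z = \sum_(z <- L) cz z * A y z.
  by apply: eq_big_seq => z zL; rewrite cLR // mem_cat zL.
have sumR y : \sum_(z <- R) c z * A y z = \sum_(z <- R) cz z * A y z.
  by apply: eq_big_seq => z zL; rewrite cLR // mem_cat zL orbT.
apply: (@posdef_false c (nth 1%g q 0) (qm 0%N q0)); first by rewrite cq.
move=> x xS; rewrite {1}/c; case: (boolP (x \in q)) => [xq _|nxq].
  pose i := index x q; have lti : i < size q by rewrite index_mem.
  have xi : x = nth 1%g q i by rewrite nth_index.
  exists (if i == 0%N then L else [:: nth 1%g q i.-1]).
  exists (if i.+1 == size q then R else [:: nth 1%g q i.+1]); split.
  - have E : L ++ q ++ R = (L ++ take i q) ++ x :: drop i.+1 q ++ R.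
      by rewrite -{1}(cat_take_drop i q) (drop_nth 1%g lti) -xi -!catA.
    apply: subseq_uniq u; rewrite E; apply: cat_subseq; last first.
      rewrite /= eqxx; case: eqP => [e|/eqP ne]; first by rewrite e drop_size.
      have lt : i.+1 < size q by rewrite ltn_neqAle ne.
      by rewrite (drop_nth 1%g lt) /= eqxx sub0seq.
    case: eqP => [->|/eqP ne]; first by rewrite take0 cats0.
    have i1 : i = i.-1.+1 by rewrite prednK // lt0n.
    rewrite {2}i1 (take_nth 1%g) -?cats1; last by rewrite -i1; apply: ltnW.
    by rewrite !catA suffix_subseq // suffix_suffix.
  - case: eqP => // _; rewrite /= andbT; apply: qm.
    by apply: leq_ltn_trans lti; apply: leq_pred.
  - case: eqP => // /eqP ne; rewrite /= andbT; apply: qm.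
    by rewrite ltn_neqAle ne.
  - rewrite {1}/c xq; change 2.*2 with (2 + 2)%N; apply: leq_add.
      case: eqP => [e|/eqP ne]; first by rewrite sumL; move: wL; rewrite -e -xi.
      have i1 : i = i.-1.+1 by rewrite prednK // lt0n.
      rewrite big_seq1 cq; last by apply: leq_ltn_trans lti; apply: leq_pred.
      rewrite leq_pmulr // lt0n (ca_sym ca) ?qm //; last by apply: leq_ltn_trans lti; apply: leq_pred.
      by rewrite xi {2}i1; apply: adj; rewrite -i1.
    case: eqP => [e|/eqP ne]; first by rewrite sumR; move: wR; rewrite -e -xi.
    have lt : i.+1 < size q by rewrite ltn_neqAle ne.
    by rewrite big_seq1 cq // leq_pmulr // lt0n xi; apply: adj.
case: ifP => // xLR cx.
have cxE : c x = cz x by apply: cLR.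
move: xLR; rewrite mem_cat => /orP[xL|xR].
  exists [::], [:: nth 1%g q 0]; split=> //=.
  - rewrite andbT inE; apply: contraNneq nxq => ->; exact: mem_nth.
  - by rewrite qm.
  - by rewrite big_nil big_seq1 cq // cxE add0n -mul2n leq_mul2l cL.
have ltq : (size q).-1 < size q by rewrite prednK.
exists [::], [:: nth 1%g q (size q).-1]; split=> //=.
- rewrite andbT inE; apply: contraNneq nxq => ->; exact: mem_nth.
- by rewrite qm.
- by rewrite big_nil big_seq1 cq // cxE add0n -mul2n leq_mul2l cR.
Qed.

Definition bond_weight (es : seq (nat * nat * nat)) i k : nat :=
  head 0%N [seq e.2 | e <- es & e.1 == (i, k)].

(** The entries of [es] are lower bounds on [A] and unlisted pairs count as 0, so further or
    stronger bonds do no harm. The inequalities on the weights [cs] are then numerical. *)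
Lemma affine_list (l : seq W) (cs : seq nat) (es : seq (nat * nat * nat)) :
  uniq l -> all (mem S) l ->
  (forall e, e \in es -> e.2 <= A (nth 1%g l e.1.1) (nth 1%g l e.1.2)) ->
  [&& 0 < nth 0%N cs 0, 0 < size l & all (fun i => (nth 0%N cs i).*2 <=
     sumn [seq (nth 0 cs k * bond_weight es i k)%N | k <- iota 0 (size l) & k != i])
     (iota 0 (size l))] -> False.
Proof.
move=> ul lS H /and3P[c0 l0 /allP chk].
have wle i k : bond_weight es i k <= A (nth 1%g l i) (nth 1%g l k).
  rewrite /bond_weight; case E: [seq e <- es | e.1 == (i, k)] => [|e es'] //=.
  have : e \in [seq e <- es | e.1 == (i, k)] by rewrite E mem_head.
  by rewrite mem_filter => /andP[/eqP e1 /H]; rewrite e1.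
pose c x := (nth 0 cs (index x l) * (x \in l))%N.
have cE i : i < size l -> c (nth 1%g l i) = nth 0%N cs i.
  by move=> lti; rewrite /c index_uniq // mem_nth // muln1.
have xS : nth 1%g l 0 \in S by apply: (allP lS); rewrite mem_nth.
suff Z : {in S, forall i, c i = 0%N} by move: (Z _ xS); rewrite cE // => e; rewrite e in c0.
apply: (ca_posdef ca) => x xxS.
case: (boolP (x \in l)) => [xl _|/negPf nx]; last by rewrite /c nx muln0.
set i := index x l; have lti : i < size l by rewrite index_mem.
have xi : x = nth 1%g l i by rewrite nth_index.
have := chk i; rewrite mem_iota add0n lti => /(_ isT) /leq_trans; rewrite xi cE //; apply.
rewrite sumnE big_map big_filter.
apply: leq_trans (_ : \sum_(j <- l | j != nth 1%g l i) c j * A (nth 1%g l i) j <= _).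
  rewrite [X in _ <= X](big_nth 1%g) big_mkcond [X in _ <= X]big_mkcond /=.
  rewrite /index_iota subn0 big_seq [X in _ <= X]big_seq.
  apply: leq_sum => k; rewrite mem_iota add0n => /andP[_ ltk].
  by rewrite nth_uniq //; case: ifP => // _; rewrite cE // leq_mul2l wle orbT.
rewrite big_mkcond big_uniq //= -big_mkcondr /= big_mkcond [X in _ <= X]big_mkcond.
apply: leq_sum => j _; case: (boolP (j \in l)) => //= jl.
by have /= -> := allP lS j jl.
Qed.

End PositiveDefinite.

Section Segments.
Variables (T : eqType) (x0 : T) (p : seq T).

Definition segment i j := drop i (take j.+1 p).

Lemma size_segment i j : j < size p -> size (segment i j) = (j.+1 - i)%N.
Proof. by move=> lt; rewrite size_drop size_takel. Qed.

Lemma nth_segment i j k : j < size p -> i + k <= j ->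
  nth x0 (segment i j) k = nth x0 p (i + k).
Proof. by move=> lt le; rewrite nth_drop nth_take. Qed.

Lemma segment_subseq i j : subseq (segment i j) p.
Proof. exact: subseq_trans (drop_subseq _ _) (take_subseq _ _). Qed.

Lemma segment_uniq i j : uniq p -> uniq (segment i j).
Proof. exact/subseq_uniq/segment_subseq. Qed.

Lemma mem_segment i j k : uniq p -> j < size p -> k < size p ->
  (nth x0 p k \in segment i j) = (i <= k <= j).
Proof.
move=> up ltj ltk; apply/idP/andP => [|[lei lej]].
  case/(nthP x0) => t; rewrite size_segment // => ltt.
  have le : i + t <= j by move: ltt; clear; lia.
  rewrite nth_segment // => /eqP; rewrite nth_uniq // ?(leq_ltn_trans le) //.
  by move/eqP <-; split=> //; apply: leq_addr.
have -> : nth x0 p k = nth x0 (segment i j) (k - i) by rewrite nth_segment ?subnKC.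
by apply: mem_nth; rewrite size_segment //; move: lei lej; clear; lia.
Qed.

Lemma mem_segment_sub i j x : x \notin p -> x \notin segment i j.
Proof. by apply: contra; apply: (mem_subseq (segment_subseq i j)). Qed.

End Segments.

(** * The diagram around a longest path *)

Section Classification.
Variables (W : finGroupType) (S : {set W}) (A : W -> W -> nat).
Variable M : W -> W -> W -> int.
Hypothesis ca : cartan_action S A M.

Local Notation adj := (dynkin_edge S).

Lemma adj_sym : symmetric adj.
Proof.
move=> x y; rewrite /dynkin_edge /= -orderV invMg.
case xS : (x \in S) => //=; last by rewrite andbF.
case yS : (y \in S) => //=.
by rewrite !(simple_invg ca) // eq_sym.
Qed.

Lemma adjP x y : adj x y -> [/\ x \in S, y \in S, x != y, A x y != 0%N & A y x != 0%N].
Proof.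
move=> axy; have /and4P[xS yS nxy _] := axy.
have := axy; rewrite (dynkin_edgeE ca) // => /andP[_ axy0].
by have := axy; rewrite adj_sym (dynkin_edgeE ca) // => /andP[_ ayx0].
Qed.

Lemma adj_weight x y : adj x y -> 0 < A x y.
Proof. by case/adjP => _ _ _; rewrite lt0n. Qed.

Lemma nadj_weight x y : x \in S -> y \in S -> x != y -> ~~ adj x y ->
  A x y = 0%N /\ A y x = 0%N.
Proof.
move=> xS yS nxy; rewrite (dynkin_edgeE ca) // nxy /= negbK => /eqP a0.
by split=> //; apply/eqP; rewrite (ca_sym ca) // a0.
Qed.

(** Weight 1 on every node of a cycle is the affine diagram of type A. *)
Lemma no_cycle (q : seq W) : uniq q -> 2 < size q ->
  (forall i, i.+1 < size q -> adj (nth 1%g q i) (nth 1%g q i.+1)) ->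
  adj (nth 1%g q 0) (nth 1%g q (size q).-1) -> False.
Proof.
move=> uq q2 aq aql; set n := size q in q2 aq aql.
have qS i : i < n -> nth 1%g q i \in S.
  case: i => [|i] lti; first by case/adjP: aql.
  by case/adjP: (aq i lti).
have cE i : i < n -> ((nth 1%g q i \in q) : nat) = 1%N by move=> lti; rewrite mem_nth.
apply: (@posdef_false _ _ _ _ ca (fun x => x \in q) (nth 1%g q 0)).
- by apply: qS; apply: ltn_trans q2.
- by rewrite cE //; apply: ltn_trans q2.
move=> x xS; rewrite lt0b => xq; pose i := index x q.
have lti : i < n by rewrite index_mem.
have xi : x = nth 1%g q i by rewrite nth_index.
have nq a b : a < n -> b < n -> a != b -> nth 1%g q a != nth 1%g q b.
  by move=> la lb nab; rewrite nth_uniq.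
rewrite xq; have -> : (nat_of_bool true).*2 = 2 by [].
have [i0|i0] := posnP i.
  exists [::], [:: nth 1%g q 1; nth 1%g q n.-1].
  rewrite xi i0; split=> //=.
  - by rewrite !inE !negb_or !nq // ?andbT /=; move: q2; clear; lia.
  - by rewrite !qS //; move: q2; clear; lia.
  rewrite big_nil big_cons big_seq1 !cE ?mul1n; try by move: q2; clear; lia.
  exact: (leq_add (adj_weight (aq 0%N (ltnW q2))) (adj_weight aql)).
have ai : adj (nth 1%g q i) (nth 1%g q i.-1).
  by rewrite adj_sym; have := aq i.-1; rewrite prednK //; apply.
have lti' : i.-1 < n by apply: leq_ltn_trans lti; apply: leq_pred.
case: (ltngtP i.+1 n) (lti) => // [lt|e] _.
  exists [:: nth 1%g q i.-1], [:: nth 1%g q i.+1].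
  rewrite xi; split=> /=.
  - by rewrite !inE !negb_or !nq //; move: i0; clear; lia.
  - by rewrite qS.
  - by rewrite qS.
  rewrite !big_seq1 !cE // !mul1n.
  exact: (leq_add (adj_weight ai) (adj_weight (aq i lt))).
exists [:: nth 1%g q 0; nth 1%g q i.-1], [::].
have n0 : 0 < n by apply: ltn_trans q2.
rewrite xi; split=> //=.
- by rewrite !inE !negb_or !nq //; move: q2 e i0; clear; lia.
- by rewrite !qS.
rewrite big_nil big_cons big_seq1 !cE ?mul1n //.
rewrite addn0; move: aql; rewrite adj_sym -e /= => /adj_weight aql'.
exact: (leq_add aql' (adj_weight ai)).
Qed.

Section LongestPath.
Variable I : {set W}.
Hypothesis IS : I \subset S.

Definition is_path p := [&& uniq p, all (mem I) p & sorted adj p].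

Definition longest_path p := is_path p /\ forall q, is_path q -> size q <= size p.

Lemma longest_path_exists : exists p, longest_path p.
Proof.
pose P k := [exists t : k.-tuple W, is_path t].
have P0 : exists k, P k by exists 0%N; apply/existsP; exists [tuple].
have Pb k : P k -> k <= #|I|.
  case/existsP => t /and3P[ut tI _]; rewrite -(size_tuple t) cardE.
  by apply: uniq_leq_size => // x /(allP tI); rewrite mem_enum.
case: (ex_maxnP P0 Pb) => k /existsP[t tp] maxk; exists t; split=> // q qp.
rewrite size_tuple; apply: maxk; apply/existsP; exists (in_tuple q); exact: qp.
Qed.

Lemma is_path_rev p : is_path p -> is_path (rev p).
Proof.
case/and3P=> up pI sp; rewrite /is_path rev_uniq up all_rev pI /=.
by rewrite rev_sorted; apply: sub_sorted sp => x y; rewrite adj_sym.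
Qed.

Lemma longest_path_rev p : longest_path p -> longest_path (rev p).
Proof. by case=> pp mp; split=> [|q /mp]; rewrite ?size_rev //; apply: is_path_rev. Qed.

Variable p : seq W.
Hypothesis lp : longest_path p.
Let m := size p.
Local Notation x i := (nth 1%g p i).

Let up : uniq p. Proof. by case: lp => /and3P[]. Qed.
Let pI i : i < m -> x i \in I.
Proof. by move=> lti; case: lp => /and3P[_ /allP H _] _; apply: H; rewrite mem_nth. Qed.
Let pS i : i < m -> x i \in S. Proof. by move/pI; apply: (subsetP IS). Qed.

Lemma path_adj i : i.+1 < m -> adj (x i) (x i.+1).
Proof. by case: lp => /and3P[_ _ /(sortedP 1%g) H] _; apply: H. Qed.

Lemma path_neq i j : i < m -> j < m -> i != j -> x i != x j.
Proof. by move=> lti ltj nij; rewrite nth_uniq. Qed.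

Lemma path_nadj i j : i < j < m -> j != i.+1 -> ~~ adj (x i) (x j).
Proof.
case/andP=> ltij ltj nij; apply/negP => aij.
have sz := size_segment i ltj.
apply: (@no_cycle (segment p i j)); rewrite ?segment_uniq ?sz //.
- by move: ltij nij; clear; lia.
- move=> k ltk; rewrite !nth_segment ?addnS //; try by move: ltk; clear; lia.
  by apply: path_adj; move: ltk ltj; clear; lia.
- rewrite !nth_segment ?addn0 //; try by move: ltij; clear; lia.
  by have -> : (i + (j.+1 - i).-1)%N = j by move: ltij; clear; lia.
Qed.

Lemma path_cartan0 i j : i < j < m -> j != i.+1 ->
  A (x i) (x j) = 0%N /\ A (x j) (x i) = 0%N.
Proof.
move=> lt nij; have /andP[lij ltj] := lt.
apply: nadj_weight; rewrite ?pS ?path_nadj ?path_neq //; try exact: ltn_trans ltj.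
by rewrite neq_ltn lij.
Qed.

Lemma outer_adj_uniq z i j : z \notin p -> i < j < m -> adj z (x i) -> ~~ adj z (x j).
Proof.
move=> nz /andP[ltij ltj] azi; apply/negP => azj.
have sz := size_segment i ltj.
apply: (@no_cycle (z :: segment p i j)) => /=.
- by rewrite segment_uniq // mem_segment_sub.
- by rewrite sz; move: ltij; clear; lia.
- case=> [|k] /=; rewrite ltnS sz => ltk.
    by rewrite nth_segment ?addn0 //; move: ltij; clear; lia.
  rewrite !nth_segment ?addnS //; try by move: ltk; clear; lia.
  by apply: path_adj; move: ltk ltj; clear; lia.
- rewrite sz; have -> : (j.+1 - i)%N = (j - i).+1 by move: ltij; clear; lia.
  by rewrite /= nth_segment ?subnKC // ltnW.
Qed.

(** A node attached to an end would lengthen the path. *)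
Lemma outer_adj_inner z b : z \in I -> z \notin p -> b < m -> adj z (x b) ->
  0 < b /\ b.+1 < m.
Proof.
have [/and3P[_ pI' sp] mp] := lp.
move=> zI nz ltb azb; split.
  rewrite lt0n; apply/eqP => b0; have := mp (z :: p).
  rewrite /= ltnn => H; suff : false by []; apply: H.
  rewrite /is_path /= nz up zI pI' /=.
  by move: azb sp; rewrite b0; case: (p) => //= a q -> ->.
rewrite ltn_neqAle ltb andbT; apply/eqP => e; have := mp (rcons p z).
rewrite size_rcons ltnn => H; suff : false by []; apply: H.
rewrite /is_path rcons_uniq nz up all_rcons /= zI pI' /=.
apply/(sortedP 1%g) => i; rewrite size_rcons ltnS => lti.
rewrite !nth_rcons lti; case: (ltngtP i.+1 m) lti => // [lt|e'] _.
  exact: path_adj.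
rewrite adj_sym; move: azb.
by have -> : b = i by move: e e'; clear; lia.
Qed.

(** Affine D: weight 2 on the segment between the two branch nodes, and 1 on z, z' and the two path
    nodes just outside. When the branch nodes coincide it is the star with four arms. *)
Lemma outer_unique z z' b b' : z \in I -> z' \in I -> z \notin p -> z' \notin p ->
  z != z' -> b <= b' -> b < m -> b' < m -> adj z (x b) -> adj z' (x b') -> False.
Proof.
move=> zI z'I nz nz' nzz' leb ltb ltb' azb azb'.
have [b0 _] := outer_adj_inner zI nz ltb azb.
have [_ b1] := outer_adj_inner z'I nz' ltb' azb'.
have ltb1 : b.-1 < m by apply: leq_ltn_trans ltb; apply: leq_pred.
have ab : adj (x b) (x b.-1).
  by rewrite adj_sym; have := @path_adj b.-1; rewrite prednK //; apply.
have sz := size_segment b ltb'.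
have nxz i : i < m -> (x i == z) = false.
  by move=> lti; apply/negbTE; apply: contraNneq nz => <-; rewrite mem_nth.
have nxz' i : i < m -> (x i == z') = false.
  by move=> lti; apply/negbTE; apply: contraNneq nz' => <-; rewrite mem_nth.
have last : (b + (b'.+1 - b).-1)%N = b' by move: leb; clear; lia.
apply: (@loaded_path _ _ _ _ ca (segment p b b') [:: x b.-1; z] [:: x b'.+1; z'] (fun=> 1%N)).
- rewrite /= cat_uniq segment_uniq //= !inE !mem_cat !mem_segment // !inE.
  rewrite !nxz // !nxz' // [z == _]eq_sym nxz // (negPf nzz').
  rewrite !(negPf (mem_segment_sub _ _ _)) // nth_uniq //.
  by move: leb b0; clear; lia.
- rewrite !all_cat /= !pS // !(subsetP IS) // !andbT /=.
  apply/allP => y /(mem_subseq (segment_subseq _ _ _)) /(nthP 1%g)[i lti <-].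
  exact: pS.
- by rewrite sz; move: leb; clear; lia.
- move=> i; rewrite sz => lti; rewrite !nth_segment ?addnS //; try by move: lti; clear; lia.
  have /adjP[] // : adj (x (b + i)) (x (b + i).+1).
  by apply: path_adj; move: lti ltb'; clear; lia.
- rewrite big_cons big_seq1 !mul1n nth_segment ?addn0 //.
  move: azb; rewrite adj_sym => /adj_weight azb.
  exact: (leq_add (adj_weight ab) azb).
- rewrite big_cons big_seq1 !mul1n sz nth_segment ?last //.
  move: azb'; rewrite adj_sym => /adj_weight azb'.
  exact: (leq_add (adj_weight (path_adj b1)) azb').
- move=> y; rewrite nth_segment ?addn0 // !inE => /orP[] /eqP->.
    by apply: adj_weight; rewrite adj_sym.
  exact: adj_weight.
- move=> y; rewrite sz nth_segment ?last // !inE => /orP[] /eqP->.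
    by apply: adj_weight; rewrite adj_sym; apply: path_adj.
  exact: adj_weight.
Qed.

Definition simple_edges (es : seq (nat * nat)) : seq (nat * nat * nat) :=
  flatten [seq [:: (e.1, e.2, 1%N); (e.2, e.1, 1%N)] | e <- es].

Lemma affine_simple (l : seq W) cs es : uniq l -> all (mem S) l ->
  (forall e, e \in es -> adj (nth 1%g l e.1) (nth 1%g l e.2)) ->
  [&& 0 < nth 0%N cs 0, 0 < size l & all (fun i => (nth 0%N cs i).*2 <=
     sumn [seq (nth 0 cs k * bond_weight (simple_edges es) i k)%N |
       k <- iota 0 (size l) & k != i])
     (iota 0 (size l))] -> False.
Proof.
move=> ul lS H; apply: (affine_list ca ul lS) => e /flatten_mapP[e' /H ae].
rewrite !inE => /orP[] /eqP-> /=; apply: adj_weight => //.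
by rewrite adj_sym.
Qed.

Lemma nodes_uniq c k zs : c + k <= m -> uniq zs -> all [predC p] zs ->
  uniq ([seq x i | i <- iota c k] ++ zs).
Proof.
move=> le uz nz; rewrite cat_uniq uz andbT; apply/andP; split.
  rewrite map_inj_in_uniq ?iota_uniq // => i j.
  rewrite !mem_iota => lti ltj /eqP; rewrite nth_uniq //; first by move/eqP.
    by move: lti le; rewrite -/m; clear; lia.
  by move: ltj le; rewrite -/m; clear; lia.
apply/hasPn => z /(allP nz) /=; apply: contra => /mapP[i].
rewrite mem_iota => lti ->; apply: mem_nth.
by move: lti le; rewrite -/m; clear; lia.
Qed.

Lemma nodes_in c k zs : c + k <= m -> all (mem I) zs ->
  all (mem S) ([seq x i | i <- iota c k] ++ zs).
Proof.
move=> le zI; rewrite all_cat; apply/andP; split; apply/allP => z.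
  case/mapP=> i; rewrite mem_iota => lti ->; apply: pS.
  by move: lti le; clear; lia.
by move/(allP zI); apply: (subsetP IS).
Qed.

(** Maximality makes both arms of the path at x_b at least as long as the arm z, w. Three arms of
    length 2 form affine E6, with weight 3 at the centre. *)
Lemma outer_no_tail z w b : z \in I -> w \in I -> z \notin p -> w \notin p ->
  w != z -> b < m -> adj z (x b) -> adj w z -> False.
Proof.
move=> zI wI nz nw nwz ltb azb awz.
have [/and3P[_ pI' sp] mp] := lp.
have nd k y : y \notin p -> y \notin drop k p by apply: contra => /mem_drop.
have nt k y : y \notin p -> y \notin take k p by apply: contra => /mem_take.
have b2 : 1 < b.
  have := mp [:: w, z & drop b p]; rewrite /= size_drop -/m => H.
  suff le : (m - b).+1 < m by move: le ltb; clear; lia.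
  apply: H; rewrite /is_path /= wI zI awz drop_uniq // inE negb_or nwz.
  rewrite !nd //=; apply/andP; split.
    by apply/allP => y /mem_drop; apply: (allP pI').
  rewrite (drop_nth 1%g ltb) /= azb /=.
  by have := drop_sorted b sp; rewrite (drop_nth 1%g ltb).
have b3 : b.+2 < m.
  have := mp [:: w, z & rev (take b.+1 p)]; rewrite /= size_rev size_takel // => H.
  apply: H; rewrite /is_path /= wI zI awz rev_uniq take_uniq // inE negb_or nwz.
  rewrite !mem_rev !nt //= all_rev; apply/andP; split.
    by apply/allP => y /mem_take; apply: (allP pI').
  rewrite (take_nth 1%g ltb) rev_rcons /= azb /=.
  have := take_sorted b.+1 sp; rewrite (take_nth 1%g ltb) => srt.
  have : sorted adj (rev (rcons (take b p) (x b))).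
    by rewrite rev_sorted; apply: sub_sorted srt => u v; rewrite adj_sym.
  by rewrite rev_rcons.
have [c bc] : exists c, b = c.+2 by exists b.-2; move: b2; clear; lia.
have le : c + 5 <= m by move: b3 bc; clear; lia.
have E i : i < 4 -> adj (x (c + i)) (x (c + i).+1).
  by move=> lti; apply: path_adj; move: lti le; clear; lia.
apply: (@affine_simple ([seq x i | i <- iota c 5] ++ [:: z; w])
  [:: 1; 2; 3; 2; 1; 2; 1]%N [:: (0, 1); (1, 2); (2, 3); (3, 4); (2, 5); (5, 6)]%N).
- by apply: nodes_uniq; rewrite //= ?inE ?nz ?nw // eq_sym nwz.
- by apply: nodes_in; rewrite //= zI wI.
- have := E 0%N isT; have := E 1%N isT; have := E 2%N isT; have := E 3%N isT.
  rewrite addn0 !addnS addn0 => e3 e2 e1 e0 e.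
  rewrite !inE => /or4P[/eqP->|/eqP->|/eqP->|/or3P[/eqP->|/eqP->|/eqP->]] //=.
    by rewrite adj_sym -bc.
  by rewrite adj_sym.
- by vm_compute.
Qed.

Lemma outer_two_three_arms z b : z \in I -> z \notin p -> b < m -> adj z (x b) ->
  [|| (b <= 1), (m <= b.+2), (b == 2) && (m <= b + 5) | (m == b + 3) && (b <= 4)]%N.
Proof.
move=> zI nz ltb azb; have azb' := azb; rewrite adj_sym in azb'.
have [b0 b1] := outer_adj_inner zI nz ltb azb.
apply: contraT => H.
have hyp c k cs es d : c + k <= m -> b = c + d -> d < k ->
   (forall e, e \in es -> [|| (e.2 == e.1.+1) && (e.2 < k) | (e.1 == d) && (e.2 == k)]) ->
   [&& 0 < nth 0%N cs 0, 0 < k.+1 & all (fun i => (nth 0%N cs i).*2 <=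
     sumn [seq (nth 0 cs k' * bond_weight (simple_edges es) i k')%N |
       k' <- iota 0 k.+1 & k' != i]) (iota 0 k.+1)] -> False.
  move=> le bE ltd esE chk.
  have sz : size ([seq x i | i <- iota c k] ++ [:: z]) = k.+1.
    by rewrite size_cat size_map size_iota addn1.
  apply: (@affine_simple ([seq x i | i <- iota c k] ++ [:: z]) cs es).
  - by apply: nodes_uniq; rewrite //= ?inE ?nz.
  - by apply: nodes_in; rewrite //= zI.
  - move=> [e1 e2] /esE /= /orP[/andP[/eqP-> lt]|/andP[/eqP-> /eqP->]].
      rewrite !nth_cat size_map size_iota lt (ltnW lt).
      rewrite !(nth_map 0%N) ?size_iota ?(ltnW lt) // !nth_iota ?(ltnW lt) //.
      rewrite addnS; apply: path_adj; move: lt le; clear; lia.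
    rewrite !nth_cat size_map size_iota ltd ltnn subnn (nth_map 0%N) ?size_iota //.
    by rewrite nth_iota // -bE.
  - by rewrite sz.
suff: False by [].
case: (leqP 3 b) => b3.
  case: (leqP (b + 4) m) => mb.
    (* The weights are the coefficients of the null root of affine E7; below come those of affine
       E8, with the long arm on the left and then on the right. *)
    apply: (hyp (b - 3)%N 7 [:: 1; 2; 3; 4; 3; 2; 1; 2]%N
      [:: (0, 1); (1, 2); (2, 3); (3, 4); (4, 5); (5, 6); (3, 7)]%N 3) => //.
    - by move: b3 mb; clear; lia.
    - by move: b3; clear; lia.
    - move=> e; rewrite !inE.
      by do 6!(case/orP=> [/eqP-> //|]); move/eqP->.
  have b5 : 5 <= b by move: H b3 mb; clear; lia.
  apply: (hyp (b - 5)%N 8 [:: 1; 2; 3; 4; 5; 6; 4; 2; 3]%N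
     [:: (0, 1); (1, 2); (2, 3); (3, 4); (4, 5); (5, 6); (6, 7); (5, 8)]%N 5) => //.
  - by move: H b3 mb b5; clear; lia.
  - by move: b5; clear; lia.
  - move=> e; rewrite !inE.
    by do 7!(case/orP=> [/eqP-> //|]); move/eqP->.
apply: (hyp (b - 2)%N 8 [:: 2; 4; 6; 5; 4; 3; 2; 1; 3]%N
     [:: (0, 1); (1, 2); (2, 3); (3, 4); (4, 5); (5, 6); (6, 7); (2, 8)]%N 2) => //.
- by move: H b3 b0; clear; lia.
- by move: H b3 b0; clear; lia.
- move=> e; rewrite !inE.
  by do 7!(case/orP=> [/eqP-> //|]); move/eqP->.
Qed.

End LongestPath.
End Classification.

(** * Multiple bonds and the shapes that remain *)

Section MultipleBonds.
Variables (W : finGroupType) (S : {set W}) (A : W -> W -> nat).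
Variable M : W -> W -> W -> int.
Hypothesis ca : cartan_action S A M.

Local Notation adj := (dynkin_edge S).

Definition multi x y := (1 < A x y) || (1 < A y x).

Lemma multi_sym x y : multi x y = multi y x. Proof. exact: orbC. Qed.

Lemma not_multi x y : adj x y -> ~~ multi x y -> A x y = 1%N /\ A y x = 1%N.
Proof.
case/(adjP ca) => _ _ _; rewrite -!lt0n /multi => a1 a2.
by case/norP; rewrite -!leqNgt => b1 b2; split; apply/eqP; rewrite eqn_leq ?b1 ?b2.
Qed.

(* The affine weight that makes y load x by at least 2 along a multiple bond. *)
Definition load_weight x y := if 1 < A x y then 1%N else 2.

Lemma load_weightP x y : adj x y -> multi x y ->
  1 < load_weight x y * A x y /\ load_weight x y <= A y x.
Proof.
case/(adjP ca) => _ _ _; rewrite -!lt0n /multi /load_weight => a1 a2.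
by case: (ltnP 1 (A x y)) => h //= a3; rewrite ?mul1n //; split=> //; rewrite mul2n -addnn; exact: (leq_add a1 a1).
Qed.

(** With weights [A x y] and 2, a product of at least 4 makes the two nodes an affine diagram. *)
Lemma bond_lt4 x y : adj x y -> A x y * A y x < 4.
Proof.
move=> axy; have [xS yS nxy a1 a2] := adjP ca axy.
rewrite ltnNge; apply/negP => ge4.
apply: (@affine_list _ _ _ _ ca [:: x; y] [:: A x y; 2] [:: (0, 1, A x y); (1, 0, A y x)]%N).
- by rewrite /= inE nxy.
- by rewrite /= xS yS.
- by move=> e; rewrite !inE => /orP[] /eqP->.
- rewrite /= lt0n a1 /= !addn0 andbT mul2n leqnn /=.
  exact: ge4.
Qed.

(** The two orientations of the triple bond give affine G2 and its dual, hence two sets of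
    weights. *)
Lemma affine_G2 x y z : adj x y -> adj y z -> x != z -> (A y z * A z y)%N = 3 -> False.
Proof.
move=> axy ayz nxz a3; have [xS yS nxy _ _] := adjP ca axy.
have [_ zS nyz _ _] := adjP ca ayz.
have ul : uniq [:: x; y; z] by rewrite /= !inE negb_or nxy nxz nyz.
have lS : all (mem S) [:: x; y; z] by rewrite /= xS yS zS.
have w1 := adj_weight ca axy; have ayx := axy; rewrite (adj_sym ca) in ayx.
have w2 := adj_weight ca ayx.
have [[b c]|[b c]] : (A y z = 3 /\ A z y = 1)%N \/ (A y z = 1 /\ A z y = 3)%N.
  move: a3; move: (A y z) (A z y) => a b; clear=> ab.
  by case: a b ab => [|[|[|[|a]]]] [|[|[|[|b]]]] //=; auto; lia.
- apply: (@affine_list _ _ _ _ ca [:: x; y; z] [:: 1; 2; 1]%N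
    [:: (0, 1, 1); (1, 0, 1); (1, 2, 3); (2, 1, 1)]%N) => //.
  move=> e; rewrite !inE => /or4P[] /eqP-> //=; by rewrite ?b ?c.
- apply: (@affine_list _ _ _ _ ca [:: x; y; z] [:: 1; 2; 3]%N
    [:: (0, 1, 1); (1, 0, 1); (1, 2, 1); (2, 1, 3)]%N) => //.
  move=> e; rewrite !inE => /or4P[] /eqP-> //=; by rewrite ?b ?c.
Qed.

(** Affine F4 or its dual, according to which entry of the multiple bond exceeds 1. *)
Lemma affine_F4 a1 a2 a3 b c : uniq [:: a1; a2; a3; b; c] ->
  adj a1 a2 -> adj a2 a3 -> adj a3 b -> adj b c -> multi a3 b -> False.
Proof.
move=> ul e12 e23 e3b ebc mu.
have lS : all (mem S) [:: a1; a2; a3; b; c].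
  have [? ? _ _ _] := adjP ca e12; have [_ ? _ _ _] := adjP ca e23.
  have [_ ? _ _ _] := adjP ca e3b; have [_ ? _ _ _] := adjP ca ebc.
  by apply/and5P; split=> //=; rewrite andbT.
have w x y : adj x y -> 0 < A x y /\ 0 < A y x.
  by move=> e; split; apply: (adj_weight ca); rewrite // (adj_sym ca).
have [? ?] := w _ _ e12; have [? ?] := w _ _ e23.
have [? ?] := w _ _ e3b; have [? ?] := w _ _ ebc.
case: (ltnP 1 (A a3 b)) => h.
  apply: (@affine_list _ _ _ _ ca [:: a1; a2; a3; b; c] [:: 1; 2; 3; 2; 1]%N
    [:: (0, 1, 1); (1, 0, 1); (1, 2, 1); (2, 1, 1); (2, 3, 2); (3, 2, 1); (3, 4, 1); (4, 3, 1)]%N) => //.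
  move=> e; rewrite !inE.
  by do 7!(case/orP=> [/eqP-> //|]); move/eqP->.
have h' : 1 < A b a3 by case/orP: mu => // h2; rewrite ltnNge h in h2.
apply: (@affine_list _ _ _ _ ca [:: a1; a2; a3; b; c] [:: 1; 2; 3; 4; 2]%N
    [:: (0, 1, 1); (1, 0, 1); (1, 2, 1); (2, 1, 1); (2, 3, 1); (3, 2, 2); (3, 4, 1); (4, 3, 1)]%N) => //.
move=> e; rewrite !inE.
by do 7!(case/orP=> [/eqP-> //|]); move/eqP->.
Qed.

Section OnPath.
Variable I : {set W}.
Hypothesis IS : I \subset S.

(** Affine B or a dual form: the path from [b] to [j] is loaded by a fork at one end and by the
    multiple bond at the other. *)
Lemma multi_right_of_branch p z b j : longest_path S I p -> z \in I ->
  z \notin p -> b < size p -> adj z (nth 1%g p b) -> b <= j -> j.+1 < size p ->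
  multi (nth 1%g p j) (nth 1%g p j.+1) -> False.
Proof.
move=> lp zI nz ltb azb lebj ltj mu; set x := nth 1%g p.
have up : uniq p by case: lp => /and3P[].
have pS i : i < size p -> x i \in S.
  move=> lti; apply: (subsetP IS); case: lp => /and3P[_ /allP H _] _.
  by apply: H; rewrite mem_nth.
have [b0 _] := outer_adj_inner ca lp zI nz ltb azb.
have ltj' := ltnW ltj.
have ltb1 : b.-1 < size p by apply: leq_ltn_trans ltb; apply: leq_pred.
have ab : adj (x b) (x b.-1).
  by rewrite (adj_sym ca); have := @path_adj _ _ _ _ lp b.-1; rewrite prednK //; apply.
have sz := size_segment b ltj'.
have nxz i : i < size p -> (x i == z) = false.
  by move=> lti; apply/negbTE; apply: contraNneq nz => <-; rewrite mem_nth.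
have last : (b + (j.+1 - b).-1)%N = j by move: lebj; slia.
have aj := path_adj lp ltj.
have [lw1 lw2] := load_weightP aj mu.
pose cz y := if y == x j.+1 then load_weight (x j) (x j.+1) else 1%N.
have cz1 : cz (x b.-1) = 1%N.
  have nb : (b.-1 == j.+1) = false by move: lebj; slia.
  by rewrite /cz nth_uniq // nb.
have cz2 : cz z = 1%N by rewrite /cz eq_sym nxz.
have cz3 : cz (x j.+1) = load_weight (x j) (x j.+1) by rewrite /cz eqxx.
apply: (@loaded_path _ _ _ _ ca (segment p b j) [:: x b.-1; z] [:: x j.+1] cz).
- rewrite /= cat_uniq segment_uniq //= !inE !mem_cat !mem_segment // !inE.
  rewrite !nxz // [z == _]eq_sym nxz //.
  rewrite !(negPf (mem_segment_sub _ _ _)) // nth_uniq //.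
  by move: lebj b0; slia.
- rewrite !all_cat /= !pS // !(subsetP IS) // !andbT /=.
  apply/allP => y /(mem_subseq (segment_subseq _ _ _)) /(nthP 1%g)[i lti <-].
  exact: pS.
- by rewrite sz; move: lebj; slia.
- move=> i; rewrite sz => lti; rewrite !nth_segment ?addnS //; try by move: lti; slia.
  have /(adjP ca)[] // : adj (x (b + i)) (x (b + i).+1).
  by apply: (path_adj lp); slia.
- rewrite big_cons big_seq1 cz1 cz2 !mul1n nth_segment ?addn0 //.
  move: azb; rewrite (adj_sym ca) => /(adj_weight ca) azb.
  exact: (leq_add (adj_weight ca ab) azb).
- by rewrite big_seq1 cz3 sz nth_segment ?last.
- move=> y; rewrite nth_segment ?addn0 // !inE => /orP[] /eqP->; rewrite ?cz1 ?cz2.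
    by apply: (adj_weight ca); rewrite (adj_sym ca).
  exact: (adj_weight ca).
- by move=> y; rewrite sz nth_segment ?last // !inE => /eqP->; rewrite cz3.
Qed.

Lemma multi_left_of_branch p z b j : longest_path S I p -> z \in I ->
  z \notin p -> b < size p -> adj z (nth 1%g p b) -> j < b ->
  multi (nth 1%g p j) (nth 1%g p j.+1) -> False.
Proof.
move=> lp zI nz ltb azb ltjb mu.
have szr := size_rev p; have ltj : j < size p := ltn_trans ltjb ltb.
apply: (@multi_right_of_branch (rev p) z (size p - b.+1) (size p - j.+2)).
- exact: (longest_path_rev ca).
- by [].
- by rewrite mem_rev.
- by rewrite szr; move: ltb; slia.
- rewrite nth_rev; last by move: ltb; slia.
  by have -> : (size p - (size p - b.+1).+1)%N = b by move: ltb; slia.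
- by move: ltb ltjb; slia.
- by rewrite szr; move: ltb ltjb; slia.
rewrite multi_sym !nth_rev; try by move: ltb ltjb; slia.
have -> : (size p - (size p - j.+2).+2)%N = j by move: ltb ltjb; slia.
by have -> : (size p - (size p - j.+2).+1)%N = j.+1 by move: ltb ltjb; slia.
Qed.

(** The loaded path is x_b alone, with its two path neighbours on one side and the bond to z on the
    other. *)
Lemma multi_at_branch p z b : longest_path S I p -> z \in I ->
  z \notin p -> b < size p -> adj z (nth 1%g p b) -> multi (nth 1%g p b) z -> False.
Proof.
move=> lp zI nz ltb azb mu; set x := nth 1%g p.
have up : uniq p by case: lp => /and3P[].
have pS i : i < size p -> x i \in S.
  move=> lti; apply: (subsetP IS); case: lp => /and3P[_ /allP H _] _.
  by apply: H; rewrite mem_nth.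
have [b0 b1] := outer_adj_inner ca lp zI nz ltb azb.
have ltb1 : b.-1 < size p by apply: leq_ltn_trans ltb; apply: leq_pred.
have ab : adj (x b) (x b.-1).
  by rewrite (adj_sym ca); have := @path_adj _ _ _ _ lp b.-1; rewrite prednK //; apply.
have ab' := path_adj lp b1.
have nxz i : i < size p -> (x i == z) = false.
  by move=> lti; apply/negbTE; apply: contraNneq nz => <-; rewrite mem_nth.
have abz : adj (x b) z by rewrite (adj_sym ca).
have [lw1 lw2] := load_weightP abz mu.
pose cz y := if y == z then load_weight (x b) z else 1%N.
have cz1 i : i < size p -> cz (x i) = 1%N by move=> lti; rewrite /cz nxz.
have cz2 : cz z = load_weight (x b) z by rewrite /cz eqxx.
apply: (@loaded_path _ _ _ _ ca [:: x b] [:: x b.-1; x b.+1] [:: z] cz) => //=.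
- rewrite !inE !nxz // !nth_uniq // !orbF.
  by move: b0; slia.
- by rewrite !pS // (subsetP IS).
- rewrite big_cons big_seq1 !cz1 // !mul1n.
  exact: (leq_add (adj_weight ca ab) (adj_weight ca ab')).
- by rewrite big_seq1 cz2.
- move=> y; rewrite !inE => /orP[] /eqP->; rewrite cz1 //; apply: (adj_weight ca);
    by rewrite (adj_sym ca).
- by move=> y; rewrite inE => /eqP->; rewrite cz2.
Qed.

Lemma multi_unique p i j : longest_path S I p -> i < j -> j.+1 < size p ->
  multi (nth 1%g p i) (nth 1%g p i.+1) -> multi (nth 1%g p j) (nth 1%g p j.+1) -> False.
Proof.
move=> lp lij ltj mui muj; set x := nth 1%g p.
have up : uniq p by case: lp => /and3P[].
have pS k : k < size p -> x k \in S.
  move=> lti; apply: (subsetP IS); case: lp => /and3P[_ /allP H _] _.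
  by apply: H; rewrite mem_nth.
have ltj' := ltnW ltj; have lti : i.+1 < size p := leq_ltn_trans lij ltj'.
have sz := size_segment i.+1 ltj'.
have last : (i.+1 + (j.+1 - i.+1).-1)%N = j by move: lij; slia.
have aj := path_adj lp ltj; have ai := path_adj lp lti.
rewrite (adj_sym ca) in ai; rewrite multi_sym in mui.
have [lw1 lw2] := load_weightP aj muj.
have [lw3 lw4] := load_weightP ai mui.
pose cz y := if y == x i then load_weight (x i.+1) (x i) else load_weight (x j) (x j.+1).
have cz1 : cz (x i) = load_weight (x i.+1) (x i) by rewrite /cz eqxx.
have cz2 : cz (x j.+1) = load_weight (x j) (x j.+1).
  rewrite /cz nth_uniq //; last exact: ltnW.
  have -> : (j.+1 == i) = false by move: lij; slia.
  by [].
apply: (@loaded_path _ _ _ _ ca (segment p i.+1 j) [:: x i] [:: x j.+1] cz).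
- rewrite /= cat_uniq segment_uniq //= !mem_cat !mem_segment ?(ltnW lti) // ?inE.
  rewrite nth_uniq ?(ltnW lti) //.
  by move: lij; slia.
- rewrite !all_cat /= !pS ?(ltnW lti) // !andbT /=.
  apply/allP => y /(mem_subseq (segment_subseq _ _ _)) /(nthP 1%g)[k ltk <-].
  exact: pS.
- by rewrite sz; move: lij; slia.
- move=> k; rewrite sz => ltk; rewrite !nth_segment ?addnS //; try by move: ltk; slia.
  have /(adjP ca)[] // : adj (x (i.+1 + k)) (x (i.+1 + k).+1).
  by apply: (path_adj lp); slia.
- by rewrite big_seq1 cz1 nth_segment ?addn0.
- by rewrite big_seq1 cz2 sz nth_segment ?last.
- by move=> y; rewrite nth_segment ?addn0 // !inE => /eqP->; rewrite cz1.
- by move=> y; rewrite sz nth_segment ?last // !inE => /eqP->; rewrite cz2.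
Qed.

Definition path_shape (p : seq W) := forall i j, i < j < size p -> j != i.+1 ->
  A (nth 1%g p i) (nth 1%g p j) = 0%N /\ A (nth 1%g p j) (nth 1%g p i) = 0%N.

Definition simple_at (p : seq W) j :=
  A (nth 1%g p j) (nth 1%g p j.+1) = 1%N /\ A (nth 1%g p j.+1) (nth 1%g p j) = 1%N.

(** [j0] locates the only bond that may be multiple; a [j0] past the last bond means that all are
    simple. Size 2 is set apart because it admits the triple bond of G2. *)
Definition unbranched p := exists j0,
  (forall j, j.+1 < size p -> j != j0 -> simple_at p j) /\
  (j0.+1 < size p -> size p = 2 \/
    (A (nth 1%g p j0) (nth 1%g p j0.+1) * A (nth 1%g p j0.+1) (nth 1%g p j0))%N = 2 /\
    (0 < j0 -> j0.+2 < size p -> size p = 4)).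

Definition branched p z b :=
  [/\ 0 < b, b.+1 < size p, forall j, j.+1 < size p -> simple_at p j,
      A (nth 1%g p b) z = 1%N /\ A z (nth 1%g p b) = 1%N &
      (forall i, i < size p -> i != b -> A (nth 1%g p i) z = 0%N /\ A z (nth 1%g p i) = 0%N) /\
      [|| (b <= 1), (size p <= b.+2), (b == 2) && (size p <= b + 5) |
         (size p == b + 3) && (b <= 4)]%N].

Lemma classification p : dynkin_connected I -> longest_path S I p -> I != set0 ->
  [/\ uniq p, 0 < size p, path_shape p &
   (I = [set x in p] /\ unbranched p) \/
   exists z b, [/\ z \notin p, I = [set x in z :: p] & branched p z b]].
Proof.
move=> conn lp In0; have [/and3P[up pI sp] mp] := lp; set x := nth 1%g p.
have xI i : i < size p -> x i \in I by move=> lti; apply: (allP pI); rewrite mem_nth.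
have p0 : 0 < size p.
  have /set0Pn[r rI] := In0; apply: (mp [:: r]).
  by rewrite /is_path /= rI.
have psh : path_shape p by move=> i j; apply: (path_cartan0 ca IS lp).
split=> //.
(* By connectedness a part of [I] stable under adjacency is all of it; this is used for the path,
   with z or alone. *)
have closed_eq (C : {set W}) : C \subset I -> x 0%N \in C ->
    (forall a b, a \in C -> b \in I -> adj a b -> b \in C) -> I = C.
  move=> CI x0C cl; apply/eqP; rewrite eqEsubset CI andbT; apply/subsetP => y yI.
  have clo : closed (dynkin_edge I) (mem C).
    move=> a b eab; have /and4P[aI bI nab ord] := eab.
    have aab : adj a b by apply/and4P; split=> //; apply: (subsetP IS).
    apply/idP/idP => /= H; first exact: cl aab.
    by apply: (cl b) => //; rewrite (adj_sym ca).
  by have := closed_connect clo (conn _ _ (xI _ p0) yI) => /= <-.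
case: (boolP [exists z in I, (z \notin p) && [exists i : 'I_(size p), adj z (x i)]]).
  case/exists_inP => z zI /andP[nz /existsP[b azb]]; right; exists z, b.
  have ltb := ltn_ord b.
  have [b0 b1] := outer_adj_inner ca lp zI nz ltb azb.
  have E : I = [set x in z :: p].
    apply: closed_eq.
    - apply/subsetP => y; rewrite !inE => /orP[/eqP-> //|]; exact: (allP pI).
    - by rewrite !inE mem_nth // orbT.
    move=> a c; rewrite !inE => aC cI aac; apply: contraT; rewrite negb_or => /andP[ncz ncp].
    case/orP: aC => [/eqP az|/(nthP 1%g)[i lti ai]].
      case: (outer_no_tail ca IS lp zI cI nz ncp ncz ltb azb).
      by rewrite (adj_sym ca) -az.
    have aci : adj c (x i) by rewrite (adj_sym ca) /x ai.
    case: (leqP b i) => [le|/ltnW le].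
      by case: (outer_unique ca IS lp zI cI nz ncp _ le ltb lti azb aci); rewrite eq_sym.
    by case: (outer_unique ca IS lp cI zI ncp nz ncz le lti ltb aci azb).
  split=> //; split=> //.
  - move=> j ltj; apply: not_multi; first exact: (path_adj lp ltj).
    apply/negP => mu; case: (leqP b j) => le.
      exact: (multi_right_of_branch lp zI nz ltb azb le ltj mu).
    exact: (multi_left_of_branch lp zI nz ltb azb le mu).
  - apply: not_multi; first by rewrite (adj_sym ca).
    by apply/negP => mu; apply: (multi_at_branch lp zI nz ltb azb mu).
  - split; last exact: (outer_two_three_arms ca IS lp zI nz ltb azb).
    move=> i lti nib; apply: (nadj_weight ca); rewrite ?(subsetP IS) ?xI //.
      by apply: contraNneq nz => <-; rewrite mem_nth.
    rewrite (adj_sym ca); case: (ltngtP i b) nib => // [lt|gt] _.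
      have lt' : i < b < size p by rewrite lt ltb.
      apply/negP => azi; have := outer_adj_uniq ca lp nz lt' azi.
      by rewrite azb.
    have gt' : b < i < size p by rewrite gt lti.
    exact: (outer_adj_uniq ca lp nz gt' azb).
move=> noz; left.
have E : I = [set x in p].
  apply: closed_eq.
  - by apply/subsetP => y; rewrite inE; apply: (allP pI).
  - by rewrite inE mem_nth.
  move=> a c; rewrite !inE => /(nthP 1%g)[i lti ai] cI aac.
  apply: contraNT noz => ncp; apply/exists_inP; exists c => //; rewrite ncp /=.
  by apply/existsP; exists (Ordinal lti); rewrite (adj_sym ca) /x ai.
split=> //.
case: (boolP [exists j : 'I_(size p), (j.+1 < size p) && multi (x j) (x j.+1)]); last first.
  move=> nom; exists (size p); split; last by move/ltnW; rewrite ltnn.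
  move=> j ltj _; apply: not_multi; first exact: (path_adj lp ltj).
  apply: contraNN nom => mu; apply/existsP; exists (Ordinal (ltnW ltj)).
  by rewrite ltj.
case/existsP => [[j0 ltj0'] /= /andP[ltj0 mu]]; exists j0; split.
  move=> j ltj nj; apply: not_multi; first exact: (path_adj lp ltj).
  apply/negP => muj; case: (ltngtP j j0) nj => // [lt|gt] _.
    exact: (multi_unique lp lt ltj0 muj mu).
  exact: (multi_unique lp gt ltj mu muj).
move=> _; have aj := path_adj lp ltj0.
have lt4 := bond_lt4 aj; have w1 := adj_weight ca aj.
have aj' := aj; rewrite (adj_sym ca) in aj'; have w2 := adj_weight ca aj'.
have nq a b : a < size p -> b < size p -> a != b -> x a != x b.
  by move=> la lb nab; rewrite nth_uniq.
have [e2|e3] : (A (x j0) (x j0.+1) * A (x j0.+1) (x j0) = 2 \/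
    A (x j0) (x j0.+1) * A (x j0.+1) (x j0) = 3)%N.
  move: mu lt4 w1 w2; rewrite /multi -/(x j0) -/(x j0.+1).
  move: (A (x j0) (x j0.+1)) (A (x j0.+1) (x j0)) => a b; clear; nia.
  (* With nodes on both sides of the double bond, a fifth node on either side gives the
     configuration of [affine_F4]. *)
  right; split=> // j00 lt2; apply/eqP; apply: contraT => n4; exfalso.
  have aj1 : adj (x j0.-1) (x j0).
    by have := @path_adj _ _ _ _ lp j0.-1; rewrite prednK //; apply; apply: ltnW.
  have aj2 := path_adj lp lt2.
  case: (ltnP j0.+3 (size p)) => lt3.
    have aj3 := path_adj lp lt3.
    apply: (@affine_F4 (x j0.+3) (x j0.+2) (x j0.+1) (x j0) (x j0.-1)).
    - by rewrite /= !inE !negb_or !nq //; move: j00 lt3; slia.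
    - by rewrite (adj_sym ca).
    - by rewrite (adj_sym ca).
    - by rewrite (adj_sym ca).
    - by rewrite (adj_sym ca).
    - by rewrite multi_sym.
  have j1 : 1 < j0 by move: lt3 lt2 n4 j00; slia.
  have [k kE] : exists k, j0 = k.+2 by exists j0.-2; move: j1; slia.
  have aj0 : adj (x k) (x k.+1) by apply: (path_adj lp); move: lt2; rewrite kE; slia.
  apply: (@affine_F4 (x k) (x k.+1) (x k.+2) (x k.+3) (x k.+4)).
  - by rewrite /= !inE !negb_or !nq //; move: lt2; rewrite kE; slia.
  - by [].
  - by move: aj1; rewrite kE.
  - by move: aj; rewrite kE.
  - by move: aj2; rewrite kE.
  - by move: mu; rewrite kE.
left; apply/eqP; apply: contraT => n2; exfalso.
have [j00|j00] := posnP j0.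
  have lt2 : j0.+2 < size p by move: ltj0 n2; rewrite j00; slia.
  have aj2 := path_adj lp lt2.
  apply: (@affine_G2 (x j0.+2) (x j0.+1) (x j0)); rewrite 1?(adj_sym ca) //.
    by rewrite nq //; slia.
  by rewrite mulnC.
have aj1 : adj (x j0.-1) (x j0).
  by have := @path_adj _ _ _ _ lp j0.-1; rewrite prednK //; apply; apply: ltnW.
apply: (@affine_G2 (x j0.-1) (x j0) (x j0.+1)) => //.
by rewrite nq //; move: j00 ltj0; slia.
Qed.

End OnPath.
End MultipleBonds.

(** * Coefficient vectors *)

Section States.
Variables (W : finGroupType) (S : {set W}) (A : W -> W -> nat).
Variable M : W -> W -> W -> int.
Hypothesis ca : cartan_action S A M.
Variables (I : {set W}) (s : W).
Hypotheses (IS : I \subset S) (sI : s \in I).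
Let ISm r : r \in I -> r \in S. Proof. exact: (subsetP IS). Qed.
Let sS : s \in S. Proof. exact: ISm. Qed.

Local Notation len := (cox_length S).
Local Notation X := (min_reps I (I :\ s)).
Implicit Types (x y : W) (u : nat -> int).

Definition unique_ascents k := forall x, x \in X -> len x < k ->
  {in I &, forall p q, (0 < M x s p)%R -> (0 < M x s q)%R -> p = q}.

Lemma coef_at1 r : r \in I -> M 1 s r = ((s == r)%:R)%R.
Proof. by move=> rI; rewrite (ca_one ca) // ISm. Qed.

Lemma coef_mulr x r q : r \in I -> q \in I ->
  M (x * r) s q = (if q == r then - M x s r else M x s q + (A r q)%:Z * M x s r)%R.
Proof. by move=> rI qI; rewrite (M_mulr ca) // ISm. Qed.

Lemma no_descent_one x : x \in X -> {in I, forall r, (0 <= M x s r)%R} -> x = 1.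
Proof.
move=> xX H; apply/eqP; apply: contraT => nx1.
have [r rI lt0] := quot_descent ca IS sI xX nx1.
by have := H r rI; rewrite leNgt lt0.
Qed.

(** Only 1 and s have length below 2 in the quotient. The ascent of 1 is s, and those of s are its
    neighbours. *)
Lemma unique_ascents2 : (forall q r, q \in I -> r \in I ->
    dynkin_edge S s q -> dynkin_edge S s r -> q = r) -> unique_ascents 2.
Proof.
move=> leaf x xX lt2 q r qI rI.
have xS : x \in <<S>> by apply: (min_reps_gen ca IS (subsetDl I [set s]) xX).
have one q' : q' \in I -> (0 < M 1 s q')%R -> q' = s.
  by move=> qI'; rewrite coef_at1 //; case: eqP.
have [x1|nx1] := eqVneq x 1; first by rewrite x1 => /(one q qI)-> /(one r rI)->.
have [t tI ltt] := quot_descent ca IS sI xX nx1.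
have [xtX xtl] := quot_down ca IS sI xX tI ltt.
have xt1 : x * t = 1.
  apply: (cox_length_eq0 (K := S)); first by rewrite groupM // mem_gen // ISm.
  by move: lt2; rewrite xtl; slia.
have xE : x = t by rewrite -[x](simple_mulK ca x (ISm tI)) xt1 mul1g.
have ts : t = s.
  by apply: one => //; rewrite -xt1 coef_mulr // eqxx oppr_gt0.
have nb q' : q' \in I -> (0 < M x s q')%R -> dynkin_edge S s q'.
  move=> qI'; have -> : M x s q' = M (1 * s) s q' by rewrite mul1g xE ts.
  rewrite coef_mulr // (coef_at1 sI) eqxx.
  rewrite (dynkin_edgeE ca) ?ISm //; case: eqVneq => // nq.
  by rewrite coef_at1 // eq_sym (negPf nq) add0r mulr1 -lt0n.
by move=> /(nb q qI) aq /(nb r rI) ar; apply: leaf.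
Qed.

Section Diff.
Variables (y : nat -> W) (k : nat) (g : int).
Hypothesis yI : forall i, i < k -> y i \in I.
Hypothesis y_inj : forall i j, i < k -> j < k -> i != j -> y i != y j.
Hypothesis y_simple : forall i j, i < k -> j < k -> i != j ->
  A (y i) (y j) = ((j == i.+1) || (i == j.+1)) :> nat.

(* On a path of simple bonds, the coefficients are the successive differences
   of a vector u, on which the reflections act as in the symmetric group. *)
Definition diff_state u x := forall t, t < k -> M x s (y t) = (g * (u t - u t.+1))%R.

Definition swap u i t : int := if t == i then u i.+1 else if t == i.+1 then u i else u t.

Lemma diff_state_ext u u' x : (forall t, t <= k -> u t = u' t) ->
  diff_state u x -> diff_state u' x.
Proof. by move=> e H t lt; rewrite H // !e // ltnW. Qed.

Lemma diff_state_swap u x i : i < k -> diff_state u x ->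
  diff_state (swap u i) (x * y i).
Proof.
move=> lti H t ltt; rewrite coef_mulr ?yI //.
case: (eqVneq t i) => [->|nti].
  have ni : (i.+1 == i) = false by slia.
  by rewrite ?eqxx H // /swap ?eqxx ni ?eqxx; ring.
rewrite (negPf (y_inj ltt lti nti)) y_simple // 1?eq_sym // !H // /swap (negPf nti).
case: (eqVneq t i.+1) => [->|nt1] /=.
  have -> : (i.+2 == i) = false by slia.
  have -> : (i.+2 == i.+1) = false by slia.
  by ring.
rewrite eqSS (negPf nti); case: (eqVneq i t.+1) => [->|nt2] /=.
  by rewrite ?eqxx; ring.
by rewrite ?[t.+1 == i]eq_sym ?(negPf nt2) /=; ring.
Qed.

End Diff.

(** Recognizes a product by walking down: [Q i] describes what remains when i letters are left, and
    [Q 0] only the identity. *)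
Lemma path_product_unique (y : nat -> W) n (Q : nat -> W -> Prop) :
  (forall x, Q 0%N x -> x = 1) ->
  (forall i x, i < n -> Q i.+1 x -> Q i (x * y i)) ->
  (forall i, i < n -> y i \in I) ->
  forall i x, i <= n -> Q i x -> x = \prod_(0 <= j < i) y j.
Proof.
move=> Q0 Qs yI; elim=> [|i IHi] x lei Qx; first by rewrite big_nil; apply: Q0.
rewrite big_nat_recr //= -(IHi _ (ltnW lei) (Qs i x lei Qx)).
by rewrite (simple_mulK ca) // ISm // yI.
Qed.

End States.

(** In the 0/1 models a step from 0 to 1 is a descent, so this lemma produces descents between two
    known entries. *)
Lemma rise_exists (u : nat -> int) a b : a <= b -> u a = 0%R -> u b = 1%R ->
  (forall t, a <= t <= b -> u t = 0%R \/ u t = 1%R) ->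
  exists t, [/\ a <= t, t < b, u t = 0%R & u t.+1 = 1%R].
Proof.
move=> leab ua ub bin; have [n bE] : exists n, b = (a + n)%N.
  by exists (b - a)%N; rewrite subnKC.
rewrite bE in ub bin *; elim: n ub bin {leab bE} => [|n IHn] ub bin.
  by move: ub; rewrite addn0 ua.
have /bin[e|e] : a <= a + n <= a + n.+1 by rewrite leq_addr leq_add2l leqnSn.
- by exists (a + n)%N; rewrite leq_addr addnS ltnSn -addnS.
have [|t [h1 h2 h3 h4]] := IHn e.
  by move=> t /andP[h1 h2]; apply: bin; rewrite h1 (leq_trans h2) // leq_add2l.
by exists t; split=> //; rewrite addnS ltnS ltnW.
Qed.

(** * Quotients that are chains: types A, B from the long arm, rank 2 *)

Section Families.
Variables (W : finGroupType) (S : {set W}) (A : W -> W -> nat).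
Variable M : W -> W -> W -> int.
Hypothesis ca : cartan_action S A M.
Variables (I : {set W}) (s : W).
Hypotheses (IS : I \subset S) (sI : s \in I).
Let ISm r : r \in I -> r \in S. Proof. exact: (subsetP IS). Qed.
Let sS : s \in S. Proof. exact: ISm. Qed.

Local Notation len := (cox_length S).
Local Notation X := (min_reps I (I :\ s)).
Implicit Types (x y : W) (u : nat -> int).

Lemma simple_path_cartan (p : seq W) n : n <= size p -> path_shape A p ->
  (forall j, j.+1 < n -> simple_at A p j) ->
  forall i j, i < n -> j < n -> i != j ->
  A (nth 1 p i) (nth 1 p j) = ((j == i.+1) || (i == j.+1)) :> nat.
Proof.
move=> len_ psh sim.
have lt_case i j : i < j -> j < n ->
    A (nth 1 p i) (nth 1 p j) = (j == i.+1) :> nat /\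
    A (nth 1 p j) (nth 1 p i) = (j == i.+1) :> nat.
  move=> lij lj; case: eqP => [e|/eqP ne]; first by rewrite e; apply: sim; rewrite -e.
  by apply: psh => //; rewrite lij (leq_trans lj).
move=> i j li lj; rewrite neq_ltn => /orP[lt|lt].
  have [-> _] := lt_case _ _ lt lj.
  have -> : (i == j.+1) = false by slia.
  by rewrite orbF.
have [_ ->] := lt_case _ _ lt li.
by have -> : (j == i.+1) = false by slia.
Qed.

Section Path.
Variable p : seq W.
Hypotheses (IE : I = [set x in p]) (up : uniq p) (p0 : 0 < size p).
Hypotheses (psh : path_shape A p) (ps : nth 1 p 0 = s).
Local Notation m := (size p).
Local Notation x_ i := (nth 1 p i).

Let xI i : i < m -> x_ i \in I.
Proof. by move=> lti; rewrite IE inE mem_nth. Qed.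
Let xneq i j : i < m -> j < m -> i != j -> x_ i != x_ j.
Proof. by move=> li lj nij; rewrite nth_uniq. Qed.
Let exI r : r \in I -> exists2 i, i < m & r = x_ i.
Proof. by rewrite IE inE => /(nthP 1)[i lti <-]; exists i. Qed.

(** The vector of every element is a basis vector e_k0, and only x_k0 moves it further. *)
Lemma unique_ascents_A : (forall j, j.+1 < m -> simple_at A p j) ->
  forall k, unique_ascents S M I s k.
Proof.
move=> sim.
have yS := simple_path_cartan (leqnn m) psh sim.
suff Q x : x \in X -> exists2 k0, k0 <= m &
    diff_state M s (nth 1 p) m 1 (fun t => ((t == k0)%:R)%R) x.
  move=> k x xX _ q r qI rI; have [k0 _ H] := Q x xX.
  have one q' : q' \in I -> (0 < M x s q')%R -> q' = x_ k0.
    case/exI => i lti ->; rewrite H //.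
    by case: (eqVneq i k0) => [->//|ni] /=; case: (_ == k0).
  by move=> /(one q qI)-> /(one r rI)->.
move: x; apply: (quot_ind ca IS sI).
  exists 0%N => // t ltt; rewrite (coef_at1 ca IS sI) ?xI // -{1}ps nth_uniq //.
  by rewrite eq_sym; case: t ltt => [|t] _ /=; ring.
move=> x q xX /exI[i lti ->] gt0 [k0 lek H].
have ik : i = k0.
  by move: gt0; rewrite H //; case: (eqVneq i k0) => [->//|ni] /=; case: (_ == k0).
exists k0.+1; first by rewrite -ik.
apply: (diff_state_ext _ (diff_state_swap ca IS sI xI xneq yS lti H)) => t _.
rewrite /swap ik eqxx; case: (eqVneq t k0) => [->|nt] /=.
  have -> : (k0.+1 == k0) = false by slia.
  by have -> : (k0 == k0.+1) = false by slia.
by case: eqP.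
Qed.

(** The vector is e_k0 or -e_k0, and the last node changes the sign of the last entry. The factor
    [a] on the last coefficient absorbs the orientation of the double bond. *)
Lemma unique_ascents_B : 1 < m ->
  (forall j, j.+1 < m -> j != m.-2 -> simple_at A p j) ->
  (A (x_ m.-2) (x_ m.-1) * A (x_ m.-1) (x_ m.-2))%N = 2 ->
  forall k, unique_ascents S M I s k.
Proof.
move=> m1 sim ab.
have mE : m = m.-2.+2 by slia.
move: (m.-2) mE sim ab => n mE; rewrite !mE /= => sim ab.
have sim' j : j.+1 < n.+1 -> simple_at A p j.
  by move=> lt; apply: sim; slia.
have len1 : n.+1 <= m by rewrite mE.
have yS := simple_path_cartan len1 psh sim'.
have xI' i : i < n.+1 -> x_ i \in I by move=> lt; apply: xI; slia.
have xneq' i j : i < n.+1 -> j < n.+1 -> i != j -> x_ i != x_ j.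
  by move=> li lj; apply: xneq; slia.
have ltl : n.+1 < m by rewrite mE.
have xlI := xI ltl.
set a := A (x_ n) (x_ n.+1) in ab; set b := A (x_ n.+1) (x_ n) in ab.
have a0 : (0 < a%:Z)%R by move: ab; case: (a).
have abZ : (b%:Z * a%:Z = 2)%R by rewrite -PoszM mulnC ab.
pose st u x := diff_state M s (nth 1 p) n.+1 1 u x /\ M x s (x_ n.+1) = (a%:Z * u n.+1)%R.
have st_swap u x i : i < n.+1 -> st u x -> st (swap u i) (x * x_ i).
  move=> lti [H1 H2]; split; first exact: (diff_state_swap ca IS sI xI' xneq' yS).
  have xiI := xI' _ lti; rewrite (coef_mulr ca IS sI) //.
  have /negPf-> : x_ n.+1 != x_ i by apply: xneq => //; slia.
  rewrite H2 H1 // /swap.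
  have -> : (n.+1 == i) = false by slia.
  case: (eqVneq i n) => [->|ni].
    by rewrite eqxx -/a; ring.
  have -> : (n.+1 == i.+1) = false by slia.
  have [-> _] : A (x_ i) (x_ n.+1) = 0%N /\ A (x_ n.+1) (x_ i) = 0%N by apply: psh; slia.
  by ring.
pose ng (w : nat -> int) (t : nat) : int := (if t == n.+1 then - w t else w t)%R.
have st_last u x : st u x -> st (ng u) (x * x_ n.+1).
  move=> [H1 H2]; split; last first.
    by rewrite (coef_mulr ca IS sI) // eqxx H2 /ng eqxx; ring.
  move=> t ltt; have xtI := xI' _ ltt; rewrite (coef_mulr ca IS sI) //.
  have /negPf-> : x_ t != x_ n.+1 by apply: xneq => //; slia.
  rewrite H1 // H2 /ng.
  have -> : (t == n.+1) = false by slia.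
  case: (eqVneq t n) => [->|nt].
    rewrite eqxx -/b mulrA abZ; ring.
  have -> : (t.+1 == n.+1) = false by slia.
  have [_ ->] : A (x_ t) (x_ n.+1) = 0%N /\ A (x_ n.+1) (x_ t) = 0%N by apply: psh; slia.
  by ring.
have st_ext u u' x : (forall t, t <= n.+1 -> u t = u' t) -> st u x -> st u' x.
  move=> e [H1 H2]; split; first exact: (diff_state_ext e H1).
  by rewrite -e.
pose e (k0 : nat) (sg : bool) (t : nat) : int := (if t == k0 then if sg then 1 else -1 else 0)%R.
suff Q x : x \in X -> exists k0 sg, k0 <= n.+1 /\ st (e k0 sg) x.
  move=> k x xX _ q r qI rI; have [k0 [sg [lek [H1 H2]]]] := Q x xX.
  (* e_k0 goes up through x_k0, which for the last entry is the sign change; -e_k0 then comes back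
     through x_(k0-1). *)
  have one q' : q' \in I -> (0 < M x s q')%R -> q' = x_ (if sg then k0 else k0.-1).
    case/exI => i lti ->; case: (ltngtP i n.+1) => [lt|gt|->].
    - rewrite H1 // /e; case: (eqVneq i k0) => [->|ni] /=.
        have -> : (k0.+1 == k0) = false by slia.
        by case: (sg).
      by case: (eqVneq i.+1 k0) => [<-|] //=; case: (sg).
    - by move: gt; slia.
    - rewrite H2 /e; case: (eqVneq n.+1 k0) => [<-|]; last by rewrite mulr0.
      by case: (sg) => //; rewrite mulrN1 oppr_gt0 ltNge ltW.
  by move=> /(one q qI)-> /(one r rI)->.
move: x; apply: (quot_ind ca IS sI).
  exists 0%N, true; split=> //; split=> [t ltt|].
    rewrite (coef_at1 ca IS sI) ?xI' // -{1}ps nth_uniq //; last by slia.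
    by rewrite /e eq_sym; case: t ltt => [|t] _ /=; ring.
  by rewrite (coef_at1 ca IS sI) ?xI // -{1}ps nth_uniq //= mulr0.
move=> x q xX /exI[i lti ->] gt0 [k0 [sg [lek H]]]; have [H1 H2] := H.
case: (ltngtP i n.+1) => [lt|gt|ei].
- move: gt0; rewrite H1 // /e; case: (eqVneq i k0) => [ik|ni] /=.
    have -> : (i.+1 == k0) = false by slia.
    case: sg H H1 H2 => H H1 H2 // _; exists k0.+1, true; split; first by slia.
    apply: (st_ext _ _ _ _ (st_swap _ _ _ lt H)) => t _.
    rewrite /swap /e ik; case: (eqVneq t k0) => [->|nt] /=.
      have -> : (k0.+1 == k0) = false by slia.
      by have -> : (k0 == k0.+1) = false by slia.
    by rewrite eqxx; case: eqP.
  case: (eqVneq i.+1 k0) => [ik|//]; case: sg H H1 H2 => H H1 H2 // _.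
  exists i, false; split; first by slia.
  apply: (st_ext _ _ _ _ (st_swap _ _ _ lt H)) => t _.
  rewrite /swap /e -ik eqxx; case: (eqVneq t i) => [//|nt] /=.
  case: (eqVneq t i.+1) => [et|//].
  by have -> : (i == i.+1) = false by slia.
- by move: gt lti; slia.
- move: gt0; rewrite ei H2 /e; case: (eqVneq n.+1 k0) => [nk|]; last by rewrite mulr0.
  case: sg H H1 H2 => H H1 H2; last by rewrite mulrN1 oppr_gt0 ltNge ltW.
  move=> _; exists k0, false; split=> //.
  apply: (st_ext _ _ _ _ (st_last _ _ H)) => t _.
  by rewrite /ng /e nk; case: (t == k0); rewrite ?oppr0.
Qed.

End Path.

(** A nontrivial element has a descent, which leaves one node of the two as a possible ascent. *)
Lemma unique_ascents_rank2 a b : I = [set a; b] -> forall k, unique_ascents S M I s k.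
Proof.
move=> IE k x xX _ q r qI rI lq lr.
have [x1|nx1] := eqVneq x 1.
  have one q' : q' \in I -> (0 < M x s q')%R -> q' = s.
    by move=> qI'; rewrite x1 (coef_at1 ca IS sI) //; case: eqP.
  by rewrite (one q qI lq) (one r rI lr).
have [t tI ltt] := quot_descent ca IS sI xX nx1.
have nq : q != t by apply: contraTneq lq => ->; rewrite -leNgt ltW.
have nr : r != t by apply: contraTneq lr => ->; rewrite -leNgt ltW.
move: qI rI tI nq nr; rewrite IE !inE.
by do 3!case/orP=> /eqP->; rewrite ?eqxx.
Qed.

End Families.

(** * Palindromic elements with an ascent *)

Section PalindromicElement.
Variables (W : finGroupType) (S : {set W}) (A : W -> W -> nat).
Variable M : W -> W -> W -> int.
Hypothesis ca : cartan_action S A M.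
Variables (I J : {set W}) (s v : W).
Hypotheses (IS : I \subset S) (sI : s \in I) (JS : J \subset S).
Hypothesis KE : I :\ s = I :&: J.
Hypotheses (vI : v \in <<I>>) (vm : v \in min_reps S J).
Hypothesis pal : palindromic S J v.
Hypothesis full : forall L : {set W}, L \subset I -> v \in <<L>> -> I \subset L.
Let ISm r : r \in I -> r \in S. Proof. exact: (subsetP IS). Qed.
Let sS : s \in S. Proof. exact: ISm. Qed.

Local Notation len := (cox_length S).
Local Notation X := (min_reps I (I :\ s)).
Implicit Types (x y : W) (u : nat -> int).

Lemma v_min_rep : v \in X.
Proof. by rewrite KE -(min_reps_parabolic ca JS IS vI). Qed.

Lemma in_lower_interval x : x \in X -> bruhat S x v -> x \in lower_interval S J v.
Proof. by move=> xX xv; rewrite (mem_lower_interval ca JS IS _ vI) -KE xX. Qed.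

Lemma descent_down x p : x \in X -> p \in I -> (M x s p < 0)%R -> bruhat S x v ->
  [/\ x * p \in X, len x = (len (x * p)).+1 & bruhat S (x * p) v].
Proof.
move=> xX pI lt0 xv; have [xpX xpl] := quot_down ca IS sI xX pI lt0.
split=> //; apply: (bruhat_trans (y := x)) xv.
apply: (bruhat_down ca (subxx S)) => //; last exact: ISm.
exact: (min_reps_gen ca IS (subsetDl I [set s]) xX).
Qed.

(** Two descents of x give two elements of the interval at distance [j.+1] from its top, where there
    is only one. *)
Lemma top_descent_unique k x j p q : unique_ascents S M I s k -> x \in X ->
  bruhat S x v -> (len x + j)%N = len v -> j < k -> p \in I -> q \in I ->
  (M x s p < 0)%R -> (M x s q < 0)%R -> p = q.
Proof.
move=> ua xX xv e ltj pI qI ltp ltq.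
have [xpX xpl xpv] := descent_down xX pI ltp xv.
have [xqX xql xqv] := descent_down xX qI ltq xv.
apply: (mulgI x); apply: (palindromic_top_unique ca IS sI ua JS KE vI vm pal ltj).
- by move: e; rewrite xpl; slia.
- by move: e; rewrite xql; slia.
- exact: in_lower_interval.
- exact: in_lower_interval.
Qed.

Lemma first_descent_unique k p q : unique_ascents S M I s k -> 0 < k ->
  p \in I -> q \in I -> (M v s p < 0)%R -> (M v s q < 0)%R -> p = q.
Proof.
move=> ua k0; apply: (top_descent_unique ua v_min_rep (bruhat_refl _ _) _ k0).
by rewrite addn0.
Qed.

Lemma second_descent_unique k r p q : unique_ascents S M I s k -> 1 < k ->
  r \in I -> (M v s r < 0)%R ->
  p \in I -> q \in I -> (M (v * r) s p < 0)%R -> (M (v * r) s q < 0)%R -> p = q.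
Proof.
move=> ua k1 rI ltr.
have [vrX vrl vrv] := descent_down v_min_rep rI ltr (bruhat_refl _ _).
by apply: (top_descent_unique ua vrX vrv _ k1); rewrite vrl addn1.
Qed.

Section SpinB.
Variable p : seq W.
Local Notation m := (size p).
Local Notation x_ i := (nth 1 p i).
Hypotheses (IE : I = [set x in p]) (up : uniq p) (m2 : 2 < m).
Hypotheses (psh : path_shape A p) (ps : nth 1 p 0 = s).
Hypothesis sim : forall j, j.+1 < m -> j != 0%N -> simple_at A p j.
Hypothesis dbl : (A (x_ 0) (x_ 1) * A (x_ 1) (x_ 0))%N = 2.
Hypothesis asc : exists2 r, r \in I & (0 < M v s r)%R.

Let xI i : i < m -> x_ i \in I.
Proof. by move=> lti; rewrite IE inE mem_nth. Qed.
Let xneq i j : i < m -> j < m -> i != j -> x_ i != x_ j.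
Proof. by move=> li lj nij; rewrite nth_uniq. Qed.
Let exI r : r \in I -> exists2 i, i < m & r = x_ i.
Proof. by rewrite IE inE => /(nthP 1)[i lti <-]; exists i. Qed.

(* An element of the quotient is a 0/1 vector u with M x s x_(i+1) = a (u_i - u_(i+1))
   and M x s x_0 = 1 - 2 u_0: x_(i+1) exchanges two entries and x_0 flips u_0. *)
Lemma spinB_palindromic : v = \prod_(0 <= j < m) x_ j.
Proof.
have [n mE] : exists n, m = n.+3 by exists (m - 3)%N; slia.
pose y i := x_ i.+1.
have yI i : i < n.+2 -> y i \in I by move=> lt; apply: xI; slia.
have yneq i j : i < n.+2 -> j < n.+2 -> i != j -> y i != y j.
  by move=> li lj nij; apply: xneq; slia.
have y0neq i : i < n.+2 -> y i != x_ 0 by move=> li; apply: xneq; slia.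
have x0I : x_ 0 \in I by apply: xI; slia.
have yS i j : i < n.+2 -> j < n.+2 -> i != j ->
    A (y i) (y j) = ((j == i.+1) || (i == j.+1)) :> nat.
  have ltc i' j' : i' < j' -> j' < n.+2 -> A (y i') (y j') = (j' == i'.+1) :> nat /\
      A (y j') (y i') = (j' == i'.+1) :> nat.
    move=> lij lj; case: (eqVneq j' i'.+1) => [e|ne].
      by rewrite e; apply: sim => //; move: lj; rewrite e; slia.
    by apply: psh; slia.
  move=> li lj; rewrite neq_ltn => /orP[lt|lt].
    have [-> _] := ltc _ _ lt lj.
    have -> : (i == j.+1) = false by slia.
    by rewrite orbF.
  have [_ ->] := ltc _ _ lt li.
  by have -> : (j == i.+1) = false by slia.
pose a := A (x_ 0) (x_ 1); pose b := A (x_ 1) (x_ 0).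
have ab : (a * b)%N = 2 := dbl.
have a0 : (0 < a%:Z)%R by move: ab; case: (a).
have abZ : (b%:Z * a%:Z = 2)%R by rewrite -PoszM mulnC ab.
have abE (w : int) : ((A (y 0%N) (x_ 0))%:Z * (a%:Z * w) = 2 * w)%R.
  by rewrite -/b mulrA abZ.
pose st u x := diff_state M s y n.+2 a u x /\ M x s (x_ 0) = (1 - 2 * u 0%N)%R.
pose fl (w : nat -> int) (t : nat) : int := (if t == 0%N then 1 - w 0%N else w t)%R.
have st0 u x : st u x -> st (fl u) (x * x_ 0).
  move=> [H1 H2]; split; last first.
    by rewrite (coef_mulr ca IS sI) // eqxx H2 /fl eqxx; ring.
  move=> t ltt; have ytI := yI _ ltt; rewrite (coef_mulr ca IS sI) //.
  rewrite (negPf (y0neq _ ltt)) H1 // H2 /fl /=.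
  case: t ltt {ytI} => [|t] ltt; first by rewrite -/a /=; ring.
  have [-> _] : A (x_ 0) (y t.+1) = 0%N /\ A (y t.+1) (x_ 0) = 0%N by apply: psh; slia.
  by rewrite /=; ring.
have sti u x i : i < n.+2 -> st u x -> st (swap u i) (x * y i).
  move=> lti [H1 H2]; split; first exact: (diff_state_swap ca IS sI yI yneq yS lti).
  have yiI := yI _ lti; rewrite (coef_mulr ca IS sI) //.
  rewrite eq_sym (negPf (y0neq _ lti)) H1 // H2 /swap.
  case: i lti {yiI} => [|i] lti; first by rewrite /= (abE (u 0%N - u 1%N)%R); ring.
  have [_ ->] : A (x_ 0) (y i.+1) = 0%N /\ A (y i.+1) (x_ 0) = 0%N by apply: psh; slia.
  by rewrite /=; ring.
have st_ext u u' x : (forall t, t <= n.+2 -> u t = u' t) -> st u x -> st u' x.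
  move=> e [H1 H2]; split; first exact: (diff_state_ext e H1).
  by rewrite -e.
have coefy u x i : st u x -> i < n.+2 -> M x s (y i) = (a%:Z * (u i - u i.+1))%R.
  by case=> H _ lt; rewrite H.
have leaf : unique_ascents S M I s 2.
  apply: (unique_ascents2 ca IS sI) => q r.
  have nb q' : q' \in I -> dynkin_edge S s q' -> q' = x_ 1.
    case/exI => -[|[|i]] lti ->; rewrite -ps //.
      by case/(adjP ca) => _ _; rewrite eqxx.
    case/(adjP ca) => _ _ _.
    by have [-> _] : A (x_ 0) (x_ i.+2) = 0%N /\ A (x_ i.+2) (x_ 0) = 0%N by apply: psh; slia.
  by move=> /nb nq /nb nr /nq-> /nr->.
(* On the way up the last entry of u can only turn from 0 to 1, and only through the last node. As v
   has full support, this entry is 1 for v. *)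
pose L := [set x in take n.+2 p].
have Q x : x \in X -> exists u, [/\ (forall t, t <= n.+2 -> u t = 0%R \/ u t = 1%R),
     st u x & u n.+2 = 0%R -> x \in <<L>>].
  have xL i : i < n.+2 -> x_ i \in <<L>>.
    move=> lt; rewrite mem_gen // inE -(nth_take 1 lt) mem_nth // size_takel //; slia.
  move: x; apply: (quot_ind ca IS sI).
    exists (fun=> 0%R); split=> //; [by left | split=> [t ltt|]].
      by rewrite (coef_at1 ca IS sI) ?yI // -ps eq_sym (negPf (y0neq _ ltt)) subrr mulr0.
    by rewrite (coef_at1 ca IS sI) // -ps eqxx mulr0 subr0.
  move=> x q xX /exI[[|i] lti ->] gt0 [u [ub H uL]].
    exists (fl u); split; last 1 first.
    - by rewrite /fl /= => /uL xxL; rewrite groupM // xL.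
    - by case=> [|t] lt; rewrite /fl /=; [case: (ub 0%N isT) => ->; [right|left] | apply: ub].
    - exact: st0.
  have lti' : i < n.+2 by slia.
  move: gt0; rewrite -/(y i) (coefy _ _ _ H lti').
  case: (ub i (ltnW lti')) => ui; case: (ub i.+1 lti') => ui1; rewrite ui ui1;
    rewrite ?subrr ?mulr0 ?sub0r ?subr0 ?mulrN1 ?mulr1 ?ltxx // => gt0.
    by move: gt0; rewrite oppr_gt0 ltNge ltW.
  exists (swap u i); split; last 1 first.
  - rewrite /swap; have -> : (n.+2 == i) = false by slia.
    case: (eqVneq n.+2 i.+1) => [e|ne]; first by rewrite ui.
    by move=> /uL xxL; rewrite groupM // xL //; slia.
  - by move=> t lt; rewrite /swap; case: eqP => // _; [left | case: eqP => // _; [right|apply: ub]].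
  - exact: sti.
have [u [ub H uL]] := Q v v_min_rep.
have um : u n.+2 = 1%R.
  case: (ub n.+2 (leqnn _)) => // /uL vL.
  have LI : L \subset I by rewrite IE; apply/subsetP => z; rewrite !inE; apply: mem_take.
  have /subsetP /(_ (x_ n.+2)) := full LI vL.
  rewrite xI ?inE; last by slia.
  move/(_ isT); have : uniq p := up.
  rewrite -{1}(cat_take_drop n.+2 p) cat_uniq => /and3P[_ /hasPn H' _].
  move=> H2; have := H' (x_ n.+2); rewrite (drop_nth 1) ?mem_head; last by slia.
  by move=> /(_ isT) /=; rewrite H2.
have dy t : t < n.+2 -> u t = 0%R -> u t.+1 = 1%R -> (M v s (y t) < 0)%R.
  by move=> lt e0 e1; rewrite (coefy _ _ _ H lt) e0 e1 sub0r mulrN1 oppr_lt0.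
have ux i j : i < n.+2 -> j < n.+2 -> y i = y j -> i = j.
  by move=> li lj e; apply/eqP; apply: contraT => /(yneq i j li lj); rewrite e eqxx.
have fu q r : q \in I -> r \in I -> (M v s q < 0)%R -> (M v s r < 0)%R -> q = r.
  exact: (first_descent_unique leaf).
(* If u_0 = 1, then x_0 is a descent. An ascent is a step from 1 to 0, and since the last entry is 1
   a rise follows it, hence a second descent. *)
case: (ub 0%N isT) => u0; last first.
  have d0 : (M v s (x_ 0) < 0)%R by case: H => _ ->; rewrite u0.
  have [r /exI[[|t] ltt ->]] := asc; first by rewrite ltNge ltW.
  have ltt' : t < n.+2 by slia.
  rewrite -/(y t) (coefy _ _ _ H ltt').
  case: (ub t (ltnW ltt')) => ut; case: (ub t.+1 ltt') => ut1; rewrite ut ut1;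
    rewrite ?subrr ?mulr0 ?ltxx // ?sub0r ?mulrN1 ?oppr_gt0 => gt0.
    by move: gt0; rewrite ltNge ltW.
  have [t2 [h1 h2 h3 h4]] := rise_exists ltt' ut1 um (fun t' h => ub t' (proj2 (andP h))).
  have e := fu _ _ (yI _ h2) x0I (dy _ h2 h3 h4) d0.
  by have := y0neq _ h2; rewrite e eqxx.
(* If u_0 = 0, uniqueness of the descent makes u equal to 0 up to position c and to 1 afterwards. *)
have [c [_ ltc uc uc1]] := rise_exists (leq0n n.+2) u0 um (fun t' h => ub t' (proj2 (andP h))).
have dc := dy _ ltc uc uc1.
have low t : t <= c -> u t = 0%R.
  move=> let_; have lt' : t <= n.+2 by slia.
  case: (ub t lt') => // ut; have [t3 [_ h2 h3 h4]] := rise_exists (leq0n t) u0 ut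
    (fun t' h => ub t' (leq_trans (proj2 (andP h)) lt')).
  have lt3 : t3 < n.+2 by slia.
  have := ux _ _ lt3 ltc (fu _ _ (yI _ lt3) (yI _ ltc) (dy _ lt3 h3 h4) dc); slia.
have high t : c < t -> t <= n.+2 -> u t = 1%R.
  move=> lct let_; case: (ub t let_) => // ut.
  have [t3 [h1 h2 h3 h4]] := rise_exists let_ ut um (fun t' h => ub t' (proj2 (andP h))).
  have := ux _ _ h2 ltc (fu _ _ (yI _ h2) (yI _ ltc) (dy _ h2 h3 h4) dc); slia.
have Hc := sti _ _ _ ltc H.
have su q r : q \in I -> r \in I -> (M (v * y c) s q < 0)%R ->
    (M (v * y c) s r < 0)%R -> q = r.
  exact: (second_descent_unique leaf _ (yI _ ltc) dc).
(* Removing [y c] exchanges the entries c and c+1, which creates two descents, one on each side,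
   unless c+1 is the last position. *)
case: (ltnP c.+1 n.+2) => [ltc1|gec].
  have d1 : (M (v * y c) s (y c.+1) < 0)%R.
    rewrite (coefy _ _ _ Hc ltc1) /swap.
    have -> : (c.+1 == c) = false by slia.
    have -> : (c.+2 == c) = false by slia.
    have -> : (c.+2 == c.+1) = false by slia.
    by rewrite eqxx uc (high c.+2) // sub0r mulrN1 oppr_lt0.
  have [c0|c0] := posnP c.
    have d2 : (M (v * y c) s (x_ 0) < 0)%R.
      by case: Hc => _ ->; rewrite /swap c0 /= high // c0.
    by have := su _ _ (yI _ ltc1) x0I d1 d2; move/eqP; rewrite (negPf (y0neq _ ltc1)).
  have ltcp : c.-1 < n.+2 by slia.
  have cp : c = c.-1.+1 by rewrite prednK.
  have d2 : (M (v * y c) s (y c.-1) < 0)%R.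
    rewrite (coefy _ _ _ Hc ltcp) /swap -cp eqxx.
    have -> : (c.-1 == c) = false by slia.
    have -> : (c.-1 == c.+1) = false by slia.
    rewrite low ?uc1 ?sub0r ?mulrN1 ?oppr_lt0 //; slia.
  have := ux _ _ ltc1 ltcp (su _ _ (yI _ ltc1) (yI _ ltcp) d1 d2); slia.
have cE : c = n.+1 by slia.
(* Only the last entry of v is 1. Going down, this 1 travels to position 0, where x_0 removes it;
   this spells the word of case (5). *)
pose R i x := x \in X /\ st (fun t => (t.+1 == i)%:R)%R x.
rewrite mE; apply: (path_product_unique ca IS (y := nth 1 p) (n := n.+3) (Q := R)).
- move=> x [xX Hx]; apply: (no_descent_one ca IS sI xX) => r /exI[[|t] lt ->].
    by case: Hx => _ ->.
  have lt' : t < n.+2 by slia.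
  by rewrite -/(y t) (coefy _ _ _ Hx lt') /= subrr mulr0.
- move=> [|i] x lti [xX Hx].
    have lt0 : (M x s (x_ 0) < 0)%R by case: Hx => _ ->.
    have [xsX _] := quot_down ca IS sI xX x0I lt0.
    by split=> //; apply: (st_ext _ _ _ _ (st0 _ _ Hx)) => -[|t].
  have lti' : i < n.+2 by [].
  have lt0 : (M x s (y i) < 0)%R.
    rewrite (coefy _ _ _ Hx lti') eqxx.
    have -> : (i.+1 == i.+2) = false by slia.
    by rewrite sub0r mulrN1 oppr_lt0.
  have [xsX _] := quot_down ca IS sI xX (yI _ lti') lt0.
  split=> //.
  apply: (st_ext _ _ _ _ (sti _ _ _ lti' Hx)) => t _.
  rewrite /swap !eqSS eqxx; case: (eqVneq t i) => [_ //|nt].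
  have -> : (i == i.+1) = false by slia.
  by case: (t == i.+1).
- by move=> i lti; apply: xI; rewrite mE.
- by [].
split; first exact: v_min_rep.
apply: (st_ext _ _ _ _ H) => t let_.
case: (leqP t c) => [le|lt]; first by rewrite low //; have -> : (t.+1 == n.+3) = false by slia.
have tn : t = n.+2 by slia.
by rewrite high // tn eqxx.
Qed.

End SpinB.

Section Fork.
Variables (p : seq W) (z : W) (b : nat).
Local Notation m := (size p).
Local Notation x_ i := (nth 1 p i).
Hypotheses (IE : I = [set x in z :: p]) (uz : z \notin p) (up : uniq p).
Hypotheses (psh : path_shape A p) (sim : forall j, j.+1 < m -> simple_at A p j).
Hypothesis att1 : forall i, i < m -> A (x_ i) z = (i == b) :> nat.
Hypothesis att2 : forall i, i < m -> A z (x_ i) = (i == b) :> nat.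
Hypothesis asc : exists2 r, r \in I & (0 < M v s r)%R.

Let xI i : i < m -> x_ i \in I.
Proof. by move=> lti; rewrite IE !inE mem_nth // orbT. Qed.
Let zI : z \in I. Proof. by rewrite IE !inE eqxx. Qed.
Let xneq i j : i < m -> j < m -> i != j -> x_ i != x_ j.
Proof. by move=> li lj nij; rewrite nth_uniq. Qed.
Let xz i : i < m -> (x_ i == z) = false.
Proof. by move=> li; apply/negbTE; apply: contraNneq uz => <-; rewrite mem_nth. Qed.
Let zx i : i < m -> (z == x_ i) = false.
Proof. by move=> li; rewrite eq_sym xz. Qed.
Let exI r : r \in I -> r = z \/ exists2 i, i < m & r = x_ i.
Proof.
rewrite IE !inE => /orP[/eqP->|/(nthP 1)[i lti <-]]; first by left.
by right; exists i.
Qed.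
Let ux i j : i < m -> j < m -> x_ i = x_ j -> i = j.
Proof. by move=> li lj e; apply/eqP; rewrite -(nth_uniq 1 li lj up) e. Qed.
Let xS := simple_path_cartan (leqnn m) psh sim.

Let not_mem_take k i : k <= i -> i < m -> x_ i \notin take k p.
Proof.
move=> leki lti; apply/negP => /(nthP 1)[j]; rewrite size_takel; last by slia.
by move=> ltj; rewrite nth_take // => /ux e; have := e (leq_trans ltj (leq_trans leki (ltnW lti))) lti; slia.
Qed.

(* As for spinB_palindromic, with M x s z = 1 - u_0 - u_1: z exchanges and flips
   the entries u_0 and u_1. *)
Lemma spinD_palindromic : s = z -> b = 1%N -> 2 < m -> False.
Proof.
move=> sz b1 m2.
have [n mE] : exists n, m = n.+3 by exists (m - 3)%N; slia.
pose st u x := diff_state M s (nth 1 p) m 1 u x /\ M x s z = (1 - u 0%N - u 1%N)%R.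
pose fl (w : nat -> int) (t : nat) : int :=
  (if t == 0%N then 1 - w 1%N else if t == 1%N then 1 - w 0%N else w t)%R.
have stz u x : st u x -> st (fl u) (x * z).
  move=> [H1 H2]; split; last first.
    by rewrite (coef_mulr ca IS sI) // eqxx H2 /fl /=; ring.
  move=> t ltt; have xtI := xI ltt; rewrite (coef_mulr ca IS sI) // xz // H1 // H2 /fl.
  rewrite att2 // b1; case: t ltt {xtI} => [|[|t]] ltt /=; by ring.
have sti u x i : i < m -> st u x -> st (swap u i) (x * x_ i).
  move=> lti [H1 H2]; split; first exact: (diff_state_swap ca IS sI xI xneq xS lti).
  have xiI := xI lti; rewrite (coef_mulr ca IS sI) // zx // H1 // H2 /swap att1 // b1.
  by case: i lti {xiI} => [|[|i]] lti /=; ring.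
have st_ext u u' x : (forall t, t <= m -> u t = u' t) -> st u x -> st u' x.
  move=> e [H1 H2]; split; first exact: (diff_state_ext e H1).
  by rewrite H2 !e // mE.
have coefx u x i : st u x -> i < m -> M x s (x_ i) = (u i - u i.+1)%R.
  by case=> H _ lt; rewrite H // mul1r.
have leaf : unique_ascents S M I s 2.
  apply: (unique_ascents2 ca IS sI) => q r.
  have nb q' : q' \in I -> dynkin_edge S s q' -> q' = x_ 1.
    case/exI => [->|[i lti ->]]; rewrite sz; case/(adjP ca) => _ _.
      by rewrite eqxx.
    by move=> _ + _; rewrite att2 // b1; case: (eqVneq i 1%N) => // ->.
  by move=> /nb nq /nb nr /nq-> /nr->.
pose L := [set y in z :: take n.+2 p].
have Q x : x \in X -> exists u, [/\ (forall t, t <= m -> u t = 0%R \/ u t = 1%R),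
     st u x & u m = 0%R -> x \in <<L>>].
  have xL i : i < n.+2 -> x_ i \in <<L>>.
    move=> lt; rewrite mem_gen // !inE -(nth_take 1 lt) mem_nth ?orbT // size_takel //; slia.
  have zL : z \in <<L>> by rewrite mem_gen // !inE eqxx.
  move: x; apply: (quot_ind ca IS sI).
    exists (fun=> 0%R); split=> //; [by left | split=> [t ltt|]].
      by rewrite (coef_at1 ca IS sI) ?xI // sz zx // subrr mulr0.
    by rewrite (coef_at1 ca IS sI) // sz eqxx !subr0.
  move=> x q xX /exI[->|[i lti ->]] gt0 [u [ub H uL]].
    exists (fl u); split; last 1 first.
    - by rewrite /fl mE /= -mE => /uL xxL; rewrite groupM.
    - move=> [|[|t]] lt; rewrite /fl /=; last exact: ub.
        by case: (ub 1%N) => [|->|->]; [rewrite mE|right|left].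
      by case: (ub 0%N) => [|->|->]; [rewrite mE|right|left].
    - exact: stz.
  move: gt0; rewrite (coefx _ _ _ H lti).
  case: (ub i (ltnW lti)) => ui; case: (ub i.+1 lti) => ui1; rewrite ui ui1;
    rewrite ?subrr ?sub0r ?subr0 ?ltxx // => gt0.
  exists (swap u i); split; last 1 first.
  - rewrite /swap; have -> : (m == i) = false by slia.
    case: (eqVneq m i.+1) => [e|ne]; first by rewrite ui.
    by move=> /uL xxL; rewrite groupM // xL //; slia.
  - by move=> t lt; rewrite /swap; case: eqP => // _; [left | case: eqP => // _; [right|apply: ub]].
  - exact: sti.
have [u [ub H uL]] := Q v v_min_rep.
have um : u m = 1%R.
  case: (ub m (leqnn _)) => // /uL vL.
  have LI : L \subset I.
    rewrite IE; apply/subsetP => y; rewrite !inE => /orP[->//|/mem_take->].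
    by rewrite orbT.
  have ltm : n.+2 < m by rewrite mE.
  have /subsetP /(_ (x_ n.+2)) := full LI vL.
  by rewrite xI // !inE xz // (negPf (not_mem_take (leqnn _) ltm)) => /(_ isT).
have dx t : t < m -> u t = 0%R -> u t.+1 = 1%R -> (M v s (x_ t) < 0)%R.
  by move=> lt e0 e1; rewrite (coefx _ _ _ H lt) e0 e1.
have fu q r : q \in I -> r \in I -> (M v s q < 0)%R -> (M v s r < 0)%R -> q = r.
  exact: (first_descent_unique leaf).
have fux i j : i < m -> j < m -> (M v s (x_ i) < 0)%R -> (M v s (x_ j) < 0)%R -> i = j.
  by move=> li lj di dj; apply: ux => //; apply: fu => //; apply: xI.
have rise i k (lik : i <= k) : k <= m -> u i = 0%R -> u k = 1%R ->
    exists t, [/\ i <= t, t < k, t < m, u t = 0%R & u t.+1 = 1%R].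
  move=> lkm ui uk; have [t' /andP[h1 h2]|t [h1 h2 h3 h4]] := rise_exists lik ui uk.
    by apply: ub; apply: leq_trans lkm.
  by exists t; split=> //; apply: leq_trans lkm.
have fallx t : (0 < M v s (x_ t))%R -> t < m -> u t = 1%R /\ u t.+1 = 0%R.
  move=> + lt; rewrite (coefx _ _ _ H lt).
  by case: (ub t (ltnW lt)) => ->; case: (ub t.+1 lt) => ->; rewrite ?subrr ?ltxx.
have su a q r : x_ a \in I -> (M v s (x_ a) < 0)%R -> q \in I -> r \in I ->
    (M (v * x_ a) s q < 0)%R -> (M (v * x_ a) s r < 0)%R -> q = r.
  by move=> aI da; apply: (second_descent_unique leaf _ aI da).
have m0 : 0 < m by rewrite mE.
have m1 : 1 < m by rewrite mE.
have [r rI gt0] := asc.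
have high a t : a < m -> u a = 0%R -> u a.+1 = 1%R -> a < t -> t <= m -> u t = 1%R.
  move=> lta ua ua1 lat ltm; case: (ub t ltm) => // ut.
  have [c [h1 h2 h3 h4 h5]] := rise _ _ ltm (leqnn _) ut um.
  have := fux _ _ h3 lta (dx _ h3 h4 h5) (dx _ lta ua ua1); slia.
have low i a t : u i = 0%R -> a < m -> u a = 0%R -> u a.+1 = 1%R -> i <= t -> t <= a -> u t = 0%R.
  move=> ui lta ua ua1 lit lat; have ltm : t <= m by slia.
  case: (ub t ltm) => // ut.
  have [c [h1 h2 h3 h4 h5]] := rise _ _ lit ltm ui ut.
  have := fux _ _ h3 lta (dx _ h3 h4 h5) (dx _ lta ua ua1); slia.
have d_next a : a.+1 < m -> u a = 0%R -> u a.+1 = 1%R -> (M (v * x_ a) s (x_ a.+1) < 0)%R.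
  move=> lta ua ua1; have lta' := ltnW lta.
  rewrite (coefx _ _ _ (sti _ _ _ lta' H) lta) /swap.
  have -> : (a.+1 == a) = false by slia.
  have -> : (a.+2 == a) = false by slia.
  have -> : (a.+2 == a.+1) = false by slia.
  by rewrite eqxx ua (high a a.+2).
have d_prev a : a.+1 < m -> u a = 0%R -> u a.+1 = 0%R -> u a.+2 = 1%R ->
    (M (v * x_ a.+1) s (x_ a) < 0)%R.
  move=> lta ua ua1 ua2; have lta' := ltnW lta.
  rewrite (coefx _ _ _ (sti _ _ _ lta H) lta') /swap eqxx.
  have -> : (a == a.+1) = false by slia.
  have -> : (a == a.+2) = false by slia.
  by rewrite ua ua2.
case: (ub 0%N isT) => u0; case: (ub 1%N m0) => u1.
- have [a [_ _ lta ua ua1]] := rise _ _ (leq0n m) (leqnn _) u0 um.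
  case: a lta ua ua1 => [|a] lta ua ua1; first by rewrite u1 in ua1.
  case: (ltnP a.+2 m) => [lt|ge].
    have ua0 : u a = 0%R by apply: (low 0%N a.+1).
    have da := dx _ lta ua ua1.
    have e := su _ _ _ (xI lta) da (xI lt) (xI (ltnW lta)) (d_next _ lt ua ua1) (d_prev _ lta ua0 ua ua1).
    have := ux lt (ltnW lta) e; slia.
  have aE : a.+2 = m by slia.
  (* Only even numbers of ones occur. A single 1 would travel down to position 0, where no descent
     is left, so the element would be 1; but the coefficient of 1 at z is 1, not 0. *)
  have no i x : i <= m -> x \in X -> ~ st (fun t => (t == i)%:R)%R x.
    elim: i x => [|i IHi] x lei xX Hx.
      have x1 : x = 1.
        apply: (no_descent_one ca IS sI xX) => q /exI[->|[j ltj ->]].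
          by case: Hx => _ ->.
        by rewrite (coefx _ _ _ Hx ltj) /=; case: (j == 0%N).
      by case: Hx => _; rewrite x1 (coef_at1 ca IS sI) // sz eqxx.
    have lt0 : (M x s (x_ i) < 0)%R.
      rewrite (coefx _ _ _ Hx lei) eqxx.
      by have -> : (i == i.+1) = false by slia.
    have [xiX _] := quot_down ca IS sI xX (xI lei) lt0.
    apply: (IHi _ (ltnW lei) xiX); apply: (st_ext _ _ _ _ (sti _ _ _ lei Hx)) => t _.
    rewrite /swap !eqSS eqxx; case: (eqVneq t i) => [_ //|nt].
    have -> : (i == i.+1) = false by slia.
    by case: (t == i.+1).
  apply: (no m v (leqnn _) v_min_rep); apply: (st_ext _ _ _ _ H) => t let_.
  case: (leqP t a.+1) => [le|lt].
    by rewrite (low 0%N a.+1) //; have -> : (t == m) = false by slia.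
  have -> : t = m by slia.
  by rewrite um eqxx.
(* Entries 0, 1: x_0 is a descent, and the ascent of v forces another rise further right. *)
- have d0 := dx _ m0 u0 u1.
  case/exI: rI gt0 => [->|[t ltt ->]] gt0.
    by move: gt0; case: H => _ ->; rewrite u0 u1.
  have [ut ut1] := fallx _ gt0 ltt.
  have [c [h1 h2 h3 h4 h5]] := rise _ _ ltt (leqnn _) ut1 um.
  have c0 := fux _ _ h3 m0 (dx _ h3 h4 h5) d0.
  by move: h1; rewrite c0.
- have [a [la _ lta ua ua1]] := rise _ _ m0 (leqnn _) u1 um.
  have da := dx _ lta ua ua1.
  case: (ltnP a.+1 m) => [lt|ge].
    case: a la lta ua ua1 da lt => [//|[|a]] _ lta ua ua1 da lt.
      have dz : (M (v * x_ 1) s z < 0)%R.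
        by case: (sti _ _ _ lta H) => _ ->; rewrite /swap /= u0 ua1.
      have e := su _ _ _ (xI lta) da (xI lt) zI (d_next _ lt ua ua1) dz.
      by have := xz lt; rewrite e eqxx.
    have ua0 : u a.+1 = 0%R by apply: (low 1%N a.+2).
    have e := su _ _ _ (xI lta) da (xI lt) (xI (ltnW lta)) (d_next _ lt ua ua1) (d_prev _ lta ua0 ua ua1).
    have := ux lt (ltnW lta) e; slia.
  (* The ones of v are now at 0 and m only, so v = z x_1 ... x_(m-1), whose support misses x_0. *)
  pose R i x := x \in X /\ st (fun t => if i == 0%N then 0 else (t == 0%N)%:R + (t == i)%:R)%R x.
  pose y i := if i == 0%N then z else x_ i.
  have vE : v = \prod_(0 <= j < m) y j.
    apply: (path_product_unique ca IS (n := m) (Q := R)) => //.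
    - move=> x [xX Hx]; apply: (no_descent_one ca IS sI xX) => q /exI[->|[t lt ->]].
        by case: Hx => _ ->.
      by rewrite (coefx _ _ _ Hx lt) /= subrr.
    - move=> [|i] x lti [xX Hx].
        have lt0 : (M x s z < 0)%R by case: Hx => _ ->.
        have [xsX _] := quot_down ca IS sI xX zI lt0.
        by split=> //; apply: (st_ext _ _ _ _ (stz _ _ Hx)) => -[|[|t]].
      have lt0 : (M x s (x_ i.+1) < 0)%R.
        rewrite (coefx _ _ _ Hx lti) /= eqxx.
        by have -> : (i.+1 == i.+2) = false by slia.
      have [xsX _] := quot_down ca IS sI xX (xI lti) lt0.
      split=> //; apply: (st_ext _ _ _ _ (sti _ _ _ lti Hx)) => t _.
      rewrite /swap /=; case: (eqVneq t i.+1) => [->|nt].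
        by rewrite eqxx.
      case: (eqVneq t i.+2) => [->|//].
      by have -> : (i.+1 == i.+2) = false by slia.
    - by move=> i lti; rewrite /y; case: eqP => // _; apply: xI.
    split; first exact: v_min_rep.
    apply: (st_ext _ _ _ _ H) => t let_.
    have -> : (m == 0%N) = false by slia.
    case: t let_ => [|t] let_; first by rewrite u0 eq_sym; have -> : (m == 0%N) = false by slia.
    case: (leqP t.+1 a) => [le|lt].
      by rewrite (low 1%N a) //=; have -> : (t.+1 == m) = false by slia.
    have tm : t.+1 = m by slia.
    by rewrite tm um eqxx; case: (m) m0.
  pose L0 := [set y in z :: behead p].
  have L0I : L0 \subset I.
    by rewrite IE; apply/subsetP => q; rewrite !inE => /orP[->//|/mem_behead->]; rewrite orbT.
  have vL0 : v \in <<L0>>.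
    rewrite vE big_mkord; apply: group_prod => -[[|i] lti] _; rewrite mem_gen // !inE ?eqxx //.
    by apply/orP; right; rewrite /y /= -nth_behead mem_nth // size_behead; slia.
  have /subsetP /(_ (x_ 0)) := full L0I vL0.
  rewrite xI // !inE xz // => /(_ isT) /=.
  by move: up; case: (p) => //= q p' /andP[/negPf->].
- have dz : (M v s z < 0)%R by case: H => _ ->; rewrite u0 u1.
  case/exI: rI gt0 => [->|[t ltt ->]] gt0; first by rewrite ltNge ltW in gt0.
  have [ut ut1] := fallx _ gt0 ltt.
  have [c [h1 h2 h3 h4 h5]] := rise _ _ ltt (leqnn _) ut1 um.
  have e := fu _ _ (xI h3) zI (dx _ h3 h4 h5) dz.
  by have := xz h3; rewrite e eqxx.
Qed.

(* The elements of the quotient are the vectors +-e_k, permuted by the signed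
   permutations with an even number of signs. *)
Lemma vectorD_palindromic : 0 < b -> m = b.+2 -> s = x_ 0 -> False.
Proof.
move=> b0 mE s0.
pose st u x := diff_state M s (nth 1 p) m 1 u x /\ M x s z = (u b.+1 + u b.+2)%R.
pose fl (w : nat -> int) (t : nat) : int :=
  (if t == b.+1 then - w b.+2 else if t == b.+2 then - w b.+1 else w t)%R.
have stz u x : st u x -> st (fl u) (x * z).
  move=> [H1 H2]; have n12 : (b.+2 == b.+1) = false by slia.
  split; last by rewrite (coef_mulr ca IS sI) // eqxx H2 /fl !eqxx n12; ring.
  move=> t ltt; have xtI := xI ltt; rewrite (coef_mulr ca IS sI) // xz // H1 // H2 /fl.
  rewrite att2 //; case: (eqVneq t b) => [->|ntb].
    have -> : (b == b.+1) = false by slia.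
    have -> : (b == b.+2) = false by slia.
    by rewrite !eqxx /=; ring.
  case: (eqVneq t b.+1) => [->|nt1]; first by rewrite ?n12 ?eqxx ?n12 ?eqxx /=; ring.
  have -> : (t == b.+2) = false by slia.
  have -> : (t.+1 == b.+1) = false by slia.
  have -> : (t.+1 == b.+2) = false by slia.
  by rewrite /=; ring.
have sti u x i : i < m -> st u x -> st (swap u i) (x * x_ i).
  move=> lti [H1 H2]; split; first exact: (diff_state_swap ca IS sI xI xneq xS lti).
  have xiI := xI lti; rewrite (coef_mulr ca IS sI) // zx // H1 // H2 /swap att1 //.
  case: (eqVneq i b) => [->|nib].
    have -> : (b.+1 == b) = false by slia.
    have -> : (b.+2 == b) = false by slia.
    have -> : (b.+2 == b.+1) = false by slia.
    by rewrite !eqxx /=; ring.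
  have -> : (b.+2 == i) = false by slia.
  case: (eqVneq i b.+1) => [->|nib1]; first by rewrite ?eqxx /=; ring.
  have -> : (b.+1 == i.+1) = false by slia.
  have -> : (b.+2 == i.+1) = false by slia.
  by rewrite /=; ring.
have st_ext u u' x : (forall t, t <= m -> u t = u' t) -> st u x -> st u' x.
  move=> e [H1 H2]; split; first exact: (diff_state_ext e H1).
  by rewrite H2 !e // mE.
have coefx u x i : st u x -> i < m -> M x s (x_ i) = (u i - u i.+1)%R.
  by case=> H _ lt; rewrite H // mul1r.
pose e (k0 : nat) (sg : bool) (t : nat) : int := (if t == k0 then if sg then 1 else -1 else 0)%R.
have e_swap_up k0 t : swap (e k0 true) k0 t = e k0.+1 true t.
  rewrite /swap /e eqxx; have -> : (k0.+1 == k0) = false by slia.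
  by case: (eqVneq t k0) => [->|//]; have -> : (k0 == k0.+1) = false by slia.
have e_swap_down k0 sg t : swap (e k0.+1 sg) k0 t = e k0 sg t.
  rewrite /swap /e eqxx; case: (eqVneq t k0) => // nt.
  by case: (eqVneq t k0.+1) => // et; have -> : (k0 == k0.+1) = false by slia.
have asc_x x k0 sg i : st (e k0 sg) x -> i < m -> (0 < M x s (x_ i))%R ->
    if sg then i = k0 else i.+1 = k0.
  move=> Hx lti; rewrite (coefx _ _ _ Hx lti) /e.
  case: (eqVneq i k0) => [->|ni].
    have -> : (k0.+1 == k0) = false by slia.
    by case: (sg).
  by case: (eqVneq i.+1 k0) => [<-|] //; case: (sg).
have asc_z x k0 sg : st (e k0 sg) x -> (0 < M x s z)%R -> sg /\ (k0 = b.+1 \/ k0 = b.+2).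
  move=> [_ ->]; rewrite /e.
  case: (eqVneq b.+1 k0) => [<-|ni].
    have -> : (b.+2 == b.+1) = false by slia.
    by case: (sg) => //; split=> //; left.
  by case: (eqVneq b.+2 k0) => [<-|] //; case: (sg) => //; split=> //; right.
have m0 : 0 < m by rewrite mE.
have Q x : x \in X -> exists k0 sg, k0 <= m /\ st (e k0 sg) x.
  move: x; apply: (quot_ind ca IS sI).
    exists 0%N, true; split=> //; split=> [t ltt|].
      rewrite (coef_at1 ca IS sI) ?xI // s0 nth_uniq //.
      by rewrite /e eq_sym; case: t ltt => [|t] _ /=; ring.
    by rewrite (coef_at1 ca IS sI) // s0 xz.
  move=> x q xX /exI[->|[i lti ->]] gt0 [k0 [sg [lek H]]].
    have [sgT kE] := asc_z _ _ _ H gt0; rewrite sgT in H.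
    exists (if k0 == b.+1 then b.+2 else b.+1), false; split; first by case: ifP; slia.
    apply: (st_ext _ _ _ _ (stz _ _ H)) => t _; rewrite /fl /e.
    have n12 : (b.+2 == b.+1) = false by slia.
    have n21 : (b.+1 == b.+2) = false by slia.
    case: kE => ->; rewrite ?eqxx ?n12 ?n21.
      case: (eqVneq t b.+1) => [et|nt1]; first by rewrite ?et ?n21 ?n12 ?eqxx.
      by case: (t == b.+2).
    case: (eqVneq t b.+1) => [et|nt1]; first by rewrite ?et ?n12 ?n21 ?eqxx.
    by case: (eqVneq t b.+2) => // et; rewrite ?et ?n21 ?n12 ?eqxx.
  have := asc_x _ _ _ _ H lti gt0; case: sg H => H ik.
    exists k0.+1, true; split; first by slia.
    by move: (sti _ _ _ lti H); rewrite ik; apply: st_ext => t _; apply: e_swap_up.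
  exists i, false; split; first by slia.
  by move: (sti _ _ _ lti H); rewrite -ik; apply: st_ext => t _; apply: e_swap_down.
have up_state i x : i <= m -> x \in X -> st (e i true) x ->
    x \in <<[set y in take i p]>> /\ len x = i.
  elim: i x => [|i IHi] x lei xX Hx.
    have -> : x = 1.
      apply: (no_descent_one ca IS sI xX) => q /exI[->|[j ltj ->]].
        by case: Hx => _ ->.
      by rewrite (coefx _ _ _ Hx ltj) /e /=; case: (j == 0%N).
    by rewrite group1 cox_length1.
  have lt0 : (M x s (x_ i) < 0)%R.
    rewrite (coefx _ _ _ Hx lei) /e eqxx.
    by have -> : (i == i.+1) = false by slia.
  have [xiX xil] := quot_down ca IS sI xX (xI lei) lt0.
  have Hxi : st (e i true) (x * x_ i).
    by apply: (st_ext _ _ _ _ (sti _ _ _ lei Hx)) => t _; apply: e_swap_down.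
  have [xiG xiL] := IHi _ (ltnW lei) xiX Hxi.
  split; last by rewrite xil xiL.
  rewrite -(simple_mulK ca x (ISm (xI lei))) groupM //.
    apply: (subsetP (genS _)) xiG; apply/subsetP => y; rewrite !inE.
    by rewrite (take_nth 1 lei) mem_rcons inE => ->; rewrite orbT.
  by rewrite mem_gen // inE (take_nth 1 lei) mem_rcons mem_head.
(* The shortest element with two ascents is that of e_(b+1), of length b+1, which both x_(b+1) and z
   raise. *)
have leaf : unique_ascents S M I s b.+1.
  move=> x xX ltx; have [k0 [sg [lek H]]] := Q x xX.
  have one q : q \in I -> (0 < M x s q)%R ->
      q = if sg then if k0 == b.+2 then z else x_ k0 else x_ k0.-1.
    case/exI => [->|[i lti ->]] gt0.
      have [sgT [kE|kE]] := asc_z _ _ _ H gt0; rewrite sgT; last by rewrite kE eqxx.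
      rewrite sgT in H; have [_ lx] := up_state _ _ lek xX H.
      by move: ltx; rewrite lx kE ltnn.
    have := asc_x _ _ _ _ H lti gt0; case: (sg) => [ik|<- //].
    have nk : (k0 == b.+2) = false by slia.
    by rewrite nk ik.
  by move=> q r qI rI /(one q qI)-> /(one r rI)->.
have [k0 [sg [lek H]]] := Q v v_min_rep.
have subI k : [set y in z :: take k p] \subset I.
  by rewrite IE; apply/subsetP => y; rewrite !inE => /orP[->//|/mem_take->]; rewrite orbT.
(* A positive vector is reached without z, and -e_(b+2) without x_(b+1), so neither has full
   support. *)
case: sg H => H.
  have [vG _] := up_state _ _ lek v_min_rep H.
  have sub : [set y in take k0 p] \subset I.
    by apply: subset_trans (subI k0); apply/subsetP => y; rewrite !inE => ->; rewrite orbT.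
  have /subsetP /(_ z zI) := full sub vG.
  by rewrite inE => /mem_take; rewrite (negPf uz).
have ltb1 : b.+1 < m by rewrite mE.
case: (eqVneq k0 b.+2) => [kE|nk].
  have lt0 : (M v s z < 0)%R.
    case: H => _ ->; rewrite /e kE eqxx.
    by have -> : (b.+1 == b.+2) = false by slia.
  have [vzX _] := quot_down ca IS sI v_min_rep zI lt0.
  have Hz : st (e b.+1 true) (v * z).
    apply: (st_ext _ _ _ _ (stz _ _ H)) => t _; rewrite /fl /e kE.
    have n21 : (b.+1 == b.+2) = false by slia.
    rewrite eqxx n21; case: (eqVneq t b.+1) => // nt1.
    by case: (eqVneq t b.+2).
  have [vzG _] := up_state _ _ (ltnW ltb1) vzX Hz.
  have vG : v \in <<[set y in z :: take b.+1 p]>>.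
    rewrite -(simple_mulK ca v (ISm zI)) groupM //.
      apply: (subsetP (genS _)) vzG; apply/subsetP => y; rewrite !inE => ->.
      by rewrite orbT.
    by rewrite mem_gen // !inE eqxx.
  have /subsetP /(_ (x_ b.+1) (xI ltb1)) := full (subI _) vG.
  by rewrite !inE xz // (negPf (not_mem_take (leqnn _) ltb1)).
have lek1 : k0 <= b.+1 by slia.
have kgt0 : 0 < k0.
  have [r /exI[->|[i lti ->]] gt0] := asc.
    by have [] := asc_z _ _ _ H gt0.
  by have /= <- := asc_x _ _ _ _ H lti gt0.
(* Going down from -e_k0 the position rises to b+1, where x_(b+1) and z are both descents. This
   takes b+1-k0 steps, and k0 > 0, which comes from the ascent, keeps it within the bound. *)
have fall d x k j : (k + d)%N = b.+1 -> x \in X -> bruhat S x v ->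
    (len x + j)%N = len v -> j + d < b.+1 -> st (e k false) x -> False.
  elim: d x k j => [|d IHd] x k j kd xX xv lx ltj Hx.
    move: kd ltj; rewrite !addn0 => kd ltj; rewrite kd in Hx.
    have n12 : (b.+2 == b.+1) = false by slia.
    have d1 : (M x s (x_ b.+1) < 0)%R by rewrite (coefx _ _ _ Hx ltb1) /e eqxx n12.
    have d2 : (M x s z < 0)%R by case: Hx => _ ->; rewrite /e eqxx n12.
    have := top_descent_unique leaf xX xv lx ltj (xI ltb1) zI d1 d2.
    by move/eqP; rewrite xz.
  have ltk : k < m by slia.
  have lt0 : (M x s (x_ k) < 0)%R.
    rewrite (coefx _ _ _ Hx ltk) /e eqxx.
    by have -> : (k.+1 == k) = false by slia.
  have [xkX xkl xkv] := descent_down xX (xI ltk) lt0 xv.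
  apply: (IHd (x * x_ k) k.+1 j.+1) => //.
  - by rewrite addSnnS.
  - by rewrite -lx xkl addSnnS.
  - by rewrite addSnnS.
  apply: (st_ext _ _ _ _ (sti _ _ _ ltk Hx)) => t _.
  rewrite /swap /e eqxx; have -> : (k.+1 == k) = false by slia.
  by case: (eqVneq t k) => [->|//]; have -> : (k == k.+1) = false by slia.
apply: (fall (b.+1 - k0)%N v k0 0%N) => //.
- by rewrite subnKC.
- exact: v_min_rep.
- exact: bruhat_refl.
- by rewrite addn0.
- by rewrite add0n; slia.
Qed.

End Fork.

End PalindromicElement.

(** * Types E and F by enumeration *)

(* The element x of the quotient is encoded by the list of the coefficients
   M x s r, r being the nodes in order. *)
Section StateMachine.
Variables (n : nat) (C : seq (seq nat)).
Implicit Types (f : seq int) (w : seq nat).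

Definition state_move f i : seq int :=
  mkseq (fun j => if j == i then - f`_i
    else f`_j + (nth 0%N (nth [::] C i) j)%:Z * f`_i)%R n.

Definition state_descents f := [seq i <- iota 0 n | (f`_i < 0)%R].
Definition state_ascents f := [seq i <- iota 0 n | (0 < f`_i)%R].

(* Unlike has and &&, which vm_compute evaluates in full, this stops at the first success. *)
Fixpoint lazy_has (T : Type) (a : T -> bool) (r : seq T) : bool :=
  if r is x :: r' then if a x then true else lazy_has a r' else false.

Fixpoint state_climb f w : option (seq int) :=
  if w is r :: w' then
    if (0 < f`_r)%R then state_climb (state_move f r) w' else None
  else Some f.

(* Descends along w, then along d, and climbs back along w: this multiplies the
   element by a reflection conjugate to d, giving an element covered by it. *)
Fixpoint other_coatom fuel f w f1 : bool :=
  lazy_has (fun d => let g := state_move f d in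
    if (if w is [::] then false
        else if state_climb g w is Some g' then g' != f1 else false) then true
    else if fuel is fuel'.+1 then other_coatom fuel' g (d :: w) f1 else false)
  (state_descents f).

(* Finds two elements of the same length among those at most k below the top. *)
Fixpoint ambiguous depth k f : bool :=
  if k is k'.+1 then
    match state_descents f with
    | [::] => false
    | [:: d] => let g := state_move f d in
       if other_coatom depth f [::] g then true else ambiguous depth k' g
    | _ => true
    end
  else false.

(* Visits each element once, along the word of its smallest descents; mask
   records the letters used, that is, the support. *)
Fixpoint explore (ok : seq int -> bool) fuel f (mask : seq bool) : bool :=
  if (if all id mask then ok f else true) then
    if fuel is fuel'.+1 then
      all (fun i => let g := state_move f i in
        if head n (state_descents g) == i
        then explore ok fuel' g (set_nth false mask i true) else true)
      (state_ascents f)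
    else nilp (state_ascents f)
  else false.

Fixpoint low_unique k f : bool :=
  if k is k'.+1 then
    if size (state_ascents f) <= 1 then
      all (fun i => low_unique k' (state_move f i)) (state_ascents f)
    else false
  else true.

Definition start_state i0 : seq int := mkseq (fun i => ((i == i0)%:R)%R) n.

(** [special] exempts states that have an ascent and need not be ambiguous. The depths 1, 4, 9 bound
    the search for a second coatom and are tried in turn. Insufficient depth or fuel can only make
    the check fail. *)
Definition quotient_check (special : seq int -> bool) k fuel i0 :=
  low_unique k (start_state i0) &&
  explore (fun f => if nilp (state_ascents f) then true
    else if special f then true
      else lazy_has (fun depth => ambiguous depth k f) [:: 1; 4; 9]%N)
    fuel (start_state i0) (nseq n false).

End StateMachine.

(** Nodes 0 to m-1 form the path and node m is attached to node b. *)
Definition fork_cartan m b : seq (seq nat) :=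
  mkseq (fun i => mkseq (fun j =>
    if j == m then i == b : nat else if i == m then j == b : nat
    else (j == i.+1) || (i == j.+1) : nat) m.+1) m.+1.

Definition F4_cartan (a b : nat) : seq (seq nat) :=
  [:: [:: 0; 1; 0; 0]; [:: 1; 0; a; 0]; [:: 0; b; 0; 1]; [:: 0; 0; 1; 0]]%N.

(** * Soundness of the enumeration *)

Section Soundness.
Variables (W : finGroupType) (S : {set W}) (A : W -> W -> nat).
Variable M : W -> W -> W -> int.
Hypothesis ca : cartan_action S A M.
Variables (I : {set W}) (s : W).
Hypotheses (IS : I \subset S) (sI : s \in I).
Let ISm r : r \in I -> r \in S. Proof. exact: (subsetP IS). Qed.

Local Notation len := (cox_length S).
Local Notation X := (min_reps I (I :\ s)).
Implicit Types (x y : W).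

Variables (l : seq W) (C : seq (seq nat)) (i0 : nat).
Local Notation n := (size l).
Hypotheses (IE : I = [set x in l]) (ul : uniq l).
Hypothesis CE : forall i j, i < n -> j < n -> i != j ->
  A (nth 1%g l i) (nth 1%g l j) = nth 0%N (nth [::] C i) j.
Hypotheses (i0n : i0 < n) (sE : nth 1%g l i0 = s).

Let lI i : i < n -> nth 1%g l i \in I.
Proof. by move=> lti; rewrite IE inE mem_nth. Qed.
Let exI r : r \in I -> exists2 i, i < n & r = nth 1%g l i.
Proof. by rewrite IE inE => /(nthP 1)[i lti <-]; exists i. Qed.

Definition state_of x : seq int := mkseq (fun i => M x s (nth 1%g l i)) n.

Lemma nth_state_of x i : i < n -> ((state_of x)`_i)%R = M x s (nth 1%g l i).
Proof. by move=> lti; rewrite nth_mkseq. Qed.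

Lemma state_of_mul x i : i < n ->
  state_of (x * nth 1%g l i) = state_move n C (state_of x) i.
Proof.
move=> lti; apply/(eq_from_nth (x0 := 0%R)); rewrite !size_mkseq // => j ltj.
rewrite !nth_mkseq // (coef_mulr ca IS sI) ?lI // (inj_in_eq (f := nth 1%g l) (D := [pred k | k < n])).
- by case: (eqVneq j i) => // nji; rewrite CE // eq_sym.
- by move=> a b; rewrite !inE => la lb /eqP; rewrite nth_uniq // => /eqP.
- by rewrite inE.
- by rewrite inE.
Qed.

Lemma state_of1 : state_of 1 = start_state n i0.
Proof.
apply/(eq_from_nth (x0 := 0%R)); rewrite !size_mkseq // => j ltj.
rewrite !nth_mkseq // (coef_at1 ca IS sI) ?lI // -sE nth_uniq //.
by rewrite eq_sym.
Qed.

Lemma mem_state_descents x i : (i \in state_descents n (state_of x)) =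
  (i < n) && (M x s (nth 1%g l i) < 0)%R.
Proof.
rewrite mem_filter mem_iota add0n /= andbC; apply: andb_id2l => lti.
by rewrite nth_state_of.
Qed.

Lemma mem_state_ascents x i : (i \in state_ascents n (state_of x)) =
  (i < n) && (0 < M x s (nth 1%g l i))%R.
Proof.
rewrite mem_filter mem_iota add0n /= andbC; apply: andb_id2l => lti.
by rewrite nth_state_of.
Qed.

Lemma lazy_hasE (T : Type) (a : pred T) r : lazy_has a r = has a r.
Proof. by elim: r => //= x r ->; case: (a x). Qed.

(** Equal states have the same descents, so both elements can be divided by the same letters down to
    1. *)
Lemma state_of_inj x y : x \in X -> y \in X -> state_of x = state_of y -> x = y.
Proof.
move=> xX; move: x xX y; apply: (quot_ind ca IS sI) => [|x p xX /exI[i lti ->] gt0 IH] y yX e.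
  apply/esym/(no_descent_one ca IS sI yX) => r /exI[i lti ->].
  by rewrite -nth_state_of // -e nth_state_of // (coef_at1 ca IS sI) ?lI //; case: eqP.
have lt0 : (M y s (nth 1%g l i) < 0)%R.
  rewrite -nth_state_of // -e nth_state_of // (coef_mulr ca IS sI) ?lI // eqxx.
  by rewrite oppr_lt0.
have [yiX _] := quot_down ca IS sI yX (lI lti) lt0.
have iS := ISm (lI lti).
rewrite (IH (y * nth 1%g l i)) ?(simple_mulK ca) // state_of_mul // -e -state_of_mul //.
by rewrite (simple_mulK ca).
Qed.

Lemma low_uniqueP k : low_unique n C k (start_state n i0) -> unique_ascents S M I s k.
Proof.
move=> low x xX ltx.
have Q j y : y \in X -> (len y + j)%N = k -> low_unique n C j (state_of y).
  move=> yX; move: y yX j; apply: (quot_ind ca IS sI).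
    by move=> j; rewrite cox_length1 add0n => ->; rewrite state_of1.
  move=> y p yX /exI[i lti ->] gt0 IH j.
  have [yiX yil] := quot_up ca IS sI yX (lI lti) gt0.
  rewrite yil addSnnS => /IH /=; case: ifP => // _ /allP; rewrite state_of_mul //; apply.
  by rewrite mem_state_ascents lti.
have [j jk] : exists j, (len x + j.+1)%N = k by exists (k - (len x).+1)%N; slia.
have /= := Q _ _ xX jk; case: ifP => // le1 _ p q /exI[a lta ->] /exI[b ltb ->] ga gb.
have ain : a \in state_ascents n (state_of x) by rewrite mem_state_ascents lta.
have bin : b \in state_ascents n (state_of x) by rewrite mem_state_ascents ltb.
by move: le1 ain bin; case: (state_ascents _ _) => [|c [|c' r]] //= _;
  rewrite !inE => /eqP-> /eqP->.
Qed.

Lemma state_climbP y w g : y \in X -> all (fun i => i < n) w ->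
  state_climb n C (state_of y) w = Some g ->
  [/\ y * wprod [seq nth 1%g l i | i <- w] \in X,
      state_of (y * wprod [seq nth 1%g l i | i <- w]) = g &
      len (y * wprod [seq nth 1%g l i | i <- w]) = (len y + size w)%N].
Proof.
elim: w y => [|r w IHw] y yX /=.
  by move=> _ [<-]; rewrite wprod_nil mulg1 addn0.
case/andP=> ltr wn; case: ifP => // gt0; rewrite -state_of_mul // => e.
rewrite nth_state_of // in gt0.
have [yrX yrl] := quot_up ca IS sI yX (lI ltr) gt0.
have [h1 h2 h3] := IHw _ yrX wn e.
by rewrite wprod_cons mulgA; split=> //; rewrite h3 yrl addSnnS.
Qed.

Section Top.
Variables (J : {set W}) (v : W).
Hypotheses (JS : J \subset S) (KE : I :\ s = I :&: J).
Hypotheses (vI : v \in <<I>>) (vm : v \in min_reps S J).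
Hypothesis pal : palindromic S J v.
Hypothesis full : forall L : {set W}, L \subset I -> v \in <<L>> -> I \subset L.
Hypothesis asc : exists2 r, r \in I & (0 < M v s r)%R.

Let gX x : x \in X -> x \in <<S>>.
Proof. exact: (min_reps_gen ca IS (subsetDl I [set s])). Qed.

(** With u the product of [w], the element x u = (x d) d u loses the letter d and becomes y = x d u.
    The successful climb shows that y is in the quotient and one shorter, and the two differ by the
    reflection u^-1 d u. *)
Lemma skipped_letter_coatom x w d f1 : x \in X -> all (fun i => i < n) w ->
  len (x * wprod [seq nth 1%g l i | i <- w]) = (len x + size w)%N ->
  d < n -> (M x s (nth 1%g l d) < 0)%R ->
  (if w is [::] then false else
   if state_climb n C (state_of (x * nth 1%g l d)) w is Some g then g != f1 else false) ->
  exists y, [/\ y \in X, state_of y != f1,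
    (len y).+1 = len (x * wprod [seq nth 1%g l i | i <- w]) &
    bruhat S y (x * wprod [seq nth 1%g l i | i <- w])].
Proof.
move=> xX wn lw ltd lt0 hit; have [xdX xdl] := quot_down ca IS sI xX (lI ltd) lt0.
have dS := ISm (lI ltd).
case E: (state_climb n C (state_of (x * nth 1%g l d)) w) hit => [g|]; last by case: (w).
have [h1 h2 h3] := state_climbP xdX wn E.
set u := wprod _ in lw h1 h2 h3 *.
have uS : u \in <<S>>.
  by apply: mem_wprod; apply/allP => _ /mapP[i iw ->]; apply/ISm/lI/(allP wn).
move=> hit; have ne : g != f1 by case: (w) hit.
have ly : (len (x * nth 1%g l d * u)).+1 = len (x * u).
  by rewrite h3 lw xdl addSn.
exists (x * nth 1%g l d * u); split=> //; first by rewrite h2.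
have xE : x * u = x * nth 1%g l d * u * (u^-1 * nth 1%g l d * u^-1^-1).
  by rewrite invgK !mulgA mulgK (simple_mulK ca).
rewrite [in X in bruhat _ _ X]xE; apply: (bruhat_step ca (subxx S)) => //.
- exact: gX.
- by rewrite groupV.
- by rewrite -xE ly.
Qed.

Lemma other_coatomP fuel x w f1 : x \in X -> all (fun i => i < n) w ->
  len (x * wprod [seq nth 1%g l i | i <- w]) = (len x + size w)%N ->
  other_coatom n C fuel (state_of x) w f1 ->
  exists y, [/\ y \in X, state_of y != f1,
    (len y).+1 = len (x * wprod [seq nth 1%g l i | i <- w]) &
    bruhat S y (x * wprod [seq nth 1%g l i | i <- w])].
Proof.
elim: fuel x w => [|fuel IHf] x w xX wn lw /=; rewrite lazy_hasE => /hasP[d].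
  rewrite mem_state_descents => /andP[ltd lt0]; rewrite -state_of_mul //.
  by case: ifP => // hit _; apply: skipped_letter_coatom hit.
rewrite mem_state_descents => /andP[ltd lt0]; rewrite -state_of_mul //.
case: ifP => [hit _|_]; first exact: skipped_letter_coatom hit.
have [xdX xdl] := quot_down ca IS sI xX (lI ltd) lt0.
move=> H; have wn' : all (fun i => i < n) (d :: w) by rewrite /= ltd.
have E : x * nth 1%g l d * wprod [seq nth 1%g l i | i <- d :: w] =
    x * wprod [seq nth 1%g l i | i <- w].
  by rewrite /= wprod_cons mulgA (simple_mulK ca) // ISm // lI.
rewrite -E; apply: IHf => //; rewrite E lw xdl /=; slia.
Qed.

Lemma ambiguousP depth kb k j x : unique_ascents S M I s kb -> x \in X ->
  bruhat S x v -> (len x + j)%N = len v -> j + k <= kb ->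
  ambiguous n C depth k (state_of x) -> False.
Proof.
move=> ua; elim: k j x => [//|k IHk] j x xX xv lx lejk /=.
have ltj : j < kb by slia.
case E: (state_descents _ _) => [//|d [|d' r]].
  have : d \in state_descents n (state_of x) by rewrite E mem_head.
  rewrite mem_state_descents => /andP[ltd lt0].
  have [xdX xdl xdv] := descent_down ca IS sI xX (lI ltd) lt0 xv.
  rewrite -state_of_mul //; case: ifP => [hit _|_ H]; last first.
    by apply: (IHk j.+1 _ xdX xdv _ _ H); [rewrite -lx xdl addSnnS | rewrite addSnnS].
  have x1 : x = x * wprod [seq nth 1%g l i | i <- [::]] by rewrite wprod_nil mulg1.
  have l0 : len (x * wprod [seq nth 1%g l i | i <- [::]]) = (len x + size ([::] : seq nat))%N.
    by rewrite -x1 addn0.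
  have [y [yX ny yl yx]] := other_coatomP (w := [::]) xX isT l0 hit.
  rewrite -x1 in yl yx.
  have e : y = x * nth 1%g l d.
    apply: (palindromic_top_unique ca IS sI ua JS KE vI vm pal ltj).
    - by rewrite -lx -yl addSnnS.
    - by rewrite -lx xdl addSnnS.
    - by apply: (in_lower_interval ca IS JS KE vI yX); apply: bruhat_trans yx xv.
    - exact: (in_lower_interval ca IS JS KE vI xdX).
  by rewrite e eqxx in ny.
move=> _.
have : d \in state_descents n (state_of x) by rewrite E mem_head.
have : d' \in state_descents n (state_of x) by rewrite E !inE eqxx orbT.
rewrite !mem_state_descents => /andP[ltd' lt0'] /andP[ltd lt0].
have e := top_descent_unique ca IS sI JS KE vI vm pal ua xX xv lx ltj (lI ltd) (lI ltd') lt0 lt0'.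
have : uniq (state_descents n (state_of x)) by rewrite filter_uniq // iota_uniq.
rewrite E /= inE; move/eqP: e; rewrite nth_uniq // => /eqP->.
by rewrite eqxx.
Qed.

Lemma quotient_checkP (special : seq int -> bool) k fuel :
  quotient_check n C special k fuel i0 -> special (state_of v).
Proof.
case/andP=> /low_uniqueP ua.
set ok := (X in explore _ _ X) => chk.
have vX := v_min_rep ca IS JS KE vI vm.
pose L (mask : seq bool) := [set nth 1%g l i | i : 'I_n & nth false mask i].
(* The visit of x is found by removing smallest descents; [mask] marks the letters of that word,
   which generate a subgroup containing x. *)
have Q x : x \in X -> exists fuel' mask, [/\ size mask = n, x \in <<L mask>> &
    explore n C ok fuel' (state_of x) mask].
  move: {2}(len x) (erefl (len x)) => t; elim: t x => [|t IHt] x xl xX.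
    rewrite (cox_length_eq0 (gX xX) xl); exists fuel, (nseq n false).
    by rewrite size_nseq group1 state_of1.
  have nx1 : x != 1 by apply: contra_eq_neq xl => ->; rewrite cox_length1.
  have [p /exI[i lti pE] lt0] := quot_descent ca IS sI xX nx1.
  have : state_descents n (state_of x) != [::].
    apply/eqP => e; have : i \in state_descents n (state_of x).
      by rewrite mem_state_descents lti -pE.
    by rewrite e.
  case E: (state_descents n (state_of x)) => [//|d r] _.
  have : d \in state_descents n (state_of x) by rewrite E mem_head.
  rewrite mem_state_descents => /andP[ltd ltd0].
  have [xdX xdl] := quot_down ca IS sI xX (lI ltd) ltd0.
  have dS := ISm (lI ltd).
  have [|fuel' [mask [szm xdL]]] := IHt (x * nth 1%g l d) _ xdX; first by slia.
  have dasc : d \in state_ascents n (state_of (x * nth 1%g l d)).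
    by rewrite mem_state_ascents ltd (coef_mulr ca IS sI) ?lI // eqxx oppr_gt0.
  case: fuel' => [|fuel'] /=; case: ifP => // _; first by case: (state_ascents _ _) dasc.
  move=> /allP /(_ _ dasc); rewrite -state_of_mul // (simple_mulK ca) // E /= eqxx => H.
  exists fuel', (set_nth false mask d true); split=> //.
    by rewrite size_set_nth szm; apply/maxn_idPr.
  rewrite -(simple_mulK ca x dS) groupM //.
    apply: (subsetP (genS _)) xdL; apply/subsetP => _ /imsetP[j jm ->].
    apply: imset_f; move: jm; rewrite !inE nth_set_nth /=.
    by case: eqP.
  apply: mem_gen; apply/imsetP; exists (Ordinal ltd) => //.
  by rewrite inE nth_set_nth /= eqxx.
have [fuel' [mask [szm vL ex]]] := Q v vX.
have LI : L mask \subset I.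
  by apply/subsetP => _ /imsetP[i _ ->]; apply: lI.
(* Full support makes the mask entirely true at v, so [ok] was evaluated there. *)
have am : all id mask.
  apply/(all_nthP false) => i; rewrite szm => lti.
  have /subsetP /(_ _ (lI lti)) /imsetP[j] := full LI vL.
  by rewrite inE => jm /eqP; rewrite nth_uniq // => /eqP->.
have : ok (state_of v) by case: fuel' ex => [|fuel'] /=; rewrite am; case: ifP.
rewrite /ok; have -> : nilp (state_ascents n (state_of v)) = false.
  have [r /exI[i lti ->] gt0] := asc.
  apply/negP => /nilP e; have : i \in state_ascents n (state_of v).
    by rewrite mem_state_ascents lti.
  by rewrite e.
case: ifP => // _; rewrite lazy_hasE => /hasP[depth _ amb].
by case: (ambiguousP (j := 0) ua vX (bruhat_refl _ _) (addn0 _) (leqnn k) amb).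
Qed.

End Top.
End Soundness.

Definition no_special : seq int -> bool := fun=> false.

(** In these checks the bound is the length of the first element with two ascents: b+1 from an end
    of the path, 2 from the side node. The fuel 100 exceeds the length of every quotient, the
    longest being 92 for the side node of E8. *)
Lemma check_E6_end : quotient_check 6 (fork_cartan 5 2) no_special 3 100 0.
Proof. by vm_compute. Qed.
Lemma check_E7_end2 : quotient_check 7 (fork_cartan 6 2) no_special 3 100 0.
Proof. by vm_compute. Qed.
Lemma check_E7_end3 : quotient_check 7 (fork_cartan 6 3) no_special 4 100 0.
Proof. by vm_compute. Qed.
Lemma check_E8_end2 : quotient_check 8 (fork_cartan 7 2) no_special 3 100 0.
Proof. by vm_compute. Qed.
Lemma check_E8_end4 : quotient_check 8 (fork_cartan 7 4) no_special 5 100 0.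
Proof. by vm_compute. Qed.
Lemma check_E6_side : quotient_check 6 (fork_cartan 5 2) no_special 2 100 5.
Proof. by vm_compute. Qed.
Lemma check_E7_side : quotient_check 7 (fork_cartan 6 2) no_special 2 100 6.
Proof. by vm_compute. Qed.
Lemma check_E8_side : quotient_check 8 (fork_cartan 7 2) no_special 2 100 7.
Proof. by vm_compute. Qed.

(** States of the prefixes of the exceptional word s1 s2 s3 s4; the one with k = 4 is exempted
    below. *)
Definition F4_path a b k : seq int :=
  foldl (state_move 4 (F4_cartan a b)) (start_state 4 0) (iota 0 k).

Lemma check_F4_12 :
  quotient_check 4 (F4_cartan 1 2) (pred1 (F4_path 1 2 4)) 3 100 0.
Proof. by vm_compute. Qed.
Lemma check_F4_21 :
  quotient_check 4 (F4_cartan 2 1) (pred1 (F4_path 2 1 4)) 3 100 0.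
Proof. by vm_compute. Qed.

(** * Forked diagrams and F4, for an element with an ascent *)

Section Assembly.
Variables (W : finGroupType) (S : {set W}) (A : W -> W -> nat).
Variable M : W -> W -> W -> int.
Hypothesis ca : cartan_action S A M.
Local Notation len := (cox_length S).

Section Element.
Variables (I J : {set W}) (s v : W).
Hypotheses (IS : I \subset S) (sI : s \in I) (JS : J \subset S).
Hypothesis KE : I :\ s = I :&: J.
Hypotheses (vI : v \in <<I>>) (vm : v \in min_reps S J).
Hypothesis pal : palindromic S J v.
Hypothesis full : forall L : {set W}, L \subset I -> v \in <<L>> -> I \subset L.
Hypothesis asc : exists2 r, r \in I & (0 < M v s r)%R.

(** A symmetric form of [branched], suited to reversing the path and to exchanging z with an end
    next to the branch node. *)
Definition fork p z (b : nat) := [/\ I = [set x in z :: p], z \notin p, uniq p,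
  forall i j, i < size p -> j < size p -> i != j ->
    A (nth 1 p i) (nth 1 p j) = ((j == i.+1) || (i == j.+1)) :> nat &
  forall i, i < size p -> A (nth 1 p i) z = (i == b) :> nat /\
                          A z (nth 1 p i) = (i == b) :> nat].

Lemma fork_rev p z b : b < size p -> fork p z b -> fork (rev p) z (size p - b.+1).
Proof.
move=> ltb [IE nz up xS att]; split.
- by rewrite IE; apply/setP => y; rewrite !inE mem_rev.
- by rewrite mem_rev.
- by rewrite rev_uniq.
- move=> i j; rewrite size_rev => lti ltj nij; rewrite !nth_rev // xS; try by slia.
- move=> i; rewrite size_rev => lti; rewrite nth_rev //.
  have [-> ->] : A (nth 1 p (size p - i.+1)) z = (size p - i.+1 == b) :> nat /\
     A z (nth 1 p (size p - i.+1)) = (size p - i.+1 == b) :> nat by apply: att; slia.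
  have -> : (size p - i.+1 == b) = (i == size p - b.+1) by slia.
  by [].
Qed.

Lemma fork_shape p z b : fork p z b ->
  path_shape A p /\ (forall j, j.+1 < size p -> simple_at A p j).
Proof.
case=> _ _ _ xS _; split.
  move=> i j /andP[lij ltj] nj; rewrite !xS //; slia.
move=> j ltj; rewrite /simple_at !xS //; slia.
Qed.

Lemma fork_check p z b i0 k : fork p z b -> b < size p -> i0 < (size p).+1 ->
  nth 1 (rcons p z) i0 = s ->
  quotient_check (size p).+1 (fork_cartan (size p) b) no_special k 100 i0 -> False.
Proof.
case=> IE nz up xS att ltb lti0 sE; rewrite -(size_rcons p z) => chk.
suff : no_special (state_of M s (rcons p z) v) by [].
apply: (quotient_checkP ca IS sI _ _ _ _ sE JS KE vI vm pal full asc chk).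
- by rewrite IE; apply/setP => y; rewrite !inE mem_rcons inE.
- by rewrite rcons_uniq nz.
- move=> i j; rewrite size_rcons => lti ltj nij.
  rewrite /fork_cartan !nth_mkseq // !nth_rcons.
  case: (ltngtP j (size p)) => [ltjp|gtj|jE]; last 2 first.
  - by move: ltj gtj; slia.
  - have ltip : i < size p by slia.
    by rewrite ltip; case: (att i ltip).
  case: (ltngtP i (size p)) => [ltip|gti|iE]; last 2 first.
  - by move: lti gti; slia.
  - by case: (att j ltjp).
  exact: xS.
- by rewrite size_rcons.
Qed.

(** If an arm of the path has length 1, this is a spin quotient of D. Otherwise, up to reversal, the
    branch node is at position 2 and the type is E6, E7 or E8. *)
Lemma fork_false_side p z b : fork p z b -> s = z -> 0 < b -> b.+1 < size p ->
  [|| (b <= 1), (size p <= b.+2), (b == 2) && (size p <= b + 5) |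
      (size p == b + 3) && (b <= 4)]%N -> False.
Proof.
move=> fk sz b0 b1 cases.
have spin q : fork q z 1%N -> 2 < size q -> False.
  move=> fq q2; have [IE nz up xS att] := fq; have [psh sim] := fork_shape fq.
  apply: (spinD_palindromic ca IS sI JS KE vI vm pal full IE nz up psh sim (b := 1%N) _ _ asc sz) => //.
  - by move=> i lti; case: (att i lti).
  - by move=> i lti; case: (att i lti).
have chk q : fork q z 2 -> 4 < size q < 8 -> False.
  move=> fq /andP[q4 q8]; have q2 : 2 < size q by slia.
  have zE : nth 1 (rcons q z) (size q) = s by rewrite nth_rcons ltnn eqxx.
  have C : (size q == 5) || (size q == 6) || (size q == 7) by move: q4 q8; slia.
  case/orP: C => [/orP[]|] /eqP e.
  - by apply: (fork_check fq q2 (ltnSn _) zE (k := 2)); rewrite e; apply: check_E6_side.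
  - by apply: (fork_check fq q2 (ltnSn _) zE (k := 2)); rewrite e; apply: check_E7_side.
  - by apply: (fork_check fq q2 (ltnSn _) zE (k := 2)); rewrite e; apply: check_E8_side.
have ltb := ltnW b1; have fr := fork_rev ltb fk.
case: (eqVneq b 1%N) => [bE|nb1]; first by apply: (spin p); [rewrite -bE | slia].
case: (eqVneq (size p) b.+2) => [mE|nm].
  apply: (spin (rev p)); last by rewrite size_rev; slia.
  by have <- : (size p - b.+1)%N = 1%N by slia.
case: (eqVneq b 2) => [bE|nb2].
  apply: (chk p); first by rewrite -bE.
  by move: cases; slia.
apply: (chk (rev p)); last by rewrite size_rev; move: cases; slia.
by have <- : (size p - b.+1)%N = 2 by move: cases; slia.
Qed.

Lemma fork_false_end p z b : fork p z b -> s = nth 1 p 0 -> 0 < b -> b.+1 < size p ->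
  [|| (b <= 1), (size p <= b.+2), (b == 2) && (size p <= b + 5) |
      (size p == b + 3) && (b <= 4)]%N -> False.
Proof.
move=> fk sE b0 b1 cases; have [IE nz up xS att] := fk.
have [psh sim] := fork_shape fk.
case: (eqVneq b 1%N) => [bE|nb1].
  case: p IE nz up xS att sE b1 {fk psh sim cases} => [//|x0 p] /= IE nz up xS att sE b1.
  move: nz; rewrite inE negb_or => /andP[nzx nz]; have /andP[nx up'] := up.
  (* x_0 and z are both arms of length 1; exchanging them makes s the side node of a path starting
     with z. *)
  apply: (@fork_false_side (z :: p) x0 1); rewrite ?sE //; last by rewrite /=; slia.
  split; rewrite /= ?inE ?negb_or 1?eq_sym ?nzx ?nz //.
  - by rewrite IE; apply/setP => y; rewrite !inE orbCA.
  - move=> [|i] [|j] lti ltj nij //=.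
    + have [_ ->] := att j.+1 ltj; rewrite bE eqSS orbF. by [].
    + have [-> _] := att i.+1 lti; rewrite bE eqSS. by [].
    + exact: (xS i.+1 j.+1).
  - move=> [|i] lti /=.
      by have [-> ->] := att 0%N (ltn0Sn _); rewrite bE.
    by rewrite (xS i.+1 0%N) // (xS 0%N i.+1) // /= !orbF !eqSS.
case: (eqVneq (size p) b.+2) => [mE|nm].
  apply: (vectorD_palindromic ca IS sI JS KE vI vm pal full IE nz up psh sim _ _ asc b0 mE sE).
  - by move=> i lti; case: (att i lti).
  - by move=> i lti; case: (att i lti).
have x0E : nth 1 (rcons p z) 0 = s by rewrite nth_rcons sE; case: (size p) b1.
have ltb := ltnW b1.
have C : [|| (b == 2) && (size p == 5), (b == 2) && (size p == 6), (b == 2) && (size p == 7),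
   (b == 3) && (size p == 6) | (b == 4) && (size p == 7)]%N by move: cases; slia.
case/or4P: C => [|||/orP[]] /andP[/eqP bE /eqP mE].
- by apply: (fork_check fk ltb (ltn0Sn _) x0E (k := 3)); rewrite mE bE; apply: check_E6_end.
- by apply: (fork_check fk ltb (ltn0Sn _) x0E (k := 3)); rewrite mE bE; apply: check_E7_end2.
- by apply: (fork_check fk ltb (ltn0Sn _) x0E (k := 3)); rewrite mE bE; apply: check_E8_end2.
- by apply: (fork_check fk ltb (ltn0Sn _) x0E (k := 4)); rewrite mE bE; apply: check_E7_end3.
- by apply: (fork_check fk ltb (ltn0Sn _) x0E (k := 5)); rewrite mE bE; apply: check_E8_end4.
Qed.

Lemma fork_of_branched (p : seq W) z b : z \notin p -> I = [set x in z :: p] -> uniq p ->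
  path_shape A p -> branched A p z b -> fork p z b.
Proof.
move=> nz IE up psh [b0 b1 sim [a1 a2] [a0 cases]].
split=> //; first exact: simple_path_cartan (leqnn _) psh sim.
by move=> i lti; case: (eqVneq i b) => [->|nib]; last exact: a0.
Qed.

Lemma branched_false (p : seq W) z b : z \notin p -> I = [set x in z :: p] -> uniq p ->
  path_shape A p -> branched A p z b -> (s = nth 1 p 0) \/ s = z -> False.
Proof.
move=> nz IE up psh br sE; have fk := fork_of_branched nz IE up psh br.
have [b0 b1 _ _ [_ cases]] := br.
case: sE => sE; first exact: fork_false_end fk sE b0 b1 cases.
exact: fork_false_side fk sE b0 b1 cases.
Qed.

(** The enumeration leaves one possible state for v, and walking it down to 1 recovers the word, for
    each orientation of the double bond. *)
Lemma F4_palindromic (p : seq W) : I = [set x in p] -> uniq p -> path_shape A p ->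
  size p = 4 -> nth 1 p 0 = s -> simple_at A p 0 -> simple_at A p 2 ->
  (A (nth 1%g p 1) (nth 1%g p 2) * A (nth 1%g p 2) (nth 1%g p 1))%N = 2 ->
  v = \prod_(0 <= j < 4) nth 1 p j.
Proof.
move=> IE up psh m4 sE sim0 sim2 ab.
have main a b : A (nth 1 p 1) (nth 1 p 2) = a -> A (nth 1 p 2) (nth 1 p 1) = b ->
    quotient_check 4 (F4_cartan a b) (pred1 (F4_path a b 4)) 3 100 0 ->
    (forall i, i < 4 -> ((F4_path a b i.+1)`_i < 0)%R /\
       state_move 4 (F4_cartan a b) (F4_path a b i.+1) i = F4_path a b i) ->
    v = \prod_(0 <= j < 4) nth 1 p j.
  move=> aE bE chk fin.
  have CE i j : i < size p -> j < size p -> i != j ->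
      A (nth 1 p i) (nth 1 p j) = nth 0%N (nth [::] (F4_cartan a b) i) j.
    rewrite m4.
    have [s01 s10] := sim0; have [s23 s32] := sim2.
    have [n02 n20] : A (nth 1 p 0) (nth 1 p 2) = 0%N /\ A (nth 1 p 2) (nth 1 p 0) = 0%N.
      by apply: psh; rewrite ?m4.
    have [n03 n30] : A (nth 1 p 0) (nth 1 p 3) = 0%N /\ A (nth 1 p 3) (nth 1 p 0) = 0%N.
      by apply: psh; rewrite ?m4.
    have [n13 n31] : A (nth 1 p 1) (nth 1 p 3) = 0%N /\ A (nth 1 p 3) (nth 1 p 1) = 0%N.
      by apply: psh; rewrite ?m4.
    by case: i => [|[|[|[|i]]]] // _; case: j => [|[|[|[|j]]]].
  have p0 : 0 < size p by rewrite m4.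
  have xI i : i < 4 -> nth 1 p i \in I by move=> lti; rewrite IE inE mem_nth ?m4.
  have vX := v_min_rep ca IS JS KE vI vm.
  have smul x i : i < 4 -> state_of M s p (x * nth 1 p i) =
      state_move 4 (F4_cartan a b) (state_of M s p x) i.
    by move=> lti; rewrite (state_of_mul ca IS sI IE up CE) m4.
  have s1 : state_of M s p 1 = F4_path a b 0.
    by rewrite (state_of1 ca IS sI IE up p0 sE) m4.
  have sv : state_of M s p v = F4_path a b 4.
    suff: pred1 (F4_path a b 4) (state_of M s p v) by move/eqP.
    move: chk; rewrite -{1}m4 => chk.
    apply: (quotient_checkP ca IS sI IE up CE p0 sE JS KE vI vm pal full asc chk).
  apply: (path_product_unique ca IS (n := 4)
    (Q := fun i x => x \in min_reps I (I :\ s) /\ state_of M s p x = F4_path a b i)) => //.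
  - move=> x [xX e].
    apply: (state_of_inj ca IS sI IE up CE xX).
    + by apply: (min_reps1 ca IS); rewrite subsetDl.
    + by rewrite s1.
  - move=> i x lti [xX e]; have [lt0 mv] := fin i lti.
    have lt0' : (M x s (nth 1%g p i) < 0)%R by rewrite -(nth_state_of M s) ?m4 // e.
    have [xiX _] := quot_down ca IS sI xX (xI i lti) lt0'.
    by split=> //; rewrite smul // e.
have [[a1 b1]|[a1 b1]] : (A (nth 1%g p 1) (nth 1%g p 2) = 1 /\ A (nth 1%g p 2) (nth 1%g p 1) = 2)%N \/
   (A (nth 1%g p 1) (nth 1%g p 2) = 2 /\ A (nth 1%g p 2) (nth 1%g p 1) = 1)%N.
- move: ab; move: (A (nth 1 p 1) (nth 1 p 2)) (A (nth 1 p 2) (nth 1 p 1)) => a b; clear.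
  by case: a => [|[|[|a]]]; case: b => [|[|[|b]]] //=; auto; lia.
- apply: (main _ _ a1 b1 check_F4_12) => -[|[|[|[|i]]]] // _; split; by vm_compute.
- apply: (main _ _ a1 b1 check_F4_21) => -[|[|[|[|i]]]] // _; split; by vm_compute.
Qed.

End Element.

End Assembly.

(** * Leaves and components *)

Section Leaf.
Variables (W : finGroupType) (S : {set W}) (A : W -> W -> nat).
Variable M : W -> W -> W -> int.
Hypothesis ca : cartan_action S A M.
Local Notation adj := (dynkin_edge S).

Lemma dynkin_edge_sub (I : {set W}) x y : I \subset S ->
  dynkin_edge I x y = [&& x \in I, y \in I & adj x y].
Proof.
move/subsetP=> IS; rewrite /dynkin_edge /=.
by case xI: (x \in I); case yI: (y \in I); rewrite //= !IS.
Qed.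

Lemma dynkin_edge_sub_sym (I : {set W}) : I \subset S -> symmetric (dynkin_edge I).
Proof. move=> IS x y; rewrite (dynkin_edge_sub x y IS) (dynkin_edge_sub y x IS).
by rewrite [adj x y](adj_sym ca) andbCA. Qed.

Lemma leaf_neighbour s x y : dynkin_leaf S s -> adj s x -> adj s y -> x = y.
Proof.
case/andP=> _ /cards1P[t tE] sx sy.
have: x \in [set t] by rewrite -tE inE.
have: y \in [set t] by rewrite -tE inE.
by rewrite !inE => /eqP-> /eqP->.
Qed.

(** An inner node of a path has two neighbours, so s is an end; if it is the last node the path is
    reversed. *)
Lemma leaf_longest_path (I : {set W}) s : dynkin_leaf S s ->
  exists2 p, longest_path S I p & (s \in p -> nth 1 p 0 = s).
Proof.
move=> leaf; have [p lp] := longest_path_exists S I.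
case: (boolP (s \in p)) => sp; last by exists p => // /(negP sp).
have lti : index s p < size p by rewrite index_mem.
have sE : nth 1 p (index s p) = s by rewrite nth_index.
case: (posnP (index s p)) => [i0|ipos]; first by exists p => // _; rewrite -i0.
case: (ltnP (index s p).+1 (size p)) => [lti1|lei].
  have /(path_adj lp) : (index s p).-1.+1 < size p by rewrite prednK.
  rewrite prednK // sE (adj_sym ca) => e1.
  have := path_adj lp lti1; rewrite sE => e2.
  have := leaf_neighbour leaf e1 e2; move/eqP.
  rewrite (negPf (path_neq lp _ _ _)) //; first exact: leq_ltn_trans (leq_pred _) lti.
  by move: ipos; slia.
exists (rev p); first exact (longest_path_rev ca lp).
move=> _; rewrite nth_rev ?(leq_ltn_trans _ lti) //.
have -> : (size p - 1)%N = index s p by move: lei lti; slia.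
by [].
Qed.

(** Coefficients never become nonzero outside the component of s in [I], so v lies in the subgroup
    of that component, which full support makes all of [I]. *)
Lemma support_connected (I : {set W}) s v : I \subset S -> s \in I ->
  v \in min_reps I (I :\ s) ->
  (forall L : {set W}, L \subset I -> v \in <<L>> -> I \subset L) ->
  dynkin_connected I.
Proof.
move=> IS sI vX full.
pose C := [set r in I | connect (dynkin_edge I) s r].
have CI : C \subset I by apply/subsetP => r; rewrite inE => /andP[].
have sC : s \in C by rewrite inE sI connect0.
have A0 r q : r \in C -> q \in I -> q \notin C -> A r q = 0%N.
  move=> rC qI; have rI := subsetP CI r rC; rewrite inE qI /= => nq.
  apply/eqP/negPn/negP => nA; case/negP: nq.
  move: rC; rewrite inE rI /= => sr; apply: connect_trans sr _.
  case: (eqVneq r q) => [<-|nrq]; first exact: connect0.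
  apply: connect1; rewrite (dynkin_edge_sub _ _ IS) rI qI.
  by rewrite (dynkin_edgeE ca) ?(subsetP IS) // nrq nA.
pose P x := x \in <<C>> /\ forall q, q \in I -> q \notin C -> M x s q = 0%R.
have : P v.
  apply: (quot_ind ca IS sI _ _ vX) => [|x p xX pI gt0 [xC x0]].
    split=> [|q qI nq]; first exact: group1.
    rewrite (coef_at1 ca IS sI) //; case: eqP => // e.
    by move: nq; rewrite -e sC.
  have pC : p \in C by apply/negPn/negP => /(x0 _ pI) e; rewrite e in gt0.
  split=> [|q qI nq]; first by rewrite groupM // mem_gen.
  rewrite (coef_mulr ca IS sI) //.
  case: eqVneq => [e|_]; first by rewrite e pC in nq.
  by rewrite x0 // A0 // mul0r addr0.
case=> vC _; have /subsetP IC := full C CI vC.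
have cs x : x \in I -> connect (dynkin_edge I) s x.
  by move/IC; rewrite inE => /andP[].
move=> x y xI yI; apply: connect_trans (cs y yI).
by rewrite (sym_connect_sym (dynkin_edge_sub_sym IS)) cs.
Qed.

End Leaf.

Section Component.
Variables (W : finGroupType) (S : {set W}) (A : W -> W -> nat).
Variable M : W -> W -> W -> int.
Hypothesis ca : cartan_action S A M.
Variable s : W.
Hypothesis leaf : dynkin_leaf S s.
Local Notation D := (dynkin_component S s).

Let sS : s \in S. Proof. by case/andP: leaf. Qed.
Let DS : D \subset S. Proof. by apply/subsetP => x; rewrite inE => /andP[]. Qed.
Let sD : s \in D. Proof. by rewrite inE sS connect0. Qed.

Lemma component_connected : dynkin_connected D.
Proof.
have sub x y : connect (dynkin_edge S) s x -> connect (dynkin_edge S) x y ->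
    connect (dynkin_edge D) x y.
  move=> sx /connectP[e pe ->]; elim: e x sx pe => [|z e IHe] x sx; first by rewrite connect0.
  case/andP=> xz pe; have [xS zS _ _ _] := adjP ca xz.
  have sz : connect (dynkin_edge S) s z by apply: connect_trans sx (connect1 xz).
  apply: connect_trans (IHe z sz pe); apply: connect1.
  by rewrite (dynkin_edge_sub x z DS) !inE xS zS sx sz.
move=> x y; rewrite !inE => /andP[xS sx] /andP[yS sy]; apply: sub => //.
by apply: connect_trans sy; rewrite (sym_connect_sym (adj_sym ca)).
Qed.

Lemma component_sub (I : {set W}) : I \subset S -> s \in I -> dynkin_connected I -> I \subset D.
Proof.
move=> IS sI conn; apply/subsetP => x xI; rewrite inE (subsetP IS) //=.
apply: (connect_sub _ (conn s x sI xI)) => y z yz; apply: connect1.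
by move: yz; rewrite (dynkin_edge_sub y z IS) => /and3P[].
Qed.

(** The only neighbour of node n of [q] not visited before is node n+1, so [p] has to follow [q]. *)
Lemma path_prefix (p q : seq W) : uniq p -> uniq q -> path_shape A q ->
  {subset p <= q} -> 0 < size p -> nth 1 p 0 = nth 1 q 0 ->
  (forall i, i.+1 < size p -> A (nth 1 p i) (nth 1 p i.+1) != 0%N) ->
  forall i, i < size p -> nth 1 p i = nth 1 q i.
Proof.
move=> up uq psh pq p0 e0 adjp.
have q_ind i : i < size p -> exists2 j, j < size q & nth 1 p i = nth 1 q j.
  by move=> lti; have /(nthP 1)[j ltj <-] := pq _ (mem_nth 1 lti); exists j.
suff H n : n < size p -> forall i, i <= n -> nth 1 p i = nth 1 q i by move=> i /H; apply.
elim: n => [|n IHn] ltn i lei; first by have -> : i = 0%N by slia.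
have IH := IHn (ltnW ltn).
case: (ltngtP i n.+1) => [lt|gt|->]; [exact: IH | by move: lei gt; slia | ].
have [j ltj ej] := q_ind _ ltn.
case: (ltngtP j n.+1) => [lt|gt|jE]; last by rewrite ej jE.
  move/eqP: ej; rewrite -(IH j lt) nth_uniq ?(ltn_trans lt) // => /eqP e.
  by move: lt; rewrite -e ltnn.
have [q0 _] : A (nth 1 q n) (nth 1 q j) = 0%N /\ A (nth 1 q j) (nth 1 q n) = 0%N.
  by apply: psh; move: gt ltj; slia.
by have := adjp n ltn; rewrite (IH n (leqnn n)) ej q0.
Qed.

(** Passes from the support, where [p] lives, to the component, whose type is to be named. Branched
    diagrams are simply laced, so the component is a path, and [p] is its beginning. *)
Lemma component_multiple_path (p : seq W) j : uniq p -> {subset p <= D} ->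
  j.+1 < size p -> nth 1 p 0 = s ->
  (forall i, i.+1 < size p -> A (nth 1 p i) (nth 1 p i.+1) != 0%N) ->
  (A (nth 1%g p j) (nth 1%g p j.+1) * A (nth 1%g p j.+1) (nth 1%g p j) != 1)%N ->
  exists q, [/\ uniq q, path_shape A q, D = [set x in q] /\ nth 1 q 0 = s,
    size p <= size q /\ (forall i, i < size p -> nth 1 p i = nth 1 q i) &
    (forall i, i.+1 < size q -> i != j -> simple_at A q i) /\
    (0 < j -> j.+2 < size q -> size q = 4)].
Proof.
move=> up pD ltj ps adjp mult.
have [q lq qs] := leaf_longest_path ca D leaf.
have D0 : D != set0 by apply/set0Pn; exists s.
have neq : nth 1 p j != nth 1 p j.+1 by rewrite nth_uniq ?(ltnW ltj) // neq_ltn leqnn.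
have pm i : i < size p -> nth 1 p i \in D by move=> lti; apply: pD (mem_nth 1 lti).
have [uq q0 psh [[DE [j0 [sim dbl]]]|[z [b [nz DE br]]]]] :=
    classification ca DS component_connected lq D0; last first.
  have [_ _ _ xS att] := fork_of_branched nz DE uq psh br.
  have le1 x y : x \in D -> y \in D -> x != y -> A x y <= 1.
    rewrite DE !inE => /orP[/eqP->|/(nthP 1)[i lti <-]] /orP[/eqP->|/(nthP 1)[k ltk <-]] nxy.
    - by rewrite eqxx in nxy.
    - by have [_ ->] := att k ltk; case: eqP.
    - by have [-> _] := att i lti; case: eqP.
    - by rewrite xS //; [case: (_ || _) | move: nxy; apply: contraNneq => ->].
  have a1 := le1 _ _ (pm _ (ltnW ltj)) (pm _ ltj) neq.
  have := le1 _ _ (pm _ ltj) (pm _ (ltnW ltj)); rewrite eq_sym => /(_ neq) a2.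
  have b1 := adjp j ltj.
  have b2 : A (nth 1 p j.+1) (nth 1 p j) != 0%N.
    by rewrite -(ca_sym ca) // (subsetP DS) // pm // ltnW.
  case/negP: mult.
  by move: a1 a2 b1 b2; case: (A _ _) => [|[|a]] //; case: (A _ _) => [|[|c]].
have qE : nth 1 q 0 = s by apply: qs; have := sD; rewrite DE inE.
have pq : {subset p <= q} by move=> x /pD; rewrite DE inE.
have e := path_prefix up uq psh pq (leq_ltn_trans (leq0n _) ltj) (etrans ps (esym qE)) adjp.
have le := uniq_leq_size up pq.
have jE : j0 = j.
  apply/eqP/negPn/negP => nj; case/negP: mult.
  have [a1 a2] : simple_at A q j by apply: sim; rewrite 1?eq_sym // (leq_trans ltj).
  by rewrite !e ?(ltnW ltj) // a1 a2.
exists q; split=> //; split; first by rewrite -jE.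
move=> j_gt lt; case: dbl; rewrite ?jE; first exact: ltnW.
  by move=> q2; move: lt; rewrite q2; case: (j) j_gt.
by case=> _; apply.
Qed.

Lemma path_diagramE (C : {set W}) (q : seq W) ms : C = [set x in q] -> uniq q ->
  C \subset S -> path_shape A q -> size q = (size ms).+1 ->
  (forall i, i.+1 < size q -> let a := (A (nth 1%g q i) (nth 1%g q i.+1) * A (nth 1%g q i.+1) (nth 1%g q i))%N in
     a = 1%N /\ nth 2 ms i = 3 \/ a = 2 /\ nth 2 ms i = 4) ->
  path_diagram ms C q.
Proof.
move=> CE uq CS psh sz bonds.
have qS i : i < size q -> nth 1 q i \in S.
  by move=> lti; apply: (subsetP CS); rewrite CE inE mem_nth.
split=> // i j /andP[lij ltj]; have lti := ltn_trans lij ltj.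
have nij : nth 1 q i != nth 1 q j by rewrite nth_uniq // neq_ltn lij.
case: eqVneq => [jE|nj].
  have [[a1 ->]|[a2 ->]] := bonds i (eq_ind j (fun k => k < size q) ltj _ jE).
    rewrite -jE in a1; move/eqP: a1; rewrite muln_eq1 => /andP[/eqP a1 /eqP a2].
    by rewrite (order3 ca) ?qS.
  by rewrite (order4 ca) ?qS // jE.
have [a0 _] := psh i j (introT andP (conj lij ltj)) nj.
(* Nodes that commute give an order of at most 2, and it is not 1 because the nodes differ. *)
apply/eqP; rewrite eqn_leq (order_le2 ca) ?qS //.
rewrite -(commute_cartan0 ca) ?qS // a0 eqxx ltn_neqAle order_gt0 andbT eq_sym order_eq1.
rewrite -eq_invg_mul (simple_invg ca) ?qS //.
Qed.

End Component.

(** * The two directions of the equivalence *)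

Section Characterization.
Variables (W : finGroupType) (S : {set W}) (A : W -> W -> nat).
Variable M : W -> W -> W -> int.
Hypothesis ca : cartan_action S A M.
Variable s : W.
Hypothesis leaf : dynkin_leaf S s.
Local Notation D := (dynkin_component S s).
Local Notation J := (S :\ s).
Variable v : W.
Hypothesis vm : v \in min_reps S J.

Let sS : s \in S. Proof. by case/andP: leaf. Qed.
Let JS : J \subset S. Proof. exact: subsetDl. Qed.
Let DS : D \subset S. Proof. by apply/subsetP => x; rewrite inE => /andP[]. Qed.
Let vS : v \in <<S>>. Proof. by move: vm; rewrite inE => /andP[]. Qed.

Lemma min_reps_parabolic_eq1 : v \in <<J>> -> v = 1.
Proof.
move=> vJ; move: vm; rewrite inE => /andP[_ /forall_inP/(_ 1)].
rewrite mem_rcoset mul1g groupV => /(_ vJ).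
rewrite (cox_length1 S) leqn0 => /eqP l0.
exact: cox_length_eq0 vS l0.
Qed.

Lemma chain_of_unique_ascents (I : {set W}) : I \subset S -> s \in I ->
  (forall k, unique_ascents S M I s k) ->
  {in min_reps I (I :\ s) &, forall x y, bruhat I x y || bruhat I y x}.
Proof.
move=> IS sI ua; apply: (chain_of_unique_ascent ca IS sI) => x xX.
exact: (ua (cox_length S x).+1 x xX (ltnSn _)).
Qed.

(** F4 occurs once: its diagram reads the same from both ends, so with s taken as the first node
    cases (3) and (4) become one. *)
Lemma palindromic_cases : palindromic S J v ->
  [\/ locally_longest S J v, in_local_chain S J v,
      exists s1 s2 s3 s4, [/\ typeF4 D s1 s2 s3 s4, J = S :\ s1 & v = s1 * s2 * s3 * s4]
    | exists n l, [/\ typeB n D l, J = S :\ nth 1 l 0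
        & exists2 k, k <= n - 1 & v = \prod_(0 <= i < k.+1) nth 1 l i]].
Proof.
move=> pal; have full0 := fun K => @simple_support_min _ _ _ _ ca K v.
rewrite /locally_longest /in_local_chain /=.
have IS := simple_support_sub S v; have vI := simple_support_gen ca vS.
move: (simple_support S v) IS vI full0 => I IS vI full0.
have full (L : {set W}) : L \subset I -> v \in <<L>> -> I \subset L.
  by move=> LI; apply: full0; apply: subset_trans IS.
case: (eqVneq v 1) => [v1|nv1].
  (* The support of 1 is empty and its quotient is a point, which is a chain. *)
  constructor 2; have I0 : I = set0.
    by apply/eqP; rewrite -subset0 full ?sub0set // v1 group1.
  move=> x y; rewrite I0 !inE gen0 !inE => /andP[/eqP-> _] /andP[/eqP-> _].
  by rewrite bruhat_refl.
have sI : s \in I.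
  apply/negPn/negP => nsI; case/eqP: nv1; apply: min_reps_parabolic_eq1.
  apply: gen_sub vI; apply/subsetP => x xI; rewrite !inE (subsetP IS) // andbT.
  by apply: contraNneq nsI => <-.
have KE : I :\ s = I :&: J.
  apply/setP => x; rewrite !inE; case xI: (x \in I); rewrite ?andbF //=.
  by rewrite (subsetP IS) ?andbT.
have vX := v_min_rep ca IS JS KE vI vm.
have conn := support_connected ca IS sI vX full.
have chain := chain_of_unique_ascents IS sI.
rewrite -KE.
case: (boolP [exists r in I, (0 < M v s r)%R]) => [/exists_inP asc|]; last first.
  rewrite negb_exists_in => /forall_inP nasc; constructor 1; split=> //.
  by apply: (no_ascent_longest ca IS sI vX) => r /nasc; rewrite -leNgt.
have I0 : I != set0 by apply/set0Pn; exists s.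
have [p lp ps] := leaf_longest_path ca I leaf.
have [up p0 psh [[IE [j0 [sim dbl]]]|[z [b [nz IE br]]]]] :=
    classification ca IS conn lp I0; last first.
  case: (branched_false ca IS sI JS KE vI vm pal full asc nz IE up psh br).
  move: sI; rewrite IE !inE => /orP[/eqP->|]; [by right | by move/ps->; left].
have {}ps : nth 1 p 0 = s by apply: ps; have := sI; rewrite IE inE.
have simple_chain : (forall j, j.+1 < size p -> simple_at A p j) ->
    {in min_reps I (I :\ s) &, forall x y, bruhat I x y || bruhat I y x}.
  by move=> simp; apply: chain; apply: (unique_ascents_A ca IS sI IE up p0 psh ps simp).
case: (ltnP j0.+1 (size p)) => [ltj|lej]; last first.
  constructor 2; apply: simple_chain => j ltj; apply: sim => //.
  by apply: contraTneq ltj => ->; rewrite -leqNgt.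
have [p2|[ab big]] := dbl ltj.
  constructor 2; apply: chain; apply: (unique_ascents_rank2 ca IS sI (a := nth 1 p 0) (b := nth 1 p 1)).
  by rewrite IE; apply/setP => x; case: (p) p2 => [|a [|b []]] //= _; rewrite !inE.
have pD : {subset p <= D}.
  by move=> x xp; apply: (subsetP (component_sub IS sI conn)); rewrite IE inE.
have adjp i : i.+1 < size p -> A (nth 1 p i) (nth 1 p i.+1) != 0%N.
  by move=> /(path_adj lp)/(adjP ca)[].
have mult : (A (nth 1%g p j0) (nth 1%g p j0.+1) * A (nth 1%g p j0.+1) (nth 1%g p j0) != 1)%N.
  by rewrite ab.
have [q [uq qsh [DE qs] [le e] [qsim q4]]] :=
  component_multiple_path ca leaf up pD ltj ps adjp mult.
have qab : (A (nth 1%g q j0) (nth 1%g q j0.+1) * A (nth 1%g q j0.+1) (nth 1%g q j0))%N = 2.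
  by rewrite -!e ?(ltnW ltj).
case: (eqVneq (size p) 2) => [p2|np2].
  constructor 2; apply: chain; apply: (unique_ascents_rank2 ca IS sI (a := nth 1 p 0) (b := nth 1 p 1)).
  by rewrite IE; apply/setP => x; case: (p) p2 => [|a [|b []]] //= _; rewrite !inE.
(* The double bond touches s: a spin quotient of type B, hence case (5). *)
case: (posnP j0) => [j00|j0pos].
  rewrite j00 in sim ab ltj qab qsim q4.
  have m2 : 2 < size p by move: ltj np2; slia.
  have vE := spinB_palindromic ca IS sI JS KE vI vm pal full IE up m2 psh ps sim ab asc.
  constructor 4; exists (size q), q; split; last 1 first.
  - exists (size p).-1; first by rewrite subn1 -!subn1 leq_sub2r.
    by rewrite vE prednK //; apply: eq_big_nat => i /andP[_ lti]; apply: e.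
  - split; first exact: leq_trans ltj le.
    apply: (path_diagramE ca DE uq DS qsh).
      by rewrite /= size_nseq; move: ltj le; slia.
    move=> [|i] lti /=; first by right.
    have [-> ->] := qsim i.+1 lti isT; left; split=> //.
    by rewrite nth_nseq; have -> : i < (size q).-2 by slia.
  - by rewrite qs.
(* A double bond at the end away from s gives a chain; an inner one leaves only F4. *)
case: (ltnP j0.+2 (size p)) => [ltj2|lej2]; last first.
  have jE : j0 = (size p).-2 by move: ltj lej2; slia.
  constructor 2; apply: chain; apply: (unique_ascents_B ca IS sI IE up p0 psh ps).
  - by apply: leq_ltn_trans ltj.
  - by rewrite -jE.
  - have -> : (size p).-1 = j0.+1 by move: ltj lej2; slia.
    exact: ab.
have p4 := big j0pos ltj2.
have j01 : j0 = 1%N by move: j0pos ltj2; rewrite p4; slia.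
rewrite j01 in sim ab qab qsim q4.
have qs4 : size q = 4 by apply: q4 => //; rewrite (leq_trans _ le) // p4.
have vE : v = \prod_(0 <= j < 4) nth 1 p j.
  apply: (F4_palindromic ca IS sI JS KE vI vm pal full asc IE up psh p4 ps) => //.
    by apply: sim; rewrite ?p4.
  by apply: sim; rewrite ?p4.
have qE : q = [:: nth 1 q 0; nth 1 q 1; nth 1 q 2; nth 1 q 3].
  by case: (q) qs4 => [|a [|b [|c [|d []]]]].
constructor 3; exists (nth 1 q 0), (nth 1 q 1), (nth 1 q 2), (nth 1 q 3); split.
- rewrite /typeF4 -qE; apply: (path_diagramE ca DE uq DS qsh); first by rewrite qs4.
  rewrite qs4 => -[|[|[|i]]] lti //=.
  + by left; have [-> ->] : simple_at A q 0 by apply: qsim; rewrite ?qs4.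
  + by right.
  + by left; have [-> ->] : simple_at A q 2 by apply: qsim; rewrite ?qs4.
- by rewrite qs.
- by rewrite vE !big_nat_recr //= big_nil mul1g !e ?p4.
Qed.

(** Comparable elements of equal length coincide, so every rank below v is a singleton. *)
Lemma palindromic_of_local_chain : in_local_chain S J v -> palindromic S J v.
Proof.
rewrite /in_local_chain /=.
have IS := simple_support_sub S v; have vI := simple_support_gen ca vS.
move: (simple_support S v) IS vI => I IS vI chain.
apply: (palindromic_of_chain ca JS vm) => x y.
rewrite !(mem_lower_interval ca JS IS _ vI) => /andP[xX _] /andP[yX _] e.
have gI z : z \in min_reps I (I :&: J) -> z \in <<I>> by rewrite inE => /andP[].
have lenE := cox_length_K ca IS.
case/orP: (chain x y xX yX) => /bruhat_len[] //; rewrite !lenE ?gI // e ltnn //.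
Qed.

Lemma path_diagram_commute ms (C : {set W}) (l : seq W) i j : path_diagram ms C l ->
  C \subset S -> i < j < size l -> i.+1 < j -> commute (nth 1 l i) (nth 1 l j).
Proof.
case=> ul CE sz ord CS /andP[lij ltj] lij1; have lti := ltn_trans lij ltj.
have lS k : k < size l -> nth 1 l k \in S.
  by move=> ltk; apply: (subsetP CS); rewrite CE inE mem_nth.
apply/eqP; rewrite -(order_le2 ca) ?lS ?nth_uniq ?(ltn_eqF lij) //.
by rewrite ord ?lij // gtn_eqF.
Qed.

Lemma path_diagram_take_palindromic ms (C : {set W}) (l : seq W) k : path_diagram ms C l ->
  C \subset S -> nth 1 l 0 = s -> k < size l -> v = \prod_(0 <= i < k.+1) nth 1 l i ->
  palindromic S J v.
Proof.
move=> pd CS l0 ltk; have [ul CE sz _] := pd.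
have -> : \prod_(0 <= i < k.+1) nth 1 l i = wprod (take k.+1 l).
  rewrite /wprod (big_nth 1) size_takel //.
  by apply: eq_big_nat => i /andP[_ lti]; rewrite nth_take.
move=> vE; rewrite vE; apply: (path_word_palindromic ca) => //.
- by apply/allP => x /mem_take xl; apply: (subsetP CS); rewrite CE inE.
- exact: take_uniq.
- by rewrite -vE.
- by move: l0 ltk; case: (l).
- move=> i j; rewrite size_takel // => /andP[lij ltj] lij1.
  rewrite !nth_take // ?(ltn_trans lij) //.
  by apply: (path_diagram_commute pd CS) => //; rewrite lij (leq_trans ltj).
Qed.

(** Serves case (3), whose word runs through the diagram from its last node. *)
Lemma path_diagram_rev_palindromic ms (C : {set W}) (l : seq W) : path_diagram ms C l ->
  C \subset S -> nth 1 (rev l) 0 = s -> v = \prod_(x <- rev l) x -> palindromic S J v.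
Proof.
move=> pd CS l0; have [ul CE sz _] := pd; rewrite -/(wprod (rev l)) => vE.
rewrite vE; apply: (path_word_palindromic ca) => //.
- by apply/allP => x; rewrite mem_rev => xl; apply: (subsetP CS); rewrite CE inE.
- by rewrite rev_uniq.
- by rewrite -vE.
- have: 0 < size (rev l) by rewrite size_rev sz.
  by move: l0; case: (rev l).
- move=> i j; rewrite size_rev => /andP[lij ltj] lij1.
  rewrite !nth_rev // ?(ltn_trans lij) //; apply: commute_sym.
  by apply: (path_diagram_commute pd CS); move: lij ltj lij1; slia.
Qed.

Lemma removed_node t : t \in S -> S :\ s = S :\ t -> t = s.
Proof. by move=> tS /setP/(_ t); rewrite !inE eqxx tS andbT => /negbFE/eqP. Qed.

End Characterization.


(* The types F4 and B_n are asked of the irreducible factor of W that contains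
   s; it is W itself when W is irreducible. *)
Theorem mainTheorem3 (R : realFieldType) (W : finGroupType) (S : {set W})
    (hW : weyl_group R S) (s : W) (hs : dynkin_leaf S s)
    (J : {set W}) (hJ : J = S :\ s) (v : W) (hv : v \in min_reps S J) :
  palindromic S J v <->
  [\/ locally_longest S J v,
      in_local_chain S J v,
      (exists s1 s2 s3 s4 : W,
        [/\ typeF4 (dynkin_component S s) s1 s2 s3 s4,
            J = S :\ s4 & v = s4 * s3 * s2 * s1])
    | (exists s1 s2 s3 s4 : W,
        [/\ typeF4 (dynkin_component S s) s1 s2 s3 s4,
            J = S :\ s1 & v = s1 * s2 * s3 * s4])
      \/
      (exists (n : nat) (l : seq W),
        [/\ typeB n (dynkin_component S s) l,
            J = S :\ nth 1 l 0
          & exists2 k : nat, k <= n - 1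
              & v = \prod_(0 <= i < k.+1) nth 1 l i])].
Proof.
have [n [Phi [Delta [rG [[rPhi rDelta] fG reflG genG SE]]]]] := hW.
have [A [M ca]] := weyl_cartan_action rPhi rDelta fG reflG genG SE.
subst J; have DS : dynkin_component S s \subset S.
  by apply/subsetP => x; rewrite inE => /andP[].
have lS ms l i : path_diagram ms (dynkin_component S s) l -> i < size l -> nth 1 l i \in S.
  by case=> _ DE _ _ lti; apply: (subsetP DS); rewrite DE inE mem_nth.
split=> [/(palindromic_cases ca hs hv)[ll|ch|f4|b]|[[_ vI vmax]|ch|f4|[f4|b]]].
- by constructor 1.
- by constructor 2.
- by constructor 4; left.
- by constructor 4; right.
- have vS : v \in <<S>> by move: hv; rewrite inE => /andP[].
  exact: (palindromic_longest ca (subsetDl S [set s]) (simple_support_sub S v)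
            (simple_support_gen ca vS) vI vmax).
- exact: (palindromic_of_local_chain ca hv ch).
- have [s1 [s2 [s3 [s4 [pd JE vE]]]]] := f4.
  apply: (path_diagram_rev_palindromic ca hv pd DS).
    exact: (removed_node (lS _ _ 3 pd isT) JE).
  by rewrite vE !big_cons big_nil mulg1 !mulgA.
- have [s1 [s2 [s3 [s4 [pd JE vE]]]]] := f4.
  apply: (path_diagram_take_palindromic ca hv (k := 3) pd DS) => //.
    exact: (removed_node (lS _ _ 0 pd isT) JE).
  by rewrite vE !big_nat_recr //= big_nil mul1g.
- have [m [l [[m1 pd] JE [k lek vE]]]] := b; have [_ _ sz _] := pd.
  apply: (path_diagram_take_palindromic ca hv (k := k) pd DS _ _ vE).
    by apply: (removed_node (lS _ _ 0 pd _) JE); rewrite sz.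
  by rewrite sz /= size_nseq; move: m1 lek; slia.
Qed.
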